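(* Write $\mathcal{D}=\mathcal{D}_q(\mathfrak{b}_{m,n})$ and $\mathcal{D}^0=\mathcal{D}_q(\mathfrak{b}_{m,n})^0$. The set of prime ideals of $\mathcal{D}$ is $$\mathrm{Spec}(\mathcal{D})=\{(0),\ \mathcal{D}^0I_1,\ \mathcal{D}^0I_2,\ \mathcal{D}^0I_3\}\cup\{\mathcal{D}^0J_1(z),\ \mathcal{D}^0J_2(z)\mid z\in\mathbb{K}^*\}.$$ All the containments among the prime ideals of $\mathcal{D}$ are those generated (by reflexivity and transitivity) by $$(0)\subset \mathcal{D}^0I_1,\quad (0)\subset \mathcal{D}^0I_2,\quad \mathcal{D}^0I_1\subset \mathcal{D}^0I_3,\quad \mathcal{D}^0I_2\subset \mathcal{D}^0I_3,$$ $$\mathcal{D}^0I_1\subset \mathcal{D}^0J_2(z),\quad \mathcal{D}^0I_2\subset \mathcal{D}^0J_1(z)\qquad(z\in\mathbb{K}^* ).$$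
   Context: $\mathbb{K}$ is an algebraically closed field of characteristic zero, $\mathbb{K}^*=\mathbb{K}\setminus\{0\}$, $q\in\mathbb{K}^*$ is not a root of unity, and $m,n$ are nonzero integers with $d=\gcd(m,n)$. The Heisenberg double $\mathcal{D}_q(\mathfrak{b}_{m,n})$ is the unital associative $\mathbb{K}$-algebra generated by $a,a^{-1},b,c,K,K^{-1},E,F$ subject to the relations $ab=q^nba$, $ac=q^mca$, $bc=cb$, $aa^{-1}=a^{-1}a=1$; $KE=q^{2m}EK$, $KF=q^{-2n}FK$, $EF=FE$, $KK^{-1}=K^{-1}K=1$; $Ka=q^{-1}aK$, $Kb=q^nbK$, $Kc=q^{-m}cK$; $Ea=aE$, $Eb=bE$, $Ec=cE+a^{-m}K^m$; $Fa=q^naF$, $Fb=q^{-n^2}bF+a^n$, $Fc=q^{mn}cF$. $\mathcal{D}_q(\mathfrak{b}_{m,n})^0$ is the subalgebra generated by $K^{\pm1},a^{\pm1}$. Put $b'=a^nbK^{-n}$, $c'=a^{-m}cK^{-m}$, $E'=a^{2m}E$, $F'=q^{-n^2}a^{-2n}FK^n$, and let $S$ be the subalgebra generated by $b',c',E',F'$. Elements of $S$ commute with $K$ and $a$, and $\mathcal{D}_q(\mathfrak{b}_{m,n})\cong\mathcal{D}_q(\mathfrak{b}_{m,n})^0\otimes S$. For an ideal $I$ of $S$, $\mathcal{D}_q(\mathfrak{b}_{m,n})^0I$ denotes the span of all products $xy$ with $x\in\mathcal{D}_q(\mathfrak{b}_{m,n})^0$, $y\in I$. Put $\phi_1=E'c'-c'E'$,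 $\phi_2=F'b'-b'F'$, $I_1=S\phi_1$, $I_2=S\phi_2$, $I_3=I_1+I_2$. For $z\in\mathbb{K}^*$: if $mn>0$, $J_1(z)=S(\phi_1^{|n|/d}-zb'^{|m|/d})+S\phi_2$ and $J_2(z)=S\phi_1+S(\phi_2^{|m|/d}-zc'^{|n|/d})$; if $mn<0$, $J_1(z)=S(\phi_1^{|n|/d}-zF'^{|m|/d})+S\phi_2$ and $J_2(z)=S\phi_1+S(\phi_2^{|m|/d}-zE'^{|n|/d})$. A prime ideal of a ring $R$ is a proper two-sided ideal $\mathfrak{p}$ such that for all two-sided ideals $\mathfrak{i},\mathfrak{j}$ of $R$, $\mathfrak{i}\mathfrak{j}\subseteq\mathfrak{p}$ implies $\mathfrak{i}\subseteq\mathfrak{p}$ or $\mathfrak{j}\subseteq\mathfrak{p}$. *)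

(* Defs.v *)
From HB Require Import structures.
From mathcomp Require Import all_boot all_order all_algebra.
From mathcomp Require Import generic_quotient ring_quotient.
From mathcomp Require Import boolp classical_sets.
From mathcomp Require Import monalg.
From Stdlib Require Import Relation_Operators.

Set Implicit Arguments.
Unset Strict Implicit.
Unset Printing Implicit Defensive.

Import GRing.Theory.
Local Open Scope classical_set_scope.
Local Open Scope quotient_scope.
Local Open Scope ring_scope.

Definition two_sided_ideal (A : pzRingType) (I : set A) : Prop :=
  zmod_closed (mem I) /\ (forall a x : A, I x -> I (a * x) /\ I (x * a)).

Definition ideal_mul (A : pzRingType) (I J : set A) : set A :=
  smallest (fun W : set A => zmod_closed (mem W)) [set x * y | x in I & y in J].

Definition prime_ideal (A : pzRingType) (P : set A) : Prop :=
  [/\ two_sided_ideal P, P <> [set: A] &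
      forall I J : set A, two_sided_ideal I -> two_sided_ideal J ->
        ideal_mul I J `<=` P -> I `<=` P \/ J `<=` P].

Definition lin_span (k : fieldType) (V : lmodType k) (X : set V) : set V :=
  smallest (fun W : set V => submod_closed (mem W)) X.

(* k<G | R>, the free algebra on G (the monoid algebra of the free monoid)
   modulo the two-sided ideal generated by R. The quotient is a pzRingType and
   an lmodType k, tied together by pres_scalerAl and pres_scalerAr. It is not
   declared an algType, since MathComp's algebras are required to be nonzero
   and k<G | R> may vanish for special R. *)
Section PresentedAlgebra.
Context (k : fieldType) (G : choiceType).

Local Notation free_alg := {malg k[{fmonom G}]}.

Definition free_gen (g : G) : free_alg := << fmu g >>.

Context (R : set free_alg).

Definition rel_ideal : set free_alg := smallest (@two_sided_ideal free_alg) R.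

Lemma rel_ideal_two_sided : two_sided_ideal rel_ideal.
Proof.
split=> [|a x Ix]; last first.
  by split=> J JR; have [[_ /(_ a x (Ix J JR))[]]] := JR.
split=> [|x y]; rewrite ?inE.
  by move=> J [[[+ _] _] _]; rewrite inE.
move=> Ix Iy J JR; have [[[_ JB] _] _] := JR.
by have := JB x y; rewrite !inE; apply; [apply: Ix | apply: Iy].
Qed.

Definition rel_pred : {pred free_alg} := mem rel_ideal.

Lemma rel_pred_zmod_closed : zmod_closed rel_pred.
Proof. exact: rel_ideal_two_sided.1. Qed.

HB.instance Definition _ :=
  GRing.isZmodClosed.Build free_alg rel_pred rel_pred_zmod_closed.

Definition pres_alg : Type := Quotient.quot rel_pred.

HB.instance Definition _ := GRing.Zmodule.on pres_alg.

Definition pres_pi (x : free_alg) : pres_alg := \pi_(Quotient.quot rel_pred) x.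

Definition pres_repr (u : pres_alg) : free_alg :=
  repr (u : Quotient.quot rel_pred).

Lemma pres_reprK : cancel pres_repr pres_pi.
Proof. by move=> u; rewrite /pres_pi /pres_repr reprK. Qed.

Lemma pres_piP (x y : free_alg) : pres_pi x = pres_pi y <-> rel_ideal (x - y).
Proof.
rewrite /pres_pi; split=> [/eqP|Ixy].
  by rewrite -Quotient.idealrBE /rel_pred inE.
by apply/eqP; rewrite -Quotient.idealrBE /rel_pred inE.
Qed.

Lemma pres_piD (x y : free_alg) : pres_pi (x + y) = pres_pi x + pres_pi y.
Proof. exact: Quotient.pi_add. Qed.

Lemma pres_piN (x : free_alg) : pres_pi (- x) = - pres_pi x.
Proof. exact: Quotient.pi_opp. Qed.

Lemma pres_pi0 : pres_pi 0 = 0.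
Proof. by rewrite -(subrr (0 : free_alg)) pres_piD pres_piN subrr. Qed.

Definition pres_one : pres_alg := pres_pi 1.
Definition pres_mul (u v : pres_alg) : pres_alg :=
  pres_pi (pres_repr u * pres_repr v).
Definition pres_scale (c : k) (u : pres_alg) : pres_alg :=
  pres_pi (c *: pres_repr u).

Lemma rel_idealD (x y : free_alg) :
  rel_ideal x -> rel_ideal y -> rel_ideal (x + y).
Proof.
by move=> Ix Iy; have := @rpredD _ rel_pred x y; rewrite /rel_pred !inE; apply.
Qed.

Lemma pres_reprB (x : free_alg) : rel_ideal (pres_repr (pres_pi x) - x).
Proof. by apply/pres_piP; rewrite pres_reprK. Qed.

Lemma pres_pi_mul (x y : free_alg) :
  pres_pi (x * y) = pres_mul (pres_pi x) (pres_pi y).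
Proof.
symmetry; apply/pres_piP; set x' := pres_repr _; set y' := pres_repr _.
have -> : x' * y' - x * y = x' * (y' - y) + (x' - x) * y.
  by rewrite mulrBr mulrBl addrA subrK.
have [_ I_ideal] := rel_ideal_two_sided.
apply: rel_idealD; first by have [] := I_ideal x' _ (pres_reprB y).
by have [] := I_ideal y _ (pres_reprB x).
Qed.

Lemma pres_pi_scale (c : k) (x : free_alg) :
  pres_pi (c *: x) = pres_scale c (pres_pi x).
Proof.
symmetry; apply/pres_piP; rewrite -scalerBr -mul_malgC.
by have [_ /(_ c%:MP _ (pres_reprB x))[]] := rel_ideal_two_sided.
Qed.

Lemma pres_mulA : associative pres_mul.
Proof.
move=> u v w; rewrite -[u]pres_reprK -[v]pres_reprK -[w]pres_reprK.
by rewrite -!pres_pi_mul mulrA.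
Qed.

Lemma pres_mul1l : left_id pres_one pres_mul.
Proof. by move=> u; rewrite -[u]pres_reprK -pres_pi_mul mul1r. Qed.

Lemma pres_mul1r : right_id pres_one pres_mul.
Proof. by move=> u; rewrite -[u]pres_reprK -pres_pi_mul mulr1. Qed.

Lemma pres_mulDl : left_distributive pres_mul +%R.
Proof.
move=> u v w; rewrite -[u]pres_reprK -[v]pres_reprK -[w]pres_reprK.
by rewrite -pres_piD -!pres_pi_mul mulrDl pres_piD.
Qed.

Lemma pres_mulDr : right_distributive pres_mul +%R.
Proof.
move=> u v w; rewrite -[u]pres_reprK -[v]pres_reprK -[w]pres_reprK.
by rewrite -pres_piD -!pres_pi_mul mulrDr pres_piD.
Qed.

HB.instance Definition _ := GRing.Zmodule_isPzRing.Build pres_alg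
  pres_mulA pres_mul1l pres_mul1r pres_mulDl pres_mulDr.

Lemma pres_scalerA (a b : k) (u : pres_alg) :
  pres_scale a (pres_scale b u) = pres_scale (a * b) u.
Proof. by rewrite -[u]pres_reprK -!pres_pi_scale scalerA. Qed.

Lemma pres_scale1r : left_id 1 pres_scale.
Proof. by move=> u; rewrite -[u]pres_reprK -pres_pi_scale scale1r. Qed.

Lemma pres_scalerDr : right_distributive pres_scale +%R.
Proof.
move=> c u v; rewrite -[u]pres_reprK -[v]pres_reprK.
by rewrite -pres_piD -!pres_pi_scale scalerDr pres_piD.
Qed.

Lemma pres_scalerDl (u : pres_alg) :
  {morph pres_scale^~ u : a b / a + b >-> a + b}.
Proof.
move=> a b; rewrite -[u]pres_reprK.
by rewrite -!pres_pi_scale scalerDl pres_piD.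
Qed.

HB.instance Definition _ := GRing.Zmodule_isLmodule.Build k pres_alg
  pres_scalerA pres_scale1r pres_scalerDr pres_scalerDl.

Lemma pres_pi1 : pres_pi 1 = 1. Proof. by []. Qed.

Lemma pres_piM (x y : free_alg) : pres_pi (x * y) = pres_pi x * pres_pi y.
Proof. exact: pres_pi_mul. Qed.

Lemma pres_piZ (c : k) (x : free_alg) : pres_pi (c *: x) = c *: pres_pi x.
Proof. exact: pres_pi_scale. Qed.

Lemma pres_pi_rel (x : free_alg) : R x -> pres_pi x = 0.
Proof.
by move=> Rx; rewrite -pres_pi0; apply/pres_piP; rewrite subr0; apply: sub_gen_smallest.
Qed.

Lemma free_scalerAr (c : k) (x y : free_alg) : c *: (x * y) = x * (c *: y).
Proof.
have mulrC_cst : x * c%:MP = c *: x.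
  rewrite malgM_def malgZ_def fgmulgU.
  by apply: eq_bigr => l _; rewrite mulm1 mulrC.
by rewrite -[c *: (x * y)]mul_malgC mulrA mul_malgC -mulrC_cst -mulrA mul_malgC.
Qed.

Lemma pres_scalerAl (c : k) (u v : pres_alg) : c *: (u * v) = (c *: u) * v.
Proof.
rewrite -[u]pres_reprK -[v]pres_reprK.
by rewrite -pres_piM -!pres_piZ -pres_piM scalerAl.
Qed.

Lemma pres_scalerAr (c : k) (u v : pres_alg) : c *: (u * v) = u * (c *: v).
Proof.
rewrite -[u]pres_reprK -[v]pres_reprK.
by rewrite -pres_piM -!pres_piZ -pres_piM free_scalerAr.
Qed.

Definition subalgebra (B : set pres_alg) : Prop :=
  [/\ B 1, submod_closed (mem B) & GRing.mulr_2closed (mem B)].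

Definition subalg_gen (X : set pres_alg) : set pres_alg := smallest subalgebra X.

End PresentedAlgebra.

(* x ^ z for z : int, given an element y standing for x^-1. *)
Definition zpow (A : pzRingType) (x y : A) (z : int) : A :=
  match z with Posz r => x ^+ r | Negz r => y ^+ r.+1 end.

Variant hd_gen := Ga | Gai | Gb | Gc | GK | GKi | GE | GF.

HB.instance Definition _ := gen_eqMixin hd_gen.
HB.instance Definition _ := gen_choiceMixin hd_gen.

Section HeisenbergDouble.
Context (k : fieldType) (q : k) (m n : int).

Definition hd_relations : seq ({malg k[{fmonom hd_gen}]} * {malg k[{fmonom hd_gen}]}) :=
  let X := @free_gen k hd_gen in
  let a := X Ga in let ai := X Gai in let b := X Gb in let c := X Gc in
  let K := X GK in let Ki := X GKi in let E := X GE in let F := X GF in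
  [:: (a * b, q ^ n *: (b * a)); (a * c, q ^ m *: (c * a)); (b * c, c * b);
      (a * ai, 1); (ai * a, 1);
      (K * E, q ^ (2 * m) *: (E * K)); (K * F, q ^ (- (2 * n)) *: (F * K));
      (E * F, F * E); (K * Ki, 1); (Ki * K, 1);
      (K * a, q^-1 *: (a * K)); (K * b, q ^ n *: (b * K));
      (K * c, q ^ (- m) *: (c * K));
      (E * a, a * E); (E * b, b * E);
      (E * c, c * E + zpow a ai (- m) * zpow K Ki m);
      (F * a, q ^ n *: (a * F));
      (F * b, q ^ (- (n * n)) *: (b * F) + zpow a ai n);
      (F * c, q ^ (m * n) *: (c * F))].

Definition hd : Type :=
  pres_alg [set p.1 - p.2 | p in [set p | p \in hd_relations]].
HB.instance Definition _ := GRing.PzRing.on hd.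
HB.instance Definition _ := GRing.Lmodule.on hd.

Definition hd_elt (g : hd_gen) : hd := pres_pi _ (free_gen k g).

Local Notation a := (hd_elt Ga).
Local Notation ai := (hd_elt Gai).
Local Notation b := (hd_elt Gb).
Local Notation c := (hd_elt Gc).
Local Notation K := (hd_elt GK).
Local Notation Ki := (hd_elt GKi).
Local Notation E := (hd_elt GE).
Local Notation F := (hd_elt GF).

Definition hd0 : set hd := subalg_gen [set K; Ki; a; ai].

Definition b' : hd := zpow a ai n * b * zpow K Ki (- n).
Definition c' : hd := zpow a ai (- m) * c * zpow K Ki (- m).
Definition E' : hd := zpow a ai (2 * m) * E.
Definition F' : hd :=
  q ^ (- (n * n)) *: (zpow a ai (- (2 * n)) * F * zpow K Ki n).

Definition hdS : set hd := subalg_gen [set b'; c'; E'; F'].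

Definition hd0_mul (I : set hd) : set hd :=
  lin_span [set x * y | x in hd0 & y in I].

Definition S_mul (x : hd) : set hd := [set s * x | s in hdS].
Definition set_add (I J : set hd) : set hd := [set x + y | x in I & y in J].

Definition phi1 : hd := E' * c' - c' * E'.
Definition phi2 : hd := F' * b' - b' * F'.

Definition I1 : set hd := S_mul phi1.
Definition I2 : set hd := S_mul phi2.
Definition I3 : set hd := set_add I1 I2.

Definition m_d : nat := (`|m| %/ `|gcdz m n|)%N.
Definition n_d : nat := (`|n| %/ `|gcdz m n|)%N.

Definition J1 (z : k) : set hd :=
  set_add (S_mul (phi1 ^+ n_d - z *: (if 0 < m * n then b' else F') ^+ m_d))
          (S_mul phi2).
Definition J2 (z : k) : set hd :=
  set_add (S_mul phi1)
          (S_mul (phi2 ^+ m_d - z *: (if 0 < m * n then c' else E') ^+ n_d)).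

(* Names for the listed primes. Generating the containments on names rather
   than on ideals keeps differently named primes apart: were two of the ideals
   to coincide, the generated relation on names would fail to describe
   inclusion. *)
Variant hd_label :=
  | L0 | LI1 | LI2 | LI3
  | LJ1 of {z : k | z != 0} | LJ2 of {z : k | z != 0}.

Definition hd_prime (i : hd_label) : set hd :=
  match i with
  | L0 => [set 0]
  | LI1 => hd0_mul I1
  | LI2 => hd0_mul I2
  | LI3 => hd0_mul I3
  | LJ1 z => hd0_mul (J1 (val z))
  | LJ2 z => hd0_mul (J2 (val z))
  end.

Variant hd_cover : hd_label -> hd_label -> Prop :=
  | cover_0_I1 : hd_cover L0 LI1
  | cover_0_I2 : hd_cover L0 LI2
  | cover_I1_I3 : hd_cover LI1 LI3
  | cover_I2_I3 : hd_cover LI2 LI3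
  | cover_I1_J2 z : hd_cover LI1 (LJ2 z)
  | cover_I2_J1 z : hd_cover LI2 (LJ1 z).

End HeisenbergDouble.

Arguments hd0 {k} q m n _.
Arguments hdS {k} q m n _.
Arguments I1 {k} q m n _.
Arguments I2 {k} q m n _.
Arguments I3 {k} q m n _.
Arguments J1 {k} q m n z _.
Arguments J2 {k} q m n z _.
Arguments hd_prime {k} q m n i _.

(* Main.v *)
Require Import Defs.
From HB Require Import structures.
From mathcomp Require Import all_boot all_order all_algebra.
From mathcomp Require Import boolp classical_sets.
From mathcomp Require Import monalg ring zify.
From Stdlib Require Import Relation_Operators.

(** The algebra [A] (the double) is a quantum torus generated by [a], [K] tensored
    with [S], and [S] consists of two deformed Weyl algebras: after rescaling,
    [d = (1 - al) E'] and [f = (1 - be) F'] satisfy [d c' = (1 - al) + al c' d] and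
    [f b' = (1 - be) + be b' f], where [al] and [be] are powers of [q] that are
    not roots of unity, while elements of different pairs commute up to powers of
    [p = q ^ (2 m n)]. In these terms [phi1 = 1 - c' d] and [phi2 = 1 - b' f] commute
    up to scalars with every generator, so they are normal elements and a prime
    ideal which avoids one of them is saturated under it. The spectrum is cut
    into four strata, according to which of [phi1], [phi2] a prime contains.

    One device does most of the work. Suppose that the terms of a sum [x] commute
    with [w] up to scalars, their weights. If [x] lies in a two-sided ideal
    saturated under [w], so does each weight component of [x] ([weight_sep]). It
    extends to the powers of [c'] and [d], although [c'] is neither normal nor
    invertible ([weyl_sep]). As [A] is spanned by monomials in [a], [K], the
    powers of each pair, [phi1] and [phi2] ([monomials_span]), an ideal is
    decomposed weight by weight:

    - Neither element is in the prime [P]: all weights separate, and a nonzero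
      element of [P] would yield [1] ([generic_simple]). So [P = 0]; and [0] is
      prime because a nonzero ideal contains a power of [phi1 phi2] ([zero_prime]).

    - Both are in [P]: modulo them each pair consists of two inverse elements, the
      weights again separate, and [A phi1 + A phi2] is maximal ([phi12_span_max]).

    - Only [phi1] is in [P]: then [d] is the inverse of [c'] and exactly one
      ratio of monomials, [Z = phi2 ^ M / c' ^ N], becomes central, where
      [M = |m| / gcd] and [N = |n| / gcd] (with [E'] in place of [c'] if
      [m n < 0]). So [P] is controlled by the polynomials in [Z] it contains
      ([ratio_content]): it is [A phi1] if there are none, and otherwise primeness
      and the closedness of the field put some [Z - z] in [P], and
      [A phi1 + A (Z - z)] is maximal ([prime_stratum]). The ideal [A phi1] is prime
      because two nonzero polynomials have a common nonroot ([phi1_span_prime]).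

    - Only [phi2] is in [P]: exchange the two pairs.

    For the containments, comparing which of [phi1], [phi2] the primes contain
    leaves only those inside one stratum and those from [J_i(z)] to [I_3]. The
    [J_i(z)] are pairwise incomparable, because [Z - z] and [Z - z'] differ by a
    nonzero scalar, and maximal.

    It remains to know that the ideals listed are proper and that [phi1 phi2] is
    not nilpotent. Both follow from representations of [A] by weighted shifts on
    functions of three integers, in which [phi1] and [phi2] act diagonally with
    eigenvalues that can be chosen to vanish or to form a geometric progression
    ([I3_proper], [J1_proper], [J2_proper], [phi_pow_neq0]). Finally [A = D^0 S] turns
    the spans [D^0 (S w)] of the statement into left ideals [A w]. *)

Set Implicit Arguments.
Unset Strict Implicit.
Unset Printing Implicit Defensive.

Import Order.TTheory GRing.Theory Num.Theory.
Local Open Scope classical_set_scope.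
Local Open Scope ring_scope.

(** * Ideals, left spans and primes *)

Section Ideals.
Context (A : pzRingType).
Implicit Types (P L : set A) (x y w : A).

Definition left_ideal L : Prop :=
  zmod_closed (mem L) /\ (forall a x, L x -> L (a * x)).

Lemma ideal_left P : two_sided_ideal P -> left_ideal P.
Proof. by case=> zP mP; split=> // a x /(mP a)[]. Qed.

Lemma lideal0 L : left_ideal L -> L 0.
Proof. by case=> [[+ _] _]; rewrite inE. Qed.

Lemma lidealB L x y : left_ideal L -> L x -> L y -> L (x - y).
Proof. by case=> [[_ LB] _]; have := LB x y; rewrite !inE; apply. Qed.

Lemma lidealN L x : left_ideal L -> L x -> L (- x).
Proof. by move=> lL Lx; rewrite -sub0r; apply: lidealB => //; apply: lideal0. Qed.

Lemma lidealD L x y : left_ideal L -> L x -> L y -> L (x + y).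
Proof. by move=> lL Lx Ly; rewrite -[y]opprK; apply: lidealB => //; apply: lidealN. Qed.

Lemma lideal_sum L (I : Type) (s : seq I) (Q : pred I) (X : I -> A) :
  left_ideal L -> (forall i, Q i -> L (X i)) -> L (\sum_(i <- s | Q i) X i).
Proof.
move=> lL LX; apply: (big_ind L) => //; first exact: lideal0.
by move=> x y; apply: lidealD.
Qed.

Lemma lideal_sub L x y : left_ideal L -> L (x - y) -> L y -> L x.
Proof. by move=> lL Lxy Ly; rewrite -(subrK y x); apply: lidealD. Qed.

Lemma lidealM L x y : left_ideal L -> L y -> L (x * y).
Proof. by case=> _; apply. Qed.

Lemma idealMr P x y : two_sided_ideal P -> P x -> P (x * y).
Proof. by case=> _ mP /(mP y)[]. Qed.

Lemma ideal1 P : two_sided_ideal P -> P 1 -> P = setT.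
Proof.
move=> iP P1; apply/seteqP; split=> // x _.
by rewrite -[x]mulr1; apply: lidealM => //; apply: ideal_left.
Qed.

Lemma ideal_proper P : two_sided_ideal P -> ~ P 1 <-> P <> [set: A].
Proof.
move=> iP; split=> [nP1 PT|PnT P1]; first by apply: nP1; rewrite PT.
by apply: PnT; apply: ideal1.
Qed.

Definition left_span1 w : set A := [set x | exists d, x = d * w].
Definition left_span2 v w : set A := [set x | exists d e, x = d * v + e * w].

Lemma left_span1_left w : left_ideal (left_span1 w).
Proof.
split; first split; rewrite ?inE; first by exists 0; rewrite mul0r.
  by move=> x y; rewrite !inE => -[d ->] [e ->]; exists (d - e); rewrite mulrBl.
by move=> a x [d ->]; exists (a * d); rewrite mulrA.
Qed.

Lemma left_span2_left v w : left_ideal (left_span2 v w).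
Proof.
split; first split; rewrite ?inE; first by exists 0, 0; rewrite !mul0r addr0.
  move=> x y; rewrite !inE => -[d [e ->]] [d' [e' ->]].
  by exists (d - d'), (e - e'); rewrite !mulrBl opprD addrACA.
by move=> a x [d [e ->]]; exists (a * d), (a * e); rewrite mulrDr !mulrA.
Qed.

Lemma left_span1_mem w : left_span1 w w.
Proof. by exists 1; rewrite mul1r. Qed.

Lemma left_span2_meml v w : left_span2 v w v.
Proof. by exists 1, 0; rewrite mul1r mul0r addr0. Qed.

Lemma left_span2_memr v w : left_span2 v w w.
Proof. by exists 0, 1; rewrite mul1r mul0r add0r. Qed.

Lemma left_span1_min L w : left_ideal L -> L w -> left_span1 w `<=` L.
Proof. by move=> lL Lw x [d ->]; apply: lidealM. Qed.

Lemma left_span2_min L v w :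
  left_ideal L -> L v -> L w -> left_span2 v w `<=` L.
Proof. by move=> lL Lv Lw x [d [e ->]]; apply: lidealD => //; apply: lidealM. Qed.

Lemma left_span1_ideal w :
  (forall x, left_span1 w (w * x)) -> two_sided_ideal (left_span1 w).
Proof.
move=> nw; have lL := left_span1_left w; split; first by case: lL.
move=> a x Lx; split; first exact: lidealM.
by case: Lx => d ->; rewrite -mulrA; apply: lidealM.
Qed.

Lemma left_span2_ideal v w :
  (forall x, left_span2 v w (v * x)) -> (forall x, left_span2 v w (w * x)) ->
  two_sided_ideal (left_span2 v w).
Proof.
move=> nv nw; have lL := left_span2_left v w; split; first by case: lL.
move=> a x Lx; split; first exact: lidealM.
case: Lx => d [e ->]; rewrite mulrDl -!mulrA.
by apply: lidealD => //; apply: lidealM.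
Qed.

(** The ideals [J = {y | u A y <= P}] and [I = {x | x J <= P}] are two-sided by
    construction and [I J <= P]; moreover [w] is in [J] and [P] contains [u] as
    soon as it contains [I]. This spares a description of the ideals generated by
    [u] and [w]. *)
Lemma prime_elim P u w : prime_ideal P -> (forall x, P (u * x * w)) -> P u \/ P w.
Proof.
case=> iP _ pP Puw; have lP := ideal_left iP.
pose J : set A := [set y | forall x, P (u * x * y)].
pose I : set A := [set x | forall y, J y -> P (x * y)].
have iJ : two_sided_ideal J.
  split; first split; rewrite ?inE.
  - by move=> x; rewrite mulr0; apply: lideal0.
  - move=> y y'; rewrite !inE => Jy Jy' x; rewrite mulrBr.
    exact: lidealB.
  move=> a y Jy; split=> x; rewrite mulrA; last exact: idealMr.
  by rewrite -(mulrA u); apply: Jy.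
have iI : two_sided_ideal I.
  split; first split; rewrite ?inE.
  - by move=> y _; rewrite mul0r; apply: lideal0.
  - move=> y y'; rewrite !inE => Iy Iy' x Jx; rewrite mulrBl.
    by apply: lidealB; auto.
  move=> a x Ix; split=> y Jy; rewrite -mulrA; first by apply: lidealM; auto.
  by apply: Ix; have [_ /(_ a _ Jy)[]] := iJ.
have [|IP|JP] := pP _ _ iI iJ.
- apply: smallest_sub; first by case: iP.
  by move=> _ [x Ix [y Jy <-]]; apply: Ix.
- by left; apply: IP => y /(_ 1); rewrite mulr1.
by right; apply: JP => x; apply: Puw.
Qed.

Lemma primeP P : two_sided_ideal P -> ~ P 1 ->
  (forall I J, two_sided_ideal I -> two_sided_ideal J ->
    (forall x y, I x -> J y -> P (x * y)) -> I `<=` P \/ J `<=` P) ->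
  prime_ideal P.
Proof.
move=> iP nP1 pP; split=> //; first by apply/ideal_proper.
move=> I J iI iJ IJP; apply: pP => // x y Ix Jy; apply: IJP.
by apply: sub_gen_smallest; exists x => //; exists y.
Qed.

(** If [I] and [J] are not inside [P], maximality gives [1 = y + z = y' + z'] with
    [y] in [I], [y'] in [J] and [z], [z'] in [P]; multiply the two expressions. *)
Lemma maximal_prime P : two_sided_ideal P -> ~ P 1 ->
  (forall Q, two_sided_ideal Q -> P `<=` Q -> ~ Q 1 -> Q `<=` P) ->
  prime_ideal P.
Proof.
move=> iP nP1 maxP; have lP := ideal_left iP.
pose add I : set A := [set x | exists y z, [/\ I y, P z & x = y + z]].
have key I : two_sided_ideal I -> ~ I `<=` P -> add I 1.
  move=> iI nIP; have lI := ideal_left iI.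
  have iaI : two_sided_ideal (add I).
    split; first split; rewrite ?inE.
    - by exists 0, 0; split; rewrite ?addr0 //; apply: lideal0.
    - move=> x x'; rewrite !inE => -[y [z [Iy Pz ->]]] [y' [z' [Iy' Pz' ->]]].
      exists (y - y'), (z - z'); rewrite opprD addrACA.
      by split=> //; apply: lidealB.
    move=> a x [y [z [Iy Pz ->]]]; rewrite mulrDr mulrDl.
    split; first by exists (a * y), (a * z); split=> //; apply: lidealM.
    by exists (y * a), (z * a); split=> //; apply: idealMr.
  apply: contrapT => naI; apply: nIP => x Ix; apply: (maxP (add I)) => //.
    by move=> z Pz; exists 0, z; rewrite add0r; split=> //; apply: lideal0.
  by exists x, 0; rewrite addr0; split=> //; apply: lideal0.
apply: primeP => // I J iI iJ IJP.
have [IP|/(key _ iI) [y [z [Iy Pz e1]]]] := pselect (I `<=` P); first by left.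
have [JP|/(key _ iJ) [y' [z' [Jy' Pz' e1']]]] := pselect (J `<=` P).
  by right.
case: nP1; rewrite -(mulr1 1) {1}e1 mulrDl; apply: lidealD => //.
  by rewrite e1' mulrDr; apply: lidealD => //; [apply: IJP | apply: lidealM].
exact: idealMr.
Qed.

(** Right cancellation of [w] modulo [P], the condition under which the weights
    of an element of [P] with respect to [w] can be separated. *)
Definition saturated P w : Prop := forall x, P (x * w) -> P x.

Lemma saturatedX P w n x : saturated P w -> P (x * w ^+ n) -> P x.
Proof.
move=> sPw; elim: n x => [|n IHn] x; first by rewrite mulr1.
by rewrite exprSr mulrA => /sPw/IHn.
Qed.

Lemma unit_saturated P w w' :
  two_sided_ideal P -> P (w * w' - 1) -> saturated P w.
Proof.
move=> iP Pw x /(idealMr w' iP) Pxw; have lP := ideal_left iP.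
have -> : x = x * w * w' - x * (w * w' - 1).
  by rewrite mulrBr mulr1 mulrA opprB addrC subrK.
by apply: lidealB => //; apply: lidealM.
Qed.

(** Normality of [w] modulo [P] moves it across [y] in [x y w]. *)
Lemma prime_saturated P w : prime_ideal P ->
  (forall x, exists y, P (x * w - w * y)) -> ~ P w -> saturated P w.
Proof.
move=> pP nw nPw x Pxw; have iP : two_sided_ideal P by case: pP.
have [y|//|//] := @prime_elim P x w pP.
have [y' Pyy'] := nw y; have lP := ideal_left iP.
rewrite -mulrA; apply: (@lideal_sub _ _ (x * (w * y'))) => //.
  by rewrite -mulrBr; apply: lidealM.
by rewrite mulrA; apply: idealMr.
Qed.

End Ideals.

(** * Commutation up to scalars *)

Section QCommutation.
Context (k : fieldType) (A : algType k).
Implicit Types (x y w : A) (l m : k) (P : set A).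

Lemma mulZl l x y : (l *: x) * y = l *: (x * y).
Proof. by rewrite scalerAl. Qed.

Lemma mulZr l x y : x * (l *: y) = l *: (x * y).
Proof. by rewrite scalerAr. Qed.

Lemma lidealZ P l x : left_ideal P -> P x -> P (l *: x).
Proof. by move=> lP Px; rewrite -[x]mul1r -mulZl; apply: lidealM. Qed.

Lemma lidealZK P l x : left_ideal P -> l != 0 -> P (l *: x) -> P x.
Proof.
by move=> lP l0 /(lidealZ l^-1 lP); rewrite scalerA mulVf // scale1r.
Qed.

Definition qcomm l w x : Prop := w * x = l *: (x * w).

Lemma qcommM l m w x y : qcomm l w x -> qcomm m w y -> qcomm (l * m) w (x * y).
Proof.
by rewrite /qcomm => wx wy; rewrite mulrA wx mulZl -mulrA wy mulZr scalerA mulrA.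
Qed.

Lemma qcomm1 w : qcomm 1 w 1.
Proof. by rewrite /qcomm mulr1 mul1r scale1r. Qed.

Lemma qcommC l w x : l != 0 -> qcomm l w x -> qcomm l^-1 x w.
Proof. by move=> l0; rewrite /qcomm => ->; rewrite scalerA mulVf // scale1r. Qed.

Lemma qcommMl l m w y x : qcomm l w x -> qcomm m y x -> qcomm (l * m) (w * y) x.
Proof.
rewrite /qcomm => wx yx.
by rewrite -mulrA yx mulZr mulrA wx mulZl scalerA mulrA (mulrC m).
Qed.

Lemma qcommX l w x n : qcomm l w x -> qcomm (l ^+ n) w (x ^+ n).
Proof.
move=> wx; elim: n => [|n IHn]; first exact: qcomm1.
by rewrite !exprS; apply: qcommM.
Qed.

Lemma qcommXl l w x n : qcomm l w x -> qcomm (l ^+ n) (w ^+ n) x.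
Proof.
move=> wx; elim: n => [|n IHn]; last by rewrite !exprS; apply: qcommMl.
by rewrite /qcomm mulr1 mul1r scale1r.
Qed.

Lemma qcommZ l m w x : qcomm l w x -> qcomm l w (m *: x).
Proof. by rewrite /qcomm => wx; rewrite mulZr wx mulZl !scalerA mulrC. Qed.

Lemma qcommZl l m w x : qcomm l w x -> qcomm l (m *: w) x.
Proof. by rewrite /qcomm => wx; rewrite mulZl wx mulZr !scalerA mulrC. Qed.

Lemma qcommD l w x y : qcomm l w x -> qcomm l w y -> qcomm l w (x + y).
Proof. by rewrite /qcomm => wx wy; rewrite mulrDr wx wy mulrDl scalerDr. Qed.

Lemma qcommB l w x y : qcomm l w x -> qcomm l w y -> qcomm l w (x - y).
Proof. by rewrite /qcomm => wx wy; rewrite mulrBr wx wy mulrBl scalerBr. Qed.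

Lemma qcommBl l w y x : qcomm l w x -> qcomm l y x -> qcomm l (w - y) x.
Proof. by rewrite /qcomm => wx yx; rewrite mulrBl wx yx mulrBr scalerBr. Qed.

Lemma qcomm_refl w : qcomm 1 w w.
Proof. by rewrite /qcomm scale1r. Qed.

Lemma qcomm_sum l w (I : Type) (s : seq I) (Q : pred I) (X : I -> A) :
  (forall i, Q i -> qcomm l w (X i)) -> qcomm l w (\sum_(i <- s | Q i) X i).
Proof.
move=> wX; apply: (big_ind (qcomm l w)) => //; last exact: qcommD.
by rewrite /qcomm mulr0 mul0r scaler0.
Qed.

Lemma qcomm_suml l x (I : Type) (s : seq I) (Q : pred I) (X : I -> A) :
  (forall i, Q i -> qcomm l (X i) x) -> qcomm l (\sum_(i <- s | Q i) X i) x.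
Proof.
move=> Xx; rewrite /qcomm mulr_suml mulr_sumr scaler_sumr.
by apply: eq_bigr => i /Xx.
Qed.

Lemma qcomm_zpow l w x y (z : int) :
  qcomm l w x -> qcomm l^-1 w y -> qcomm (l ^ z) w (zpow x y z).
Proof.
move=> wx wy; case: z => n; first exact: qcommX.
by rewrite /= NegzE -exprz_inv; apply: qcommX.
Qed.

Lemma qcomm_zpowl l w x y (z : int) :
  qcomm l x w -> qcomm l^-1 y w -> qcomm (l ^ z) (zpow x y z) w.
Proof.
move=> xw yw; case: z => n; first exact: qcommXl.
by rewrite /= NegzE -exprz_inv; apply: qcommXl.
Qed.

Lemma qcomm_inv l w x y : l != 0 -> x * y = 1 -> y * x = 1 ->
  qcomm l w x -> qcomm l^-1 w y.
Proof.
rewrite /qcomm => l0 xy yx wx.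
have := congr1 (fun u => l^-1 *: (y * u * y)) wx.
rewrite mulZr mulZl scalerA mulVf // scale1r -!mulrA xy mulr1.
by rewrite (mulrA y x) yx mul1r => ->.
Qed.

Lemma zpowS x y (z : int) : x * y = 1 -> y * x = 1 ->
  x * zpow x y z = zpow x y (z + 1).
Proof.
move=> xy yx; case: z => [n|[|n]].
- by rewrite -exprS -PoszD addn1.
- by rewrite /= expr1.
have -> : Negz n.+1 + 1 = Negz n by rewrite !NegzE; lia.
by rewrite /= exprS mulrA xy mul1r.
Qed.

Lemma zpow_opp x y (z : int) : zpow x y (- z) = zpow y x z.
Proof. by case: z => [[|n]|n]. Qed.

Lemma zpowP x y (z : int) : x * y = 1 -> y * x = 1 ->
  y * zpow x y z = zpow x y (z - 1).
Proof.
move=> xy yx; have := zpowS (- z) yx xy.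
by rewrite -zpow_opp opprK => ->; rewrite -zpow_opp opprD opprK.
Qed.

Lemma zpowD x y (z t : int) : x * y = 1 -> y * x = 1 ->
  zpow x y (z + t) = zpow x y z * zpow x y t.
Proof.
move=> xy yx; elim/int_rect: z => [|n IHn|n IHn].
- by rewrite add0r mul1r.
- by rewrite -addn1 PoszD -[_ + 1 + t]addrAC -!zpowS // IHn mulrA.
have -> : - n.+1%:Z = - n%:Z - 1 by rewrite -addn1 PoszD opprD.
by rewrite addrAC -!zpowP // IHn mulrA.
Qed.

Lemma zpowNl x y (z : int) : x * y = 1 -> y * x = 1 ->
  zpow x y (- z) * zpow x y z = 1.
Proof. by move=> xy yx; rewrite -zpowD // addNr. Qed.

(** For [y] in [P], the element [w y - l y w] of [P] has the same weight components
    as [y], each multiplied by its weight minus [l] and followed by [w]. Doing this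
    for all weights [l] other than [mu] leaves the component of weight [mu], up
    to a nonzero scalar. It is enough that the weights hold modulo [P]. *)
Lemma weight_sep P w mu (I : eqType) (s : seq I) (X : I -> A) (lam : I -> k) :
  two_sided_ideal P -> (forall i, P (w * X i - lam i *: (X i * w))) ->
  P (\sum_(i <- s) X i) ->
  exists n, P ((\sum_(i <- s | lam i == mu) X i) * w ^+ n).
Proof.
move=> iP wX PX; have lP := ideal_left iP.
(* [L] lists the weights removed so far *)
have kill (L : seq k) :
    P (\sum_(i <- s) (\prod_(m <- L) (lam i - m)) *: (X i * w ^+ size L)).
  elim: L => [|m L IHL].
    by under eq_bigr do rewrite big_nil scale1r mulr1.
  have := lidealB lP (lidealM w lP IHL) (lidealZ m lP (idealMr w iP IHL)).
  rewrite mulr_sumr mulr_suml scaler_sumr -sumrB => PL.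
  pose E i : A := (\prod_(m <- L) (lam i - m)) *:
    ((w * X i - lam i *: (X i * w)) * w ^+ size L).
  have PE : P (\sum_(i <- s) E i).
    by apply: lideal_sum => // i _; apply: lidealZ => //; apply: idealMr.
  have := lidealB lP PL PE; rewrite -sumrB; congr P; apply: eq_bigr => i _.
  rewrite mulZr mulZl !mulrA -!(mulrA _ _ w) -exprSr /E mulrBl scalerBr opprB.
  rewrite addrC addrA subrK mulZl -!mulrA -exprS !scalerA -scalerBl big_cons.
  by congr (_ *: _); ring.
pose L := [seq m <- map lam s | m != mu].
exists (size L); have := kill L.
pose nu := \prod_(m <- L) (mu - m).
have nu0 : nu != 0.
  rewrite prodf_seq_neq0; apply/allP => m; rewrite mem_filter => /andP[mmu _].
  by rewrite implyTb subr_eq0 eq_sym.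
rewrite (bigID (fun i => lam i == mu)) /= [X in _ + X]big1_seq ?addr0.
  rewrite (eq_bigr (fun i => nu *: (X i * w ^+ size L))); last first.
    by move=> i /eqP ->.
  by rewrite -scaler_sumr -mulr_suml; apply: lidealZK.
move=> i /andP[lmu si].
have Lli : lam i \in L by rewrite mem_filter lmu map_f.
by rewrite (big_rem _ Lli) /= subrr mul0r scale0r.
Qed.

Lemma weight_sep_sat P w mu (I : eqType) (s : seq I) (Q : pred I) (X : I -> A)
    (lam : I -> k) :
  two_sided_ideal P -> saturated P w ->
  (forall i, P (w * X i - lam i *: (X i * w))) ->
  P (\sum_(i <- s | Q i) X i) -> P (\sum_(i <- s | Q i && (lam i == mu)) X i).
Proof.
move=> iP sPw wX; rewrite -big_filter => /(weight_sep mu iP wX)[n].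
by rewrite big_filter_cond; apply: saturatedX.
Qed.

Lemma qcomm_mod P l w x : two_sided_ideal P -> qcomm l w x ->
  P (w * x - l *: (x * w)).
Proof. by move=> /ideal_left lP ->; rewrite subrr; apply: lideal0. Qed.

Lemma qcomm_push l w x y : qcomm l w x -> w * (x * y) = l *: (x * (w * y)).
Proof. by move=> wx; rewrite mulrA wx mulZl -mulrA. Qed.

Lemma qcomm1_push w x y : qcomm 1 w x -> w * (x * y) = x * (w * y).
Proof. by move=> wx; rewrite (qcomm_push _ wx) scale1r. Qed.

Lemma qcomm1M w x y : qcomm 1 w x -> qcomm 1 w y -> qcomm 1 w (x * y).
Proof. by rewrite -[X in qcomm X w (x * y)]mulr1; apply: qcommM. Qed.

Lemma qcomm1_sym w x : qcomm 1 w x -> qcomm 1 x w.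
Proof. by rewrite -[X in _ -> qcomm X _ _]invr1; apply/qcommC/oner_neq0. Qed.

Lemma qcomm1_zpow w x y z : qcomm 1 w x -> qcomm 1 w y -> qcomm 1 w (zpow x y z).
Proof.
move=> wx wy; rewrite -(exp1rz k z); apply: qcomm_zpow => //.
by rewrite invr1.
Qed.

Lemma qcomm1X w x n : qcomm 1 w x -> qcomm 1 w (x ^+ n).
Proof. by move=> /(qcommX n); rewrite expr1n. Qed.

Lemma qcomm1_inv w x y :
  x * y = 1 -> y * x = 1 -> qcomm 1 w x -> qcomm 1 w y.
Proof.
by move=> xy yx /(qcomm_inv (oner_neq0 k) xy yx); rewrite invr1.
Qed.

Lemma qcomm1_phi l w c d :
  l != 0 -> qcomm l w c -> qcomm l^-1 w d -> qcomm 1 w (1 - c * d).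
Proof.
move=> l0 wc wd; apply: qcommB; first exact: qcomm1.
by rewrite -(mulfV l0); apply: qcommM.
Qed.

End QCommutation.

(** * Deformed Weyl pairs *)

Section WeylPair.
Context (k : fieldType) (A : algType k).
Implicit Types (x y w c d : A) (l m : k) (P : set A).

(** A deformed Weyl algebra, normalised so that [1 - c * d] commutes up to
    scalars with [c] and [d], and so that [c] and [d] become inverse to each
    other modulo it. Accordingly [zpow c d] plays the part of the powers of [c]. *)
Definition weyl_pair (al : k) c d : Prop :=
  d * c = (1 - al)%:A + al *: (c * d).

Lemma weyl_pair_sym al c d : al != 0 -> weyl_pair al c d -> weyl_pair al^-1 d c.
Proof.
rewrite /weyl_pair => al0 ->; rewrite scalerDr !scalerA mulVf // scale1r.
by rewrite addrA -scalerDl mulrBr mulVf // mulr1 addrA subrK subrr scale0r add0r.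
Qed.

Section OnePair.
Variables (al : k) (c d : A).
Hypotheses (al0 : al != 0) (cd : weyl_pair al c d).
Local Notation phi := (1 - c * d).

Lemma weyl_dc : d * c = 1 - al *: phi.
Proof. by rewrite cd scalerBl scalerBr scale1r opprB addrAC addrA. Qed.

Lemma weyl_phi_c : qcomm al phi c.
Proof.
rewrite /qcomm mulrBl mul1r -mulrA weyl_dc mulrBr mulr1 mulZr opprB addrC.
by rewrite subrK.
Qed.

Lemma weyl_phi_d : qcomm al^-1 phi d.
Proof.
apply: qcommC => //; rewrite /qcomm mulrBr mulr1 mulrA weyl_dc.
by rewrite (mulrBl d 1) mul1r mulZl opprB addrC subrK.
Qed.

Lemma weyl_phi_zpow (z : int) : qcomm (al ^ z) phi (zpow c d z).
Proof. by apply: qcomm_zpow; [apply: weyl_phi_c | apply: weyl_phi_d]. Qed.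

Lemma weyl_dcX n :
  d * c ^+ n.+1 = al ^+ n.+1 *: (c ^+ n.+1 * d) + (1 - al ^+ n.+1) *: c ^+ n.
Proof.
rewrite [in LHS]exprS mulrA weyl_dc mulrBl mul1r mulZl.
have /= -> := qcommX n weyl_phi_c.
rewrite [c ^+ n.+1]exprSr mulrBr mulr1 scalerA -exprS -mulrA.
by rewrite scalerBr scalerBl scale1r opprB addrCA addrC.
Qed.

(** Nothing happens when [z >= 0]; for [z < 0] the product [c * d = 1 - phi]
    appears, and [phi] is moved to the right. *)
Lemma weyl_zpowS (z : int) :
  exists g, c * zpow c d z = zpow c d (z + 1) * (1 - g *: phi).
Proof.
case: z => n.
  by exists 0; rewrite scale0r subr0 mulr1 -exprS -PoszD addn1.
exists (al^-1 ^+ n); have -> : Negz n + 1 = - n%:Z by rewrite NegzE; lia.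
rewrite zpow_opp /= exprS mulrA [in LHS](_ : c * d = 1 - phi); last by rewrite opprB addrC subrK.
rewrite (mulrBl (d ^+ n)) mul1r.
by have /= -> := qcommX n weyl_phi_d; rewrite (mulrBr _ 1 (_ *: _)) mulr1 mulZr.
Qed.

(** A power of [c] can be cancelled although [c] is neither normal nor
    invertible modulo [P]: commuting [d] past [c ^+ n.+1 * S] lowers the exponent
    with coefficient [1 - al ^+ n.+1], which is nonzero. *)
Lemma weyl_descend P lam n (S : A) : (forall i, al ^+ i.+1 != 1) ->
  lam != 0 -> two_sided_ideal P -> qcomm lam S d -> P (c ^+ n * S) -> P S.
Proof.
move=> al1 lam0 iP Sd; have lP := ideal_left iP.
elim: n => [|n IHn]; first by rewrite mul1r.
move=> PcS; apply: IHn; have al1n : 1 - al ^+ n.+1 != 0 by rewrite subr_eq0 eq_sym.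
apply: (lidealZK lP al1n).
have := lidealB lP (lidealM d lP PcS)
  (lidealZ (al ^+ n.+1 * lam^-1) lP (idealMr d iP PcS)).
rewrite mulrA weyl_dcX mulrDl !mulZl -mulrA -(mulrA _ S) Sd mulZr scalerA.
by rewrite divfK // mulrA addrAC subrr add0r.
Qed.
End OnePair.

Lemma weyl_zpowP (al : k) c d (z : int) : al != 0 -> weyl_pair al c d ->
  exists m, d * zpow c d z = zpow c d (z - 1) * (1 - m *: (1 - c * d)).
Proof.
move=> al0 cd; have alV0 : al^-1 != 0 by rewrite invr_eq0.
have [m e] := weyl_zpowS alV0 (weyl_pair_sym al0 cd) (- z).
have e1 : 1 - d * c = al *: (1 - c * d) by rewrite (weyl_dc cd) opprB addrC subrK.
exists (m * al); move: e; rewrite e1.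
by rewrite -zpow_opp opprK -[- z + 1]opprK zpow_opp opprD opprK scalerA => <-.
Qed.

(** Modulo [1 - c * d] the two elements of the pair are inverse to each other. *)
Lemma weyl_zpowD_mod (al : k) P c d (z t : int) : al != 0 -> weyl_pair al c d ->
  two_sided_ideal P -> P (1 - c * d) ->
  P (zpow c d z * zpow c d t - zpow c d (z + t)).
Proof.
move=> al0 cd iP Pphi; have lP := ideal_left iP.
have absorb y m : P (y * (1 - m *: (1 - c * d)) - y).
  rewrite mulrBr mulr1 addrAC subrr add0r; apply: lidealN => //.
  by apply: lidealM => //; apply: lidealZ.
elim/int_rect: z => [|n IHn|n IHn].
- by rewrite add0r mul1r subrr; apply: lideal0.
- rewrite [zpow c d n.+1]exprS -mulrA.
  apply: (lideal_sub lP (y := c * zpow c d (n%:Z + t) - zpow c d (n.+1%:Z + t))) => /=.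
    by rewrite opprB addrA subrK -mulrBr; apply: lidealM.
  have -> : n.+1%:Z + t = n%:Z + t + 1 by lia.
  by have [m ->] := weyl_zpowS al0 cd (n%:Z + t); apply: absorb.
move: IHn; rewrite !zpow_opp /= => IHn; rewrite exprS -mulrA.
apply: (lideal_sub lP (y := d * zpow c d (- n%:Z + t) - zpow c d (- n.+1%:Z + t))).
  by rewrite opprB addrA subrK -mulrBr; apply: lidealM.
have -> : - n.+1%:Z + t = - n%:Z + t - 1 by lia.
by have [m ->] := weyl_zpowP (- n%:Z + t) al0 cd; apply: absorb.
Qed.

Section PowerSeparation.
Variables (al : k) (P : set A) (I : eqType) (s : seq I) (W : I -> A).
Variables (lam : I -> k) (mu : k).
Hypotheses (al0 : al != 0) (al1 : forall z : int, al ^ z = 1 -> z = 0).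
Hypotheses (iP : two_sided_ideal P) (lam0 : forall i, lam i != 0).

Lemma weyl_sep_pow (Q : pred I) (c d : A) n : weyl_pair al c d ->
  (forall i, qcomm (lam i) c (W i)) -> (forall i, qcomm (lam i) (W i) d) ->
  P (\sum_(i <- s | Q i) c ^+ n * W i) ->
  P (\sum_(i <- s | Q i && (lam i == mu)) W i).
Proof.
move=> cd cW Wd; have lP := ideal_left iP; rewrite -big_filter => PcW.
have X_c i : qcomm (lam i) c (c ^+ n * W i).
  by rewrite -[lam i]mul1r; apply: qcommM => //; rewrite -(expr1n _ n); apply/qcommX/qcomm_refl.
have {PcW} [N] := weight_sep mu iP (fun i => qcomm_mod iP (X_c i)) PcW.
rewrite big_filter_cond -mulr_sumr; set S := (\sum_(i <- _ | _) _).
have [mu0|mu0] := eqVneq mu 0.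
  suff -> : S = 0 by rewrite mulr0 mul0r.
  by rewrite /S big1 // => i /andP[_ /eqP lami]; have := lam0 i; rewrite lami mu0 eqxx.
have cS : qcomm mu c S by apply: qcomm_sum => i /andP[_ /eqP <-].
have Sd : qcomm mu S d by apply: qcomm_suml => i /andP[_ /eqP <-].
have /(qcommC (expf_neq0 N mu0)) ScN := qcommXl N cS.
rewrite -mulrA ScN mulZr mulrA -exprD => /lidealZK; rewrite invr_eq0 expf_neq0 //.
move=> /(_ lP isT); apply: (weyl_descend cd _ mu0) => // i.
by apply/eqP => ali; have := al1 (z := i.+1) ali.
Qed.
End PowerSeparation.

(** The element [1 - c * d] commutes with every [W i] and has weight [al ^ r] on
    [zpow c d r], so it separates the exponents. Then [c] separates the [lam i], and
    [weyl_descend] removes the remaining power of [c], or of [d] if [r0 < 0], the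
    pair being symmetric. *)
Lemma weyl_sep al P c d (I : eqType) (s : seq I) (Q : pred I) (W : I -> A)
    (lam : I -> k) (r : I -> int) (r0 : int) (mu : k) :
  al != 0 -> (forall z : int, al ^ z = 1 -> z = 0) -> weyl_pair al c d ->
  two_sided_ideal P -> saturated P (1 - c * d) -> (forall i, lam i != 0) ->
  (forall i, qcomm (lam i) c (W i)) -> (forall i, qcomm (lam i) (W i) d) ->
  P (\sum_(i <- s | Q i) zpow c d (r i) * W i) ->
  P (\sum_(i <- s | Q i && (r i == r0) && (lam i == mu)) W i).
Proof.
move=> al0 al1 cd iP sP lam0 cW Wd.
have phi_W i : qcomm 1 (1 - c * d) (W i).
  apply: qcommBl; first by rewrite /qcomm mul1r mulr1 scale1r.
  rewrite -(mulfV (lam0 i)); apply: qcommMl => //.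
  exact: qcommC.
have phi_X i : qcomm (al ^ r i) (1 - c * d) (zpow c d (r i) * W i).
  by rewrite -[al ^ r i]mulr1; apply: qcommM => //; apply: weyl_phi_zpow.
move=> /(weight_sep_sat (al ^ r0) iP sP (fun i => qcomm_mod iP (phi_X i))).
rewrite (eq_bigl (fun i => Q i && (r i == r0))) => [|i]; last first.
  congr (_ && _); apply/eqP/eqP => [e|-> //]; apply/eqP; rewrite -subr_eq0; apply/eqP/al1.
  by rewrite expfzDr // e -expfzDr // subrr expr0z.
rewrite (eq_bigr (fun i => zpow c d r0 * W i)) => [|i /andP[_ /eqP ->] //].
case: r0 => n /=; first exact: (weyl_sep_pow mu al1 iP lam0 cd cW Wd).
have al0' : al^-1 != 0 by rewrite invr_eq0.
have lam0' i : (lam i)^-1 != 0 by rewrite invr_eq0.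
rewrite [in X in _ -> X](eq_bigl (fun i => Q i && (r i == Negz n) && ((lam i)^-1 == mu^-1))).
  apply: (@weyl_sep_pow al^-1 _ _ _ _ _ _ _ _ lam0' _ d c) => //; last 3 first.
  - exact: weyl_pair_sym.
  - by move=> i; apply: qcommC.
  - by move=> i; apply: qcommC.
  by move=> z; rewrite exprz_inv => /al1/eqP; rewrite oppr_eq0 => /eqP.
by move=> i; rewrite (inj_eq invr_inj).
Qed.
End WeylPair.

(** * Two pairs over a quantum torus *)

Lemma big_group (V : nmodType) (I : Type) (J : eqType) (key : I -> J) (s : seq I)
    (F : I -> V) :
  \sum_(i <- s) F i =
  \sum_(j <- undup (map key s)) \sum_(i <- s | key i == j) F i.
Proof.
have : {subset map key s <= undup (map key s)} by move=> j; rewrite mem_undup.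
have := undup_uniq (map key s); move: (undup _) => l l_uniq.
elim: s => [_|i s IHs sub_l]; first by rewrite big_nil big1 // => j _; rewrite big_nil.
have l_i : key i \in l by apply: sub_l; rewrite mem_head.
rewrite big_cons IHs => [|j sj]; last by apply: sub_l; rewrite seq.inE sj orbT.
rewrite !(bigD1_seq _ l_i l_uniq) /= big_cons eqxx addrA; congr (_ + _).
by apply: eq_bigr => j /negPf ji; rewrite big_cons eq_sym ji.
Qed.

Definition nonroot (k : fieldType) (l : k) : Prop :=
  l != 0 /\ forall z : int, l ^ z = 1 -> z = 0.

Lemma nonrootV (k : fieldType) (l : k) : nonroot l -> nonroot l^-1.
Proof.
case=> l0 l1; split=> [|z]; first by rewrite invr_eq0.
by rewrite exprz_inv => /l1/eqP; rewrite oppr_eq0 => /eqP.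
Qed.

Lemma nonroot_inj (k : fieldType) (l : k) : nonroot l -> injective (exprz l).
Proof.
case=> l0 l1 z t e; apply/eqP; rewrite -subr_eq0; apply/eqP/l1.
by rewrite expfzDr // e -expfzDr // subrr expr0z.
Qed.

Lemma nonrootX_inj (k : fieldType) (l : k) : nonroot l -> injective (GRing.exp l).
Proof. by move=> /nonroot_inj lI r s e; have [] := lI (Posz r) (Posz s) e. Qed.

(** Coefficient and exponents of a monomial: [et] and [er] are the exponents of
    the two pairs, [ei] and [ej] those of [a] and [K], [es] and [eu] those of [phi1] and
    [phi2]. *)
Record term (k : Type) := Term
  { cf : k; et : int; er : int; ei : int; ej : int; es : nat; eu : nat }.
HB.instance Definition _ (k : Type) := gen_eqMixin (term k).

Section TwoPairs.
Context (k : fieldType) (A : algType k).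

(** An induction principle: every element is reached from [1] by linear
    combinations and left multiplication by the generators. *)
Definition generates (gens : seq A) : Prop :=
  forall B : set A, B 1 -> (forall x y, B x -> B y -> B (x + y)) ->
    (forall (l : k) x, B x -> B (l *: x)) ->
    (forall g x, g \in gens -> B x -> B (g * x)) -> forall x, B x.

(** Two pairs which commute with a quantum torus, and with each other up to
    powers of [p]. For [c = c'], [b = b'] and [d], [f] proportional to [E'], [F'] these
    are the relations of the double. *)
Record heis_rel (q al be p : k) (a ai K Ki c d b f : A) : Prop := HeisRel {
  a_ai : a * ai = 1; ai_a : ai * a = 1; K_Ki : K * Ki = 1; Ki_K : Ki * K = 1;
  K_a : qcomm q^-1 K a;
  a_c : qcomm 1 a c; a_d : qcomm 1 a d; a_b : qcomm 1 a b; a_f : qcomm 1 a f;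
  K_c : qcomm 1 K c; K_d : qcomm 1 K d; K_b : qcomm 1 K b; K_f : qcomm 1 K f;
  weyl_c : weyl_pair al c d; weyl_b : weyl_pair be b f;
  b_c : qcomm p b c; b_d : qcomm p^-1 b d;
  f_c : qcomm p^-1 f c; f_d : qcomm p f d;
  heis_gen : generates [:: a; ai; K; Ki; c; d; b; f]
}.

(** This symmetry carries the primes containing [phi1] to those containing
    [phi2]. *)
Lemma heis_swap q al be p a ai K Ki c d b f : p != 0 ->
  heis_rel q al be p a ai K Ki c d b f ->
  heis_rel q be al p^-1 a ai K Ki b f c d.
Proof.
move=> p0 []; split=> //; last 1 first.
  move=> B B1 BD BZ Bg; apply: heis_gen0 => // g x; rewrite !seq.inE => gP.
  by apply: Bg; rewrite !seq.inE; do ?[case/orP: gP => [->|gP]]; rewrite ?gP ?orbT.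
- exact: qcommC.
- by apply: qcommC => //; rewrite invr_eq0.
- by rewrite invrK -[p]invrK; apply: qcommC => //; rewrite invr_eq0.
- exact: qcommC.
Qed.

(** This symmetry inverts [p], which accounts for the two signs of [m * n]. *)
Lemma heis_flip q al be p a ai K Ki c d b f : al != 0 ->
  heis_rel q al be p a ai K Ki c d b f ->
  heis_rel q al^-1 be p^-1 a ai K Ki d c b f.
Proof.
move=> al0 []; split; rewrite ?invrK //; first exact: weyl_pair_sym.
move=> B B1 BD BZ Bg; apply: heis_gen0 => // g x; rewrite !seq.inE => gP.
by apply: Bg; rewrite !seq.inE; do ?[case/orP: gP => [->|gP]]; rewrite ?gP ?orbT.
Qed.

Section Presentation.
Variables (q al be p : k) (a ai K Ki c d b f : A).
Hypothesis H : heis_rel q al be p a ai K Ki c d b f.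
Hypotheses (qR : nonroot q) (alR : nonroot al) (beR : nonroot be) (p0 : p != 0).
Implicit Types (P L : set A) (v : term k) (x y w : A).
Local Notation phi1 := (1 - c * d).
Local Notation phi2 := (1 - b * f).
Local Notation gens := [:: a; ai; K; Ki; c; d; b; f].

Let q0 : q != 0. Proof. by case: qR. Qed.
Let al0 : al != 0. Proof. by case: alR. Qed.
Let be0 : be != 0. Proof. by case: beR. Qed.
Let pV0 : p^-1 != 0. Proof. by rewrite invr_eq0. Qed.

Lemma torus_unit : [/\ qcomm 1 ai a, qcomm 1 Ki K, qcomm q Ki a & qcomm q K ai].
Proof.
split.
- by rewrite /qcomm (ai_a H) (a_ai H) scale1r.
- by rewrite /qcomm (Ki_K H) (K_Ki H) scale1r.
- have /(qcommC _) := K_a H; rewrite invr_eq0 invrK => /(_ q0) aK.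
  have /(qcommC _) := qcomm_inv q0 (K_Ki H) (Ki_K H) aK.
  by rewrite invr_eq0 invrK; apply.
- have := qcomm_inv _ (a_ai H) (ai_a H) (K_a H).
  by rewrite invr_eq0 invrK; apply.
Qed.

(** The condition on [w] to commute with the whole torus. *)
Definition torus_comm w := qcomm 1 a w /\ qcomm 1 K w.

Lemma torus_commV w : torus_comm w ->
  [/\ qcomm 1 w a, qcomm 1 w ai, qcomm 1 w K & qcomm 1 w Ki].
Proof.
case=> /qcomm1_sym wa /qcomm1_sym wK; split=> //.
  exact: qcomm1_inv (a_ai H) (ai_a H) wa.
exact: qcomm1_inv (K_Ki H) (Ki_K H) wK.
Qed.

Lemma torus_commM w x : torus_comm w -> torus_comm x -> torus_comm (w * x).
Proof. by move=> [aw Kw] [ax Kx]; split; apply: qcomm1M. Qed.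

Lemma torus_comm1 : torus_comm 1.
Proof. by split; apply: qcomm1. Qed.

Lemma torus_commX w n : torus_comm w -> torus_comm (w ^+ n).
Proof. by case=> aw Kw; split; apply: qcomm1X. Qed.

Lemma torus_commB w x : torus_comm w -> torus_comm x -> torus_comm (w - x).
Proof. by move=> [aw Kw] [ax Kx]; split; apply: qcommB. Qed.

Lemma torus_comm_zpow w x z :
  torus_comm w -> torus_comm x -> torus_comm (zpow w x z).
Proof. by move=> [aw Kw] [ax Kx]; split; apply: qcomm1_zpow. Qed.

Lemma torus_comm_c : torus_comm c. Proof. by split; [apply: a_c H|apply: K_c H]. Qed.
Lemma torus_comm_d : torus_comm d. Proof. by split; [apply: a_d H|apply: K_d H]. Qed.
Lemma torus_comm_b : torus_comm b. Proof. by split; [apply: a_b H|apply: K_b H]. Qed.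
Lemma torus_comm_f : torus_comm f. Proof. by split; [apply: a_f H|apply: K_f H]. Qed.
Lemma torus_comm_phi1 : torus_comm phi1.
Proof.
by apply: torus_commB torus_comm1 _; apply: torus_commM torus_comm_c torus_comm_d.
Qed.
Lemma torus_comm_phi2 : torus_comm phi2.
Proof.
by apply: torus_commB torus_comm1 _; apply: torus_commM torus_comm_b torus_comm_f.
Qed.

Definition torus (i j : int) : A := zpow a ai i * zpow K Ki j.

Lemma comm_torus w i j : torus_comm w -> qcomm 1 w (torus i j).
Proof. by case/torus_commV=> *; apply: qcomm1M; apply: qcomm1_zpow. Qed.

Lemma torus_comm_sym w i j : torus_comm w -> qcomm 1 (torus i j) w.
Proof. by move=> /comm_torus cw; apply: qcomm1_sym. Qed.

Lemma torus_inv i j : exists y, y * torus i j = 1.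
Proof.
exists (zpow K Ki (- j) * zpow a ai (- i)).
rewrite -mulrA (mulrA (zpow a ai (- i))) zpowNl ?mul1r ?zpowNl //.
all: by case: H.
Qed.

Lemma c_f : qcomm p c f.
Proof. by rewrite -[p]invrK; apply: qcommC => //; apply: f_c H. Qed.
Lemma c_b : qcomm p^-1 c b.
Proof. by apply: qcommC => //; apply: b_c H. Qed.
Lemma d_b : qcomm p d b.
Proof. by rewrite -[p]invrK; apply: qcommC => //; apply: b_d H. Qed.
Lemma d_f : qcomm p^-1 d f.
Proof. by apply: qcommC => //; apply: f_d H. Qed.

Lemma b_phi1 : qcomm 1 b phi1.
Proof. exact: qcomm1_phi p0 (b_c H) (b_d H). Qed.
Lemma f_phi1 : qcomm 1 f phi1.
Proof. by apply: qcomm1_phi pV0 (f_c H) _; rewrite invrK; apply: f_d H. Qed.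
Lemma c_phi2 : qcomm 1 c phi2.
Proof. by apply: qcomm1_phi pV0 c_b _; rewrite invrK; apply: c_f. Qed.
Lemma d_phi2 : qcomm 1 d phi2.
Proof. exact: qcomm1_phi p0 d_b d_f. Qed.
Lemma phi1_phi2 : qcomm 1 phi1 phi2.
Proof.
apply: qcomm1_sym; apply: qcommB; first exact: qcomm1.
by apply: qcomm1M; apply: qcomm1_sym; [apply: c_phi2|apply: d_phi2].
Qed.

Definition mono (t r i j : int) (s u : nat) : A :=
  zpow b f t * (zpow c d r * (zpow a ai i * (zpow K Ki j * (phi1 ^+ s * phi2 ^+ u)))).
Definition monot v : A := cf v *: mono (et v) (er v) (ei v) (ej v) (es v) (eu v).

(** Left multiplication by a generator shifts one exponent of a monomial, up to
    a scalar and a factor [1 - m phi1] or [1 - m phi2]; this factor is absorbed by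
    [phi1 ^+ s * phi2 ^+ u]. *)
Lemma monomials_span x : exists s : seq (term k), x = \sum_(v <- s) monot v.
Proof.
pose B : set A := [set x | exists s : seq (term k), x = \sum_(v <- s) monot v].
have BD y z : B y -> B z -> B (y + z).
  by move=> [s ->] [s' ->]; exists (s ++ s'); rewrite big_cat.
have BZ l y : B y -> B (l *: y).
  move=> [s ->].
  exists [seq Term (l * cf v) (et v) (er v) (ei v) (ej v) (es v) (eu v) | v <- s].
  by rewrite big_map scaler_sumr; apply: eq_bigr => v _; rewrite /monot scalerA.
have BB y z : B y -> B z -> B (y - z).
  by move=> By Bz; apply: (BD) => //; rewrite -scaleN1r; apply: (BZ).
have Bm t r i j s u : B (mono t r i j s u).
  by exists [:: Term 1 t r i j s u]; rewrite big_seq1 /monot scale1r.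
have Bsum g : (forall t r i j s u, B (g * mono t r i j s u)) ->
    forall y, B y -> B (g * y).
  move=> gm y [s ->]; rewrite mulr_sumr; apply: (big_ind B) => //.
    by exists [::]; rewrite big_nil.
  by move=> v _; rewrite mulZr; apply/BZ/gm.
have [a1 aV K1 KV] : [/\ a * ai = 1, ai * a = 1, K * Ki = 1 & Ki * K = 1] by case: H.
have [ai_a_ Ki_K_ Ki_a K_ai] := torus_unit.
have Bc g t r r' i j s u l m : qcomm l g (zpow b f t) ->
    g * zpow c d r = zpow c d r' * (1 - m *: phi1) -> B (g * mono t r i j s u).
  move=> gb gc; rewrite /mono (qcomm_push _ gb); apply: (BZ).
  rewrite (mulrA g) gc -mulrA mulrBl mul1r !mulrBr; apply: (BB); first exact: Bm.
  rewrite mulZl !mulZr; apply: (BZ).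
  have [pa pai pK pKi] := torus_commV torus_comm_phi1.
  rewrite (qcomm1_push _ (qcomm1_zpow i pa pai)) (qcomm1_push _ (qcomm1_zpow j pK pKi)).
  by rewrite (mulrA phi1) -exprS; apply: Bm.
have Bb g t t' r i j s u m : qcomm 1 phi2 (zpow c d r) ->
    g * zpow b f t = zpow b f t' * (1 - m *: phi2) -> B (g * mono t r i j s u).
  move=> pc gb; rewrite /mono mulrA gb -mulrA mulrBl mul1r mulrBr.
  apply: (BB); first exact: Bm.
  rewrite mulZl mulZr; apply: (BZ).
  have [pa pai pK pKi] := torus_commV torus_comm_phi2.
  rewrite (qcomm1_push _ pc) (qcomm1_push _ (qcomm1_zpow i pa pai)).
  rewrite (qcomm1_push _ (qcomm1_zpow j pK pKi)).
  rewrite (qcomm1_push _ (qcomm1X s (qcomm1_sym phi1_phi2))) -exprS.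
  exact: Bm.
have Bt g t r i j s u : qcomm 1 g b -> qcomm 1 g f -> qcomm 1 g c -> qcomm 1 g d ->
    B (zpow b f t * (zpow c d r * (g * (zpow a ai i * (zpow K Ki j * (phi1 ^+ s * phi2 ^+ u)))))) ->
    B (g * mono t r i j s u).
  move=> gb gf gc gd; rewrite /mono (qcomm1_push _ (qcomm1_zpow t gb gf)).
  by rewrite (qcomm1_push _ (qcomm1_zpow r gc gd)).
have BK g t r i j j' s u l : qcomm 1 g b -> qcomm 1 g f -> qcomm 1 g c -> qcomm 1 g d ->
    qcomm l g (zpow a ai i) -> g * zpow K Ki j = zpow K Ki j' ->
    B (g * mono t r i j s u).
  move=> gb gf gc gd ga gK; apply: Bt => //.
  by rewrite (qcomm_push _ ga) (mulrA g) gK !mulZr; apply: (BZ); apply: Bm.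
have Ba g t r i i' j s u : qcomm 1 g b -> qcomm 1 g f -> qcomm 1 g c -> qcomm 1 g d ->
    g * zpow a ai i = zpow a ai i' -> B (g * mono t r i j s u).
  move=> gb gf gc gd ga; apply: Bt => //.
  by rewrite (mulrA g) ga; apply: Bm.
apply: (heis_gen H (B := B)) => //.
  by exists [:: Term 1 0 0 0 0 0 0]; rewrite big_seq1 /monot scale1r /mono !mul1r.
have [cb cf_] := (torus_commV torus_comm_b, torus_commV torus_comm_f).
have [cc cd] := (torus_commV torus_comm_c, torus_commV torus_comm_d).
move=> g x' gens_g; apply: Bsum => t r i j s u; move: gens_g.
rewrite !seq.inE; case/or4P => [/eqP->|/eqP->|/eqP->|].
- by apply: Ba; [apply: a_b H|apply: a_f H|apply: a_c H|apply: a_d H|apply: zpowS].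
- by apply: Ba; [case: cb|case: cf_|case: cc|case: cd|apply: zpowP] => // *; apply: qcomm1_sym.
- apply: (BK _ _ _ _ _ (j + 1) _ _ (q^-1 ^ i)); rewrite ?zpowS //;
    [apply: K_b H|apply: K_f H|apply: K_c H|apply: K_d H|].
  by apply: qcomm_zpow; [apply: K_a H|rewrite invrK].
case/orP => [/eqP->|].
  apply: (BK _ _ _ _ _ (j - 1) _ _ (q ^ i)); rewrite ?zpowP //;
    [case: cb|case: cf_|case: cc|case: cd|] => // *; first [exact: qcomm1_sym|idtac].
  apply: qcomm_zpow => //; exact: qcomm_inv q0 (a_ai H) (ai_a H) Ki_a.
have cbt : qcomm (p^-1 ^ t) c (zpow b f t).
  by apply: qcomm_zpow; rewrite ?invrK; [apply: c_b|apply: c_f].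
have dbt : qcomm (p ^ t) d (zpow b f t).
  by apply: qcomm_zpow; [apply: d_b|apply: d_f].
have p2c : qcomm 1 phi2 (zpow c d r).
  by apply: qcomm1_zpow; apply: qcomm1_sym; [apply: c_phi2|apply: d_phi2].
case/or4P => /eqP->.
- have [m e] := weyl_zpowS al0 (weyl_c H) r; exact: Bc cbt e.
- have [m e] := weyl_zpowP r al0 (weyl_c H); exact: Bc dbt e.
- have [m e] := weyl_zpowS be0 (weyl_b H) t; exact: Bb p2c e.
- have [m e] := weyl_zpowP t be0 (weyl_b H); exact: Bb p2c e.
Qed.

(** Since [a] and [K] are units, every ideal is saturated under them, and their
    weights [q ^ j] and [q ^ (- i)] on [torus i j] determine [i] and [j]. *)
Lemma sep_torus P (s : seq (term k)) (Q : pred (term k)) (X : term k -> A) i0 j0 :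
  two_sided_ideal P -> (forall v, torus_comm (X v)) ->
  P (\sum_(v <- s | Q v) torus (ei v) (ej v) * X v) ->
  P (\sum_(v <- s | Q v && ((ei v, ej v) == (i0, j0))) X v).
Proof.
move=> iP cX PX; have lP := ideal_left iP.
have [aK K1 Ki_a K_ai] := torus_unit.
have sa : saturated P a.
  by apply: (unit_saturated (w' := ai)) => //; rewrite (a_ai H) subrr; apply: lideal0.
have sK : saturated P K.
  by apply: (unit_saturated (w' := Ki)) => //; rewrite (K_Ki H) subrr; apply: lideal0.
have qaK : qcomm q a K by rewrite -[q]invrK; apply: qcommC (K_a H); rewrite invr_eq0.
have qaKi : qcomm q^-1 a Ki by apply: qcomm_inv (K_Ki H) (Ki_K H) qaK.
have a_a : qcomm 1 a ai by apply: qcomm1_sym.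
have K_K : qcomm 1 K Ki by apply: qcomm1_sym.
have wa v : qcomm (q ^ ej v) a (torus (ei v) (ej v) * X v).
  rewrite -[q ^ _]mulr1 -[q ^ _]mul1r; apply: qcommM; last by case: (cX v).
  apply: qcommM; last exact: qcomm_zpow.
  by apply: qcomm1_zpow => //; apply: qcomm_refl.
have wK v : qcomm (q^-1 ^ ei v) K (torus (ei v) (ej v) * X v).
  rewrite -[q^-1 ^ _]mulr1 -[q^-1 ^ _]mulr1; apply: qcommM; last by case: (cX v).
  apply: qcommM; last by apply: qcomm1_zpow => //; apply: qcomm_refl.
  by apply: qcomm_zpow; [apply: K_a H|rewrite invrK].
have := weight_sep_sat (q ^ j0) iP sa (fun v => qcomm_mod iP (wa v)) PX.
move/(weight_sep_sat (q^-1 ^ i0) iP sK (fun v => qcomm_mod iP (wK v))).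
rewrite (eq_bigl (fun v => Q v && ((ei v, ej v) == (i0, j0)))) => [|v]; last first.
  rewrite (inj_eq (nonroot_inj qR)) (inj_eq (nonroot_inj (nonrootV qR))).
  by rewrite xpair_eqE -andbA (andbC (ej v == _)).
rewrite (eq_bigr (fun v => torus i0 j0 * X v)) => [|v /andP[_ /eqP[-> ->]] //].
rewrite -mulr_sumr => /(lidealM (proj1_sig (cid (torus_inv i0 j0))) lP).
by case: cid => y /= yT; rewrite mulrA yT mul1r.
Qed.

(** The weight under [b] of what follows the power of [b] in a monomial:
    [zpow c d r] contributes [p ^ r] and [phi2 ^+ u] contributes [be ^- u]. *)
Definition b_weight v : k := p ^ er v * be^-1 ^+ eu v.
Definition no_b v : A :=
  zpow c d (er v) * (torus (ei v) (ej v) * (phi1 ^+ es v * phi2 ^+ eu v)).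

Lemma phi2_b : qcomm be phi2 b. Proof. exact: weyl_phi_c (weyl_b H). Qed.
Lemma phi2_f : qcomm be^-1 phi2 f. Proof. exact: weyl_phi_d (weyl_b H). Qed.
Lemma phi1_c : qcomm al phi1 c. Proof. exact: weyl_phi_c (weyl_c H). Qed.
Lemma phi1_d : qcomm al^-1 phi1 d. Proof. exact: weyl_phi_d (weyl_c H). Qed.

Lemma b_no_b v : qcomm (b_weight v) b (no_b v).
Proof.
apply: qcommM; first by apply: qcomm_zpow; [apply: b_c H|apply: b_d H].
rewrite -[be^-1 ^+ _]mul1r -[be^-1 ^+ _]mul1r.
apply: qcommM; first exact/comm_torus/torus_comm_b.
apply: qcommM; first exact/qcomm1X/b_phi1.
by apply: qcommX; apply: qcommC phi2_b.
Qed.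

Lemma no_b_f v : qcomm (b_weight v) (no_b v) f.
Proof.
apply: qcommMl; first by apply: qcomm_zpowl; [apply: c_f|apply: d_f].
rewrite -[be^-1 ^+ _]mul1r -[be^-1 ^+ _]mul1r.
apply: qcommMl; first exact/torus_comm_sym/torus_comm_f.
apply: qcommMl; first exact/qcomm1_sym/qcomm1X/f_phi1.
by apply: qcommXl; apply: phi2_f.
Qed.

Lemma b_weight0 v : b_weight v != 0.
Proof. by rewrite mulf_neq0 ?expfz_neq0 ?expf_neq0 // invr_eq0. Qed.

Lemma monotE v : monot v = zpow b f (et v) * (cf v *: no_b v).
Proof. by rewrite /monot /mono /no_b /torus mulZr -!mulrA. Qed.

Lemma sep_b P (s : seq (term k)) (Q : pred (term k)) t0 l0 :
  two_sided_ideal P -> saturated P phi2 -> P (\sum_(v <- s | Q v) monot v) ->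
  P (\sum_(v <- s | Q v && (et v == t0) && (b_weight v == l0)) cf v *: no_b v).
Proof.
move=> iP sP; rewrite (eq_bigr _ (fun v _ => monotE v)).
have [_ be1] := beR.
apply: (weyl_sep t0 l0 be0 be1 (weyl_b H)) => // v; first exact: b_weight0.
  exact/qcommZ/b_no_b.
exact/qcommZl/no_b_f.
Qed.

(** * Primes that avoid [phi1] and [phi2] *)

(** Separating in turn by the second pair, the first pair and the torus isolates
    the terms with given exponents and cancels their other factors, which leaves
    [l phi1 ^+ i phi2 ^+ u] in [P]. If [l] were nonzero, saturation would put [1] in
    [P]. *)
Lemma generic_simple P : two_sided_ideal P -> saturated P phi1 ->
  saturated P phi2 -> ~ P 1 -> P `<=` [set 0].
Proof.
move=> iP s1 s2 nP1 x; have [s ->] := monomials_span x; have lP := ideal_left iP.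
move=> Px; pose key v := (et v, er v, es v, eu v, (ei v, ej v)).
rewrite /= (big_group key) big1_seq // => -[[[[t r] i] u] [i0 j0]] _.
pose g : k := \sum_(v <- s | key v == (t, r, i, u, (i0, j0))) cf v.
rewrite (eq_bigr (fun v => cf v *: mono t r i0 j0 i u)); last first.
  by move=> v /eqP[<- <- <- <- <- <-].
rewrite -scaler_suml; suff -> : \sum_(v <- s | key v == (t, r, i, u, (i0, j0))) cf v = 0.
  by rewrite scale0r.
apply: contrapT => /eqP g0; apply: nP1.
have := sep_b t (p ^ r * be^-1 ^+ u) iP s2 Px.
rewrite (eq_bigr (fun v => zpow c d (er v) *
    (cf v *: (torus (ei v) (ej v) * (phi1 ^+ es v * phi2 ^+ eu v))))); last first.
  by move=> v _; rewrite mulZr.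
have [_ al1] := alR.
have cX v : torus_comm (phi1 ^+ es v * phi2 ^+ eu v).
  by apply: torus_commM; apply: torus_commX; [apply: torus_comm_phi1|apply: torus_comm_phi2].
have lam0 v : al^-1 ^+ es v != 0 by rewrite expf_neq0 // invr_eq0.
have cW v : qcomm (al^-1 ^+ es v) c
    (cf v *: (torus (ei v) (ej v) * (phi1 ^+ es v * phi2 ^+ eu v))).
  apply: qcommZ; rewrite -[al^-1 ^+ _]mulr1 -[al^-1 ^+ _]mul1r -mulrA.
  apply: qcommM; first exact/comm_torus/torus_comm_c.
  apply: qcommM; last exact/qcomm1X/c_phi2.
  by apply: qcommX; apply: qcommC phi1_c.
have Wd v : qcomm (al^-1 ^+ es v)
    (cf v *: (torus (ei v) (ej v) * (phi1 ^+ es v * phi2 ^+ eu v))) d.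
  apply: qcommZl; rewrite -[al^-1 ^+ _]mulr1 -[al^-1 ^+ _]mul1r -mulrA.
  apply: qcommMl; first exact/torus_comm_sym/torus_comm_d.
  apply: qcommMl; last exact/qcomm1_sym/qcomm1X/d_phi2.
  by apply: qcommXl; apply: phi1_d.
move/(weyl_sep r (al^-1 ^+ i) al0 al1 (weyl_c H) iP s1 lam0 cW Wd).
rewrite (eq_bigr (fun v => torus (ei v) (ej v) *
  (cf v *: (phi1 ^+ es v * phi2 ^+ eu v)))); last by move=> v _; rewrite mulZr.
have cX' v : torus_comm (cf v *: (phi1 ^+ es v * phi2 ^+ eu v)).
  by have [cv1 cv2] := cX v; split; apply: qcommZ.
move/(sep_torus i0 j0 iP cX').
rewrite (eq_bigl (fun v => key v == (t, r, i, u, (i0, j0)))) => [|v]; last first.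
  apply/idP/eqP => [|e]; last first.
    by move: e; rewrite /b_weight => -[-> -> -> -> -> ->]; rewrite !eqxx.
  rewrite /b_weight => /andP[/andP[/andP[/andP[/eqP et0 /eqP bw] /eqP er0] /eqP es0] /eqP[ei0 ej0]].
  move: bw; rewrite er0 => /(mulfI (expfz_neq0 _ p0)) bw.
  have eu0 : eu v = u by apply: (nonrootX_inj (nonrootV beR)).
  have es1 : es v = i by apply: (nonrootX_inj (nonrootV alR)).
  by rewrite /key et0 er0 es1 eu0 ei0 ej0.
rewrite (eq_bigr (fun v => cf v *: (phi1 ^+ i * phi2 ^+ u))); last first.
  by move=> v /eqP[_ _ <- <- _ _].
rewrite -scaler_suml => /(lidealZK lP g0); rewrite -[phi1 ^+ _]mul1r.
by move=> /(saturatedX s2)/(saturatedX s1).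
Qed.

(** * Normality of [phi1] and [phi2] *)

Lemma normal_left w : (forall g, g \in gens -> exists l, qcomm l w g) ->
  forall x, exists y, w * x = y * w.
Proof.
move=> wg; apply: (heis_gen H (B := [set x | exists y, w * x = y * w])).
- by exists 1; rewrite mulr1 mul1r.
- by move=> x y [x' ex] [y' ey]; exists (x' + y'); rewrite mulrDr mulrDl ex ey.
- by move=> l x [x' ex]; exists (l *: x'); rewrite mulZr mulZl ex.
move=> g x /wg [l wgl] [x' ex]; exists (l *: (g * x')).
by rewrite mulrA wgl !mulZl -mulrA ex mulrA.
Qed.

Lemma normal_right w : (forall g, g \in gens -> exists2 l, l != 0 & qcomm l w g) ->
  forall x, exists y, x * w = w * y.
Proof.
move=> wg; apply: (heis_gen H (B := [set x | exists y, x * w = w * y])).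
- by exists 1; rewrite mulr1 mul1r.
- by move=> x y [x' ex] [y' ey]; exists (x' + y'); rewrite mulrDr mulrDl ex ey.
- by move=> l x [x' ex]; exists (l *: x'); rewrite mulZr mulZl ex.
move=> g x /wg [l l0 /(qcommC l0) wgl] [x' ex]; exists (l^-1 *: (g * x')).
by rewrite -mulrA ex mulrA wgl mulZl mulZr !mulrA.
Qed.

Lemma gens_ind (Q : A -> Prop) : Q a -> Q ai -> Q K -> Q Ki -> Q c -> Q d ->
  Q b -> Q f -> forall g, g \in gens -> Q g.
Proof.
move=> Qa Qai QK QKi Qc Qd Qb Qf g; rewrite !seq.inE.
by do ![case/orP => [/eqP->//|]]; move/eqP->.
Qed.

Lemma phi1_gens g : g \in gens -> exists2 l, l != 0 & qcomm l phi1 g.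
Proof.
have alV0 : al^-1 != 0 by rewrite invr_eq0.
have [pa pai pK pKi] := torus_commV torus_comm_phi1; have o0 := oner_neq0 k.
move: g; apply: gens_ind; try by exists 1.
- by exists al => //; apply: phi1_c.
- by exists al^-1 => //; apply: phi1_d.
- by exists 1 => //; apply/qcomm1_sym/b_phi1.
- by exists 1 => //; apply/qcomm1_sym/f_phi1.
Qed.

Lemma phi2_gens g : g \in gens -> exists2 l, l != 0 & qcomm l phi2 g.
Proof.
have beV0 : be^-1 != 0 by rewrite invr_eq0.
have [pa pai pK pKi] := torus_commV torus_comm_phi2; have o0 := oner_neq0 k.
move: g; apply: gens_ind; try by exists 1.
- by exists 1 => //; apply/qcomm1_sym/c_phi2.
- by exists 1 => //; apply/qcomm1_sym/d_phi2.
- by exists be => //; apply: phi2_b.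
- by exists be^-1 => //; apply: phi2_f.
Qed.

Lemma phi1_left x : exists y, phi1 * x = y * phi1.
Proof. by apply: normal_left x => g /phi1_gens[l _]; exists l. Qed.
Lemma phi1_right x : exists y, x * phi1 = phi1 * y.
Proof. exact: normal_right phi1_gens x. Qed.
Lemma phi2_left x : exists y, phi2 * x = y * phi2.
Proof. by apply: normal_left x => g /phi2_gens[l _]; exists l. Qed.
Lemma phi2_right x : exists y, x * phi2 = phi2 * y.
Proof. exact: normal_right phi2_gens x. Qed.

Local Notation L1 := (left_span1 phi1).

Lemma phi1_span_ideal : two_sided_ideal L1.
Proof. by apply: left_span1_ideal => x; have [y ->] := phi1_left x; exists y. Qed.

Let L1l := ideal_left phi1_span_ideal.

Lemma zpow_modD z t : L1 (zpow c d z * zpow c d t - zpow c d (z + t)).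
Proof.
exact: weyl_zpowD_mod al0 (weyl_c H) phi1_span_ideal (left_span1_mem _).
Qed.

(** * Primes over [phi1] that avoid [phi2] *)

Section Ratio.
Variables (M N : nat).
Hypotheses (M0 : (0 < M)%N) (N0 : (0 < N)%N).
Hypothesis relMN : be ^+ M = p^-1 ^+ N.
(** The exponents [(r, u)] for which [zpow c d r * phi2 ^+ u] commutes with [b] are
    the multiples of [(- N, M)]. *)
Hypothesis weights : forall r u : int, p ^ r = be ^ u ->
  exists j : int, r = - (N%:Z * j) /\ u = M%:Z * j.

(** Modulo [phi1], where [d] is the inverse of [c], this is [phi2 ^ M / c ^ N]. It
    becomes central by the relation [be ^ M = p ^ (- N)]. It is written [Z] in the
    comments below. *)
Definition ratio : A := phi2 ^+ M * d ^+ N.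

Lemma phi2_d n r : phi2 ^+ n * d ^+ r = d ^+ r * phi2 ^+ n.
Proof.
have : qcomm 1 (d ^+ r) (phi2 ^+ n).
  apply: qcomm1X; apply: qcomm1_sym; apply: qcomm1X; apply: qcomm1_sym.
  exact: d_phi2.
by rewrite /qcomm scale1r.
Qed.

Lemma phi2_zpow n r : phi2 ^+ n * zpow c d r = zpow c d r * phi2 ^+ n.
Proof.
have : qcomm 1 (zpow c d r) (phi2 ^+ n).
  apply: qcomm1X; apply: qcomm1_sym; apply: qcomm1_zpow; apply: qcomm1_sym.
    exact: c_phi2.
  exact: d_phi2.
by rewrite /qcomm scale1r.
Qed.

Lemma torus_comm_ratio : torus_comm ratio.
Proof.
by apply: torus_commM; apply: torus_commX; [apply: torus_comm_phi2|apply: torus_comm_d].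
Qed.

Lemma commutatorM (z g x : A) :
  z * (g * x) - (g * x) * z = (z * g - g * z) * x + g * (z * x - x * z).
Proof. by rewrite mulrBl mulrBr !mulrA addrA subrK. Qed.

Lemma ratio_comm x : L1 (ratio * x - x * ratio).
Proof.
have ex g : qcomm 1 ratio g -> L1 (ratio * g - g * ratio).
  by move=> ->; rewrite scale1r subrr; apply: lideal0.
apply: (heis_gen H (B := [set x | L1 (ratio * x - x * ratio)])) x => /=.
- by rewrite mulr1 mul1r subrr; apply: lideal0.
- move=> x y Lx Ly; rewrite mulrDr mulrDl opprD addrACA.
  exact: lidealD.
- by move=> l x Lx; rewrite mulZr mulZl -scalerBr; apply: lidealZ.
move=> g x gens_g Lx; rewrite commutatorM; apply: lidealD => //; last exact: lidealM.
apply: idealMr; first exact: phi1_span_ideal.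
have [Za Zai ZK ZKi] := torus_commV torus_comm_ratio.
move: g gens_g; apply: gens_ind; try exact: ex.
- have -> : ratio * c - c * ratio = phi2 ^+ M * (d ^+ N * c - c * d ^+ N).
    rewrite mulrBr /ratio !mulrA; congr (_ - _ * _).
    by have := phi2_zpow M 1; rewrite /= expr1 => ->.
  apply: lidealM => //.
  have := lidealB L1l (zpow_modD (- N%:Z) 1) (zpow_modD 1 (- N%:Z)).
  by rewrite (addrC 1 (- N%:Z)) opprB addrA subrK zpow_opp.
- apply: ex; rewrite /ratio -(mulr1 1); apply: qcommMl.
    by apply: qcomm1_sym; apply: qcomm1X; apply: d_phi2.
  by apply: qcomm1_sym; apply: qcomm1X; apply: qcomm_refl.
- apply: ex; have -> : 1 = be ^+ M * p ^+ N by rewrite relMN exprVn mulVf // expf_neq0.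
  by apply: qcommMl; apply: qcommXl; [apply: phi2_b|apply: d_b].
- apply: ex; have -> : 1 = be^-1 ^+ M * p^-1 ^+ N.
    by rewrite exprVn relMN -exprVn invrK -exprMn mulfV // expr1n.
  by apply: qcommMl; apply: qcommXl; [apply: phi2_f|apply: d_f].
Qed.

Lemma ratioX n : ratio ^+ n = phi2 ^+ (M * n) * d ^+ (N * n).
Proof.
rewrite /ratio exprMn_comm; first by rewrite -!exprM.
exact: phi2_d.
Qed.

(** Two pairs of exponents [(r, u)] of the same weight under [b] differ by a
    multiple of [(- N, M)]. Factoring out the one with the least power of [phi2]
    leaves a polynomial in the ratio. *)
Lemma homogeneous_ratio (s : seq (term k)) (Q : pred (term k)) l0 :
  (forall v, Q v -> b_weight v = l0) -> exists r0 u0 g,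
  L1 (\sum_(v <- s | Q v) cf v *: (zpow c d (er v) * phi2 ^+ eu v)
      - zpow c d r0 * phi2 ^+ u0 * horner_alg ratio g).
Proof.
move=> Ql; rewrite -big_filter; set s' := filter Q s.
have [s'0|] := eqVneq s' [::].
  exists 0, 0%N, 0; rewrite s'0 big_nil raddf0 mulr0 subr0; exact: lideal0.
case Es: s' => [//|v1 s1] _; have s'v1 : v1 \in s' by rewrite Es mem_head.
(* the term [v0] with the least power of [phi2] *)
have ex_u : exists u, u \in map (@eu k) s' by exists (eu v1); apply: map_f.
have /mapP[v0 s'v0 u0E] : ex_minn ex_u \in map (@eu k) s' by case: ex_minnP.
have u0_min v : v \in s' -> (eu v0 <= eu v)%N.
  by move=> s'v; rewrite -u0E; case: ex_minnP => u _; apply; apply: map_f.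
have ljv v : v \in s' -> exists j : nat,
    er v = er v0 - (N * j)%N%:Z /\ eu v = (eu v0 + M * j)%N.
  move=> s'v; have: b_weight v = b_weight v0.
    by move: s'v s'v0; rewrite !mem_filter => /andP[/Ql-> _] /andP[/Ql-> _].
  rewrite /b_weight !exprVn => /eqP; rewrite eqr_div ?expf_neq0 // => /eqP bw.
  have : p ^ (er v - er v0) = be ^ ((eu v)%:Z - (eu v0)%:Z).
    rewrite !expfzDr // -!invr_expz; apply/eqP; rewrite eqr_div ?expfz_neq0 //.
    by apply/eqP; rewrite -!exprnP bw mulrC.
  case/weights => j [ej0 uj0]; have := u0_min v s'v.
  case: j ej0 uj0 => j ej0 uj0 lu; last by exfalso; nia.
  by exists j; split; [lia|nia].
pose kk v := ((eu v - eu v0) %/ M)%N.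
have kkP v : v \in s' -> er v = er v0 - (N * kk v)%N%:Z /\ eu v = (eu v0 + M * kk v)%N.
  move=> /ljv[j [-> euj]]; have -> : kk v = j by rewrite /kk euj addKn mulKn.
  by [].
exists (er v0), (eu v0), (\sum_(v <- s') cf v *: 'X^(kk v)).
rewrite -Es raddf_sum mulr_sumr -sumrB big_seq; apply: lideal_sum => // v s'v.
rewrite /= linearZ /= rmorphXn /= horner_algX mulr_algl mulZr -scalerBr; apply: lidealZ => //.
have [-> ->] := kkP _ s'v; rewrite ratioX exprD -!mulrA (mulrA (phi2 ^+ eu v0)) -exprD.
rewrite phi2_d !mulrA -mulrBl; apply: idealMr; first exact: phi1_span_ideal.
rewrite -[X in L1 X]opprB; apply: lidealN => //.
have := zpow_modD (er v0) (- (N * kk v)%N%:Z).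
by rewrite [zpow c d (- _)]zpow_opp.
Qed.

Lemma ratio_phi2 g n : horner_alg ratio g * phi2 ^+ n = phi2 ^+ n * horner_alg ratio g.
Proof.
elim/poly_ind: g => [|g l IHg]; first by rewrite rmorph0 mul0r mulr0.
rewrite rmorphD rmorphM /= horner_algX horner_algC mulrDl mulrDr mulr_algl mulr_algr.
congr (_ + _); rewrite [RHS]mulrA -IHg -!mulrA; congr (_ * _).
by rewrite /ratio -?mulrA -phi2_d !mulrA -!exprD addnC.
Qed.

(** Modulo [phi1], [x] is a sum of terms, one for each weight, of the form
    [b^t torus(i, j) c^r phi2^u g(Z)]. The sequence [gs] lists the polynomials [g]:
    a left ideal containing [phi1] and the [g(Z)] contains [x], and conversely weights
    can be separated in a two-sided ideal saturated under [phi2], after which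
    [torus(i, j)], [c^r] and [phi2^u] are cancelled. *)
Lemma ratio_content x : exists gs : seq {poly k},
  (forall L, left_ideal L -> L phi1 ->
     (forall g, g \in gs -> L (horner_alg ratio g)) -> L x) /\
  (forall P, two_sided_ideal P -> P phi1 -> saturated P phi2 -> P x ->
     forall g, g \in gs -> P (horner_alg ratio g)).
Proof.
have [s ->] := monomials_span x.
pose key v := (et v, b_weight v, (ei v, ej v)).
pose Q j v := (es v == 0%N) && (key v == j).
have hom j : {rug : int * nat * {poly k} |
  L1 (\sum_(v <- s | Q j v) cf v *: (zpow c d (er v) * phi2 ^+ eu v)
      - zpow c d rug.1.1 * phi2 ^+ rug.1.2 * horner_alg ratio rug.2)}.
  apply: cid; have [|r0 [u0 [g Lg]]] := @homogeneous_ratio s (Q j) j.1.2.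
    by move=> v /andP[_ /eqP <-].
  by exists (r0, u0, g).
pose G j := (sval (hom j)).2.
have rest L : left_ideal L -> L phi1 -> L (\sum_(v <- s | es v != 0%N) monot v).
  move=> lL Lphi; apply: lideal_sum => // v; rewrite -lt0n => es0.
  rewrite /monot; apply: lidealZ => //; do 4! apply: lidealM => //.
  have phi12 : phi1 ^+ es v * phi2 ^+ eu v = phi2 ^+ eu v * phi1 ^+ es v.
    have := qcomm1_sym (qcomm1X (es v) (qcomm1_sym (qcomm1X (eu v) phi1_phi2))).
    by rewrite /qcomm scale1r.
  rewrite phi12 -(prednK es0) exprSr mulrA; exact: lidealM.
exists [seq G j | j <- undup (map key s)]; split.
  move=> L lL Lphi LG; rewrite (bigID (fun v => es v == 0%N)) /=.
  apply: lidealD => //; last exact: rest.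
  rewrite -big_filter (big_group key) big_seq; apply: lideal_sum => // j.
  rewrite mem_undup => /mapP[v0]; rewrite mem_filter => /andP[/eqP es0 sv0] jE.
  rewrite big_filter_cond.
  rewrite (eq_bigr (fun v => zpow b f j.1.1 * (torus j.2.1 j.2.2 *
     (cf v *: (zpow c d (er v) * phi2 ^+ eu v))))); last first.
    move=> v /andP[/eqP ev /eqP <-]; rewrite monotE /no_b ev mul1r !mulZr /=; congr (_ *: (_ * _)).
    rewrite (mulrA (zpow c d _)) (mulrA (torus _ _)); congr (_ * _).
    have := comm_torus (ei v) (ej v) (torus_comm_zpow (er v) torus_comm_c torus_comm_d).
    by rewrite /qcomm scale1r.
  rewrite -!mulr_sumr; do 2! apply: lidealM => //.
  have LGj : L (zpow c d (sval (hom j)).1.1 * phi2 ^+ (sval (hom j)).1.2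
      * horner_alg ratio (G j)).
    by apply: lidealM => //; apply/LG/map_f; rewrite mem_undup jE map_f.
  apply: (lideal_sub lL _ LGj); apply: (left_span1_min lL Lphi).
  exact: svalP (hom j).
move=> P iP Pphi sP Px g /mapP[j _ ->]; have lP := ideal_left iP.
have L1P := left_span1_min lP Pphi.
have : P (\sum_(v <- s | es v == 0%N) monot v).
  move: Px; rewrite (bigID (fun v => es v == 0%N)) /= => /lidealB.
  by move=> /(_ _ lP (rest _ lP Pphi)); rewrite addrK.
case: j => [[t0 l0] [i0 j0]].
move=> /(sep_b t0 l0 iP sP).
rewrite (eq_bigr (fun v => torus (ei v) (ej v) *
  (cf v *: (zpow c d (er v) * phi2 ^+ eu v)))); last first.
  move=> v /andP[/andP[/eqP ev _] _]; rewrite /no_b ev mul1r mulZr; congr (_ *: _).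
  rewrite (mulrA (zpow c d _)) (mulrA (torus _ _)); congr (_ * _).
  have := comm_torus (ei v) (ej v) (torus_comm_zpow (er v) torus_comm_c torus_comm_d).
  by rewrite /qcomm scale1r.
have cX v : torus_comm (cf v *: (zpow c d (er v) * phi2 ^+ eu v)).
  have [] := torus_commM (torus_comm_zpow (er v) torus_comm_c torus_comm_d)
    (torus_commX (eu v) torus_comm_phi2).
  by split; apply: qcommZ.
move=> /(sep_torus i0 j0 iP cX).
rewrite (eq_bigl (Q (t0, l0, (i0, j0)))) => [PQ|v]; last first.
  by rewrite /Q /key !xpair_eqE -!andbA.
have := svalP (hom (t0, l0, (i0, j0))); rewrite -/(G _).
set r0 := _.1.1; set u0 := _.1.2 => /L1P PG.
have := lidealB lP PQ PG; rewrite opprB addrC subrK -mulrA -ratio_phi2.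
move=> /(lidealM (zpow c d (- r0)) lP); rewrite mulrA => Pr.
apply: (saturatedX sP (n := u0)).
apply: (lideal_sub lP (y := zpow c d (- r0) * zpow c d r0 *
   (horner_alg ratio (G (t0, l0, (i0, j0))) * phi2 ^+ u0))) => //.
rewrite -[X in X - _]mul1r -mulrBl -opprB mulNr; apply: lidealN => //.
apply: idealMr => //; apply: L1P.
by have := zpow_modD (- r0) r0; rewrite addNr.
Qed.

Local Notation J z := (left_span2 phi1 (ratio - z%:A)).

Lemma J_ideal z : two_sided_ideal (J z).
Proof.
have lJ := left_span2_left phi1 (ratio - z%:A).
have Jphi := left_span2_meml phi1 (ratio - z%:A).
apply: left_span2_ideal => x.
  by have [y ->] := phi1_left x; apply: lidealM.
have -> : (ratio - z%:A) * x = x * (ratio - z%:A) + (ratio * x - x * ratio).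
  by rewrite mulrBl mulrBr mulr_algl mulr_algr [RHS]addrC addrA subrK.
apply: lidealD => //; first by apply: lidealM => //; apply: left_span2_memr.
by apply: left_span1_min (ratio_comm x).
Qed.

(** Modulo [Z - z] a polynomial in [Z] is its value at [z]. *)
Lemma horner_rem z g : exists x, horner_alg ratio g = x * (ratio - z%:A) + (g.[z])%:A.
Proof.
have /factor_theorem[h hE] : root (g - (g.[z])%:P) z.
  by rewrite /root hornerD hornerN hornerC subrr.
exists (horner_alg ratio h); apply/eqP; rewrite -subr_eq; apply/eqP.
have := congr1 (horner_alg ratio) hE.
by rewrite rmorphB rmorphM rmorphB /= horner_algX !horner_algC.
Qed.

Lemma horner_value L z g : left_ideal L -> L (ratio - z%:A) ->
  L (horner_alg ratio g) -> L (g.[z])%:A.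
Proof.
move=> lL LZ; have [y ->] := horner_rem z g => Lg.
by have := lidealB lL Lg (lidealM y lL LZ); rewrite addrC addKr.
Qed.

Lemma scalar_ideal P l : left_ideal P -> P l%:A -> ~ P 1 -> l = 0.
Proof.
by move=> lP Pl nP1; apply: contrapT => /eqP l0; apply: nP1; apply: lidealZK Pl.
Qed.

(** If [Z] is a nonzero scalar modulo [P] then [phi2] is invertible modulo [P]. *)
Lemma ratio_saturated P z :
  z != 0 -> two_sided_ideal P -> P (ratio - z%:A) -> saturated P phi2.
Proof.
move=> z0 iP PZ; have lP := ideal_left iP.
apply: (unit_saturated (w' := z^-1 *: (phi2 ^+ M.-1 * d ^+ N))) => //.
rewrite mulZr mulrA -exprS prednK //.
have -> : z^-1 *: (phi2 ^+ M * d ^+ N) - 1 = z^-1 *: (ratio - z%:A).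
  by rewrite scalerBr scalerA mulVf // scale1r.
exact: lidealZ.
Qed.

(** An element of [Q] has contents [g(Z)] in [Q], and modulo [Z - z] these are the
    scalars [g.[z]]; they vanish as [Q] is proper. *)
Lemma J_max z Q : z != 0 -> two_sided_ideal Q -> J z `<=` Q -> ~ Q 1 -> Q `<=` J z.
Proof.
move=> z0 iQ JQ nQ1 x Qx; have lQ := ideal_left iQ.
have QZ : Q (ratio - z%:A) by apply/JQ/left_span2_memr.
have [gs [gsL gsP]] := ratio_content x.
have QG := gsP Q iQ (JQ _ (left_span2_meml _ _)) (ratio_saturated z0 iQ QZ) Qx.
apply: gsL; [exact: left_span2_left|exact: left_span2_meml|move=> g /QG Qg].
have [y gE] := horner_rem z g; rewrite gE.
have -> : g.[z] = 0.
  by apply: (scalar_ideal lQ) => //; apply: horner_value QZ Qg.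
rewrite scale0r addr0; apply: lidealM; first exact: left_span2_left.
exact: left_span2_memr.
Qed.

(** One passes from one generator to the other by multiplying by [d ^+ N] or
    [c ^+ N], which are inverse to each other modulo [phi1]. *)
Lemma J_generator z : J z = left_span2 phi1 (phi2 ^+ M - z *: c ^+ N).
Proof.
have cd_mod : L1 (c ^+ N * d ^+ N - 1).
  by have := zpow_modD N (- N%:Z); rewrite addrN zpow_opp.
have dc_mod : L1 (d ^+ N * c ^+ N - 1).
  by have := zpow_modD (- N%:Z) N; rewrite addNr zpow_opp.
apply/seteqP; split; apply: left_span2_min;
  try exact: left_span2_meml; try exact: left_span2_left.
  set w := phi2 ^+ M - _; have lL := left_span2_left phi1 w.
  have -> : ratio - z%:A = d ^+ N * w + z *: (d ^+ N * c ^+ N - 1).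
    by rewrite mulrBr -phi2_d mulZr scalerBr addrA subrK.
  apply: lidealD => //; first by apply: lidealM => //; apply: left_span2_memr.
  apply: lidealZ => //; apply: left_span1_min dc_mod => //.
  exact: left_span2_meml.
have lL := left_span2_left phi1 (ratio - z%:A).
have cN : c ^+ N * phi2 ^+ M = phi2 ^+ M * c ^+ N.
  by have /= := phi2_zpow M N => ->.
have -> : phi2 ^+ M - z *: c ^+ N = c ^+ N * (ratio - z%:A) - phi2 ^+ M * (c ^+ N * d ^+ N - 1).
  by rewrite !mulrBr mulr1 mulr_algr /ratio !mulrA cN opprB [RHS]addrC addrA subrK.
apply: lidealB => //; apply: lidealM => //; first exact: left_span2_memr.
apply: left_span1_min cd_mod => //; exact: left_span2_meml.
Qed.

(** If [P] contains no nonzero polynomial in [Z], the contents of its elements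
    vanish and [P] is generated by [phi1]. Otherwise [Z] being central modulo [phi1],
    primeness reduces such a polynomial to a linear factor [Z - z]; here [z] is
    not zero because [phi2] is not in [P], and [J z] is maximal. *)
Lemma prime_stratum (closed : forall g : {poly k}, size g != 1%N -> exists z, root g z)
    P : prime_ideal P -> P phi1 -> ~ P phi2 ->
  P = L1 \/ exists2 z, z != 0 & P = J z.
Proof.
move=> pP Pphi1 nPphi2; have [iP PT _] := pP; have lP := ideal_left iP.
have nP1 : ~ P 1 by apply/ideal_proper.
have sP : saturated P phi2.
  apply: prime_saturated => // x; have [y ->] := phi2_right x.
  by exists y; rewrite subrr; apply: lideal0.
have L1P := left_span1_min lP Pphi1.
have [[g g0 Pg]|noP] := pselect (exists2 g, g != 0 & P (horner_alg ratio g)); last first.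
  left; apply/seteqP; split=> // x Px; have [gs [gsL gsP]] := ratio_content x.
  have PG := gsP P iP Pphi1 sP Px.
  apply: gsL => //; [exact: left_span1_mem|move=> g /PG Pg].
  have [->|g0] := eqVneq g 0; first by rewrite rmorph0; apply: lideal0.
  by case: noP; exists g.
have [z Pz] : exists z, P (ratio - z%:A).
  (* induction on the degree: split off a root and use primeness *)
  elim: (size g) {-2}g (leqnn (size g)) g0 Pg => {g} [|n IHn] g.
    by rewrite leqn0 size_poly_eq0 => /eqP->; rewrite eqxx.
  move=> szg g0 Pg; have [/size_poly1P[l l0 gE]|] := boolP (size g == 1%N).
    by move: Pg; rewrite gE horner_algC => /(scalar_ideal lP)/(_ nP1) l00; rewrite l00 eqxx in l0.
  move=> /closed[z /factor_theorem[h gE]].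
  move: Pg; rewrite gE rmorphM rmorphB /= horner_algX horner_algC => Pg.
  have [x|Ph|Pz] := @prime_elim _ P (horner_alg ratio h) (ratio - z%:A) pP.
  - rewrite -mulrA.
    have -> : x * (ratio - z%:A) = (ratio - z%:A) * x - (ratio * x - x * ratio).
      by rewrite mulrBl mulrBr mulr_algl mulr_algr opprB [RHS]addrC addrA subrK.
    rewrite mulrBr mulrA; apply: lidealB => //; first exact: idealMr.
    by apply: lidealM => //; apply/L1P/ratio_comm.
  - have h0 : h != 0 by apply: contraNneq g0 => h0; rewrite gE h0 mul0r.
    apply: (IHn h) => //.
    by move: szg; rewrite gE size_Mmonic ?monicXsubC // size_XsubC addn2.
  - by exists z.
have z0 : z != 0.
  apply/eqP => z0; apply: nP1; apply: (saturatedX sP (n := M)); rewrite mul1r.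
  move: Pz; rewrite z0 scale0r subr0 => /(idealMr (c ^+ N) iP).
  rewrite /ratio -mulrA => PZ; apply: (lideal_sub lP _ PZ).
  rewrite -{1}[phi2 ^+ M]mulr1 -mulrBr; apply: lidealM => //.
  rewrite -[X in P X]opprB; apply: lidealN => //; apply: L1P.
  by have := zpow_modD (- N%:Z) N; rewrite addNr zpow_opp.
have JP : J z `<=` P by apply: left_span2_min.
by right; exists z => //; apply/seteqP; split=> //; apply: J_max.
Qed.

Hypothesis J_proper : forall z, z != 0 -> ~ J z 1.

Lemma J_prime z : z != 0 -> prime_ideal (J z).
Proof.
move=> z0; apply: maximal_prime; [exact: J_ideal|exact: J_proper|].
by move=> Q iQ JQ nQ1; apply: J_max.
Qed.

Lemma J_inj z z' : z' != 0 -> J z `<=` J z' -> z = z'.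
Proof.
move=> z0' JJ; have lJ := left_span2_left phi1 (ratio - z'%:A).
apply/esym/eqP; rewrite -subr_eq0; apply/eqP/(scalar_ideal lJ _ (J_proper z0')).
have -> : (z' - z)%:A = (ratio - z%:A) - (ratio - z'%:A).
  by rewrite opprB [RHS]addrC addrA subrK scalerBl.
by apply: lidealB => //; [apply/JJ/left_span2_memr|apply: left_span2_memr].
Qed.

(** The powers of [q] are pairwise distinct, so one of them is not a root. *)
Lemma nonroot_witness (g : {poly k}) : g != 0 -> exists2 z, z != 0 & ~~ root g z.
Proof.
move=> g0; pose rs := [seq q ^+ i | i <- iota 0 (size g)].
have uq : uniq rs by rewrite map_inj_uniq ?iota_uniq //; apply: nonrootX_inj.
have [all_rs|/allPn[z /mapP[i _ ->] nr]] := boolP (all (root g) rs).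
  by have := max_poly_roots g0 all_rs uq; rewrite size_map size_iota ltnn.
by exists (q ^+ i) => //; rewrite expf_neq0.
Qed.

(** An element outside [A phi1] has a nonzero content [g], and lies in [J z] only if
    [g] vanishes at [z]. Given such elements in two ideals, the prime [J z] at a
    common nonroot contains neither, hence not the product of the ideals. *)
Lemma phi1_span_prime : prime_ideal L1.
Proof.
have L1J z : L1 `<=` J z.
  by apply: left_span1_min; [apply: left_span2_left|apply: left_span2_meml].
have contentL x : ~ L1 x -> exists2 g, g != 0 &
    forall z, z != 0 -> J z x -> root g z.
  have [gs [gsL gsP]] := ratio_content x => nLx.
  have [g gs_g g0] : exists2 g, g \in gs & g != 0.
    apply: contrapT => no_g; apply: nLx; apply: gsL => //; first exact: left_span1_mem.
    move=> g gs_g; have [->|g0] := eqVneq g 0; first by rewrite rmorph0; apply: lideal0.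
    by case: no_g; exists g.
  exists g => // z z0 Jx; have JZ := left_span2_memr phi1 (ratio - z%:A).
  have Jg := gsP _ (J_ideal z) (left_span2_meml _ _)
    (ratio_saturated z0 (J_ideal z) JZ) Jx g gs_g.
  have lJ := left_span2_left phi1 (ratio - z%:A).
  by apply/eqP/(scalar_ideal lJ _ (J_proper z0)); apply: horner_value JZ Jg.
have o0 := oner_neq0 k.
apply: primeP => [||I I' iI iI' II']; first exact: phi1_span_ideal.
  by move=> /(L1J 1); apply: J_proper.
apply: contrapT => /not_orP[/existsNP[x /not_implyP[Ix nLx]] /existsNP[y /not_implyP[Iy nLy]]].
have [g g0 gx] := contentL _ nLx; have [h h0 hy] := contentL _ nLy.
have [z z0] := nonroot_witness (mulf_neq0 g0 h0); rewrite rootM => /norP[ng nh].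
have [r|Jx|Jy] := @prime_elim _ _ x y (J_prime z0).
- by apply/L1J/II' => //; apply: idealMr.
- by rewrite gx in ng.
- by rewrite hy in nh.
Qed.
End Ratio.

(** * The prime that contains [phi1] and [phi2] *)

Local Notation L3 := (left_span2 phi1 phi2).

Lemma phi12_span_ideal : two_sided_ideal L3.
Proof.
have lL := left_span2_left phi1 phi2.
apply: left_span2_ideal => x.
  by have [y ->] := phi1_left x; apply: lidealM => //; apply: left_span2_meml.
by have [y ->] := phi2_left x; apply: lidealM => //; apply: left_span2_memr.
Qed.

(** Modulo [phi1] and [phi2] both pairs consist of inverse elements, and the
    weights under [b], [c], [a], [K] determine all the remaining exponents. *)
Lemma phi12_span_max Q : nonroot p -> two_sided_ideal Q -> Q phi1 -> Q phi2 -> ~ Q 1 ->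
  Q `<=` L3.
Proof.
move=> pR iQ Q1 Q2 nQ1 x; have [s ->] := monomials_span x => Qx; have lQ := ideal_left iQ.
have lL := left_span2_left phi1 phi2.
pose Q0 v := (es v == 0%N) && (eu v == 0%N).
have rest L : left_ideal L -> L phi1 -> L phi2 -> L (\sum_(v <- s | ~~ Q0 v) monot v).
  move=> lL' Lphi1 Lphi2; apply: lideal_sum => // v Qv.
  rewrite /monot; apply: lidealZ => //; do 4! apply: lidealM => //.
  have [eu0|eu0] := posnP (eu v).
    move: Qv; rewrite /Q0 eu0 eqxx andbT -lt0n expr0 mulr1 => es0.
    by rewrite -(prednK es0) exprSr; apply: lidealM.
  by rewrite -(prednK eu0) [phi2 ^+ _]exprSr mulrA; apply: lidealM.
rewrite (bigID Q0) /=; apply: lidealD => //; last first.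
  by apply: rest; [|apply: left_span2_meml|apply: left_span2_memr].
have {Qx} : Q (\sum_(v <- s | Q0 v) monot v).
  by have := lidealB lQ Qx (rest _ lQ Q1 Q2); rewrite (bigID Q0) /= addrK.
pose X v := zpow b f (et v) * (zpow c d (er v) * (cf v *: torus (ei v) (ej v))).
have monoX v : Q0 v -> monot v = X v.
  by move=> /andP[/eqP es0 /eqP eu0]; rewrite monotE /no_b /X es0 eu0 !mulr1 !mulZr.
have cX v : Q (c * X v - p^-1 ^ et v *: (X v * c)).
  have cb : qcomm (p^-1 ^ et v) c (zpow b f (et v)).
    by apply: qcomm_zpow; rewrite ?invrK; [apply: c_b|apply: c_f].
  have Tc := torus_comm_sym (ei v) (ej v) torus_comm_c.
  rewrite /X (qcomm_push _ cb) -scalerBr; apply: lidealZ => //.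
  rewrite -(mulrA (zpow b f _)) -mulrBr; apply: lidealM => //.
  rewrite -mulrA mulZl Tc scale1r -mulZr !mulrA -mulrBl; apply: idealMr => //.
  have Qcd z t := weyl_zpowD_mod z t al0 (weyl_c H) iQ Q1.
  have := lidealB lQ (Qcd 1 (er v)) (Qcd (er v) 1).
  by rewrite (addrC 1 (er v)) opprB addrA subrK.
have bX v : Q (b * X v - p ^ er v *: (X v * b)).
  have bc : qcomm (p ^ er v) b (zpow c d (er v)).
    by apply: qcomm_zpow; [apply: b_c H|apply: b_d H].
  have bT := comm_torus (ei v) (ej v) torus_comm_b.
  have -> : p ^ er v *: (X v * b) =
      zpow b f (et v) * b * (zpow c d (er v) * (cf v *: torus (ei v) (ej v))).
    rewrite /X -!(mulrA (zpow b f _)) -mulrA mulZl -(mulZr (p ^ er v)); congr (_ * _).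
    rewrite (qcomm_push _ bc); congr (_ *: (_ * _)).
    by rewrite mulZr bT scale1r.
  rewrite /X (mulrA b) -mulrBl; apply: idealMr => //.
  have Qbf z t := weyl_zpowD_mod z t be0 (weyl_b H) iQ Q2.
  have := lidealB lQ (Qbf 1 (et v)) (Qbf (et v) 1).
  by rewrite (addrC 1 (et v)) opprB addrA subrK.
have sc : saturated Q c.
  apply: (unit_saturated (w' := d)) => //.
  by rewrite -[X in Q X]opprB; apply: lidealN.
have sb : saturated Q b.
  apply: (unit_saturated (w' := f)) => //.
  by rewrite -[X in Q X]opprB; apply: lidealN.
rewrite !(eq_bigr _ monoX) => QX.
pose key v := (et v, er v, (ei v, ej v)).
rewrite -big_filter (big_group key) big1_seq; first exact: lideal0.
move=> [[t r] [i j]] _ /=.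
rewrite big_filter_cond; pose Qj v := Q0 v && (key v == (t, r, (i, j))).
suff g0 : \sum_(v <- s | Qj v) cf v = 0.
  rewrite (eq_bigr (fun v => cf v *: (zpow b f t * (zpow c d r * torus i j)))).
    by rewrite -scaler_suml g0 scale0r.
  by move=> v /andP[_ /eqP[<- <- <- <-]]; rewrite /X !mulZr.
apply: (scalar_ideal lQ) => //.
have := weight_sep_sat (p^-1 ^ t) iQ sc cX QX.
move/(weight_sep_sat (p ^ r) iQ sb bX).
rewrite (eq_bigl (fun v => Q0 v && (et v == t) && (er v == r))); last first.
  move=> v; rewrite (inj_eq (nonroot_inj pR)).
  by rewrite (inj_eq (nonroot_inj (nonrootV pR))).
rewrite (eq_bigr (fun v => zpow b f t * (zpow c d r *
   (torus (ei v) (ej v) * (cf v)%:A)))); last first.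
  by move=> v /andP[/andP[_ /eqP <-] /eqP <-]; rewrite /X mulr_algr.
have cancel al' x1 y1 z y : al' != 0 -> weyl_pair al' x1 y1 -> Q (1 - x1 * y1) ->
    Q (zpow x1 y1 z * y) -> Q y.
  move=> al'0 w1 Q1' /(lidealM (zpow x1 y1 (- z)) lQ); rewrite mulrA => Qy.
  apply: (lideal_sub lQ _ Qy); rewrite -[X in X - _]mul1r -mulrBl -opprB mulNr.
  apply: lidealN => //; apply: idealMr => //.
  by have := weyl_zpowD_mod (- z) z al'0 w1 iQ Q1'; rewrite addNr.
rewrite -!mulr_sumr => /(cancel _ _ _ _ _ be0 (weyl_b H) Q2).
move=> /(cancel _ _ _ _ _ al0 (weyl_c H) Q1).
have cA v : torus_comm (cf v)%:A by split; apply: qcommZ; apply: qcomm1.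
move=> /(sep_torus i j iQ cA); rewrite scaler_suml.
by congr Q; apply: eq_bigl => v; rewrite /Qj /key !xpair_eqE -!andbA.
Qed.

Lemma phi12_span_prime : nonroot p -> ~ L3 1 -> prime_ideal L3.
Proof.
move=> pR L31; apply: maximal_prime => // [|Q iQ LQ nQ1]; first exact: phi12_span_ideal.
by apply: phi12_span_max => //; apply: LQ; [apply: left_span2_meml|apply: left_span2_memr].
Qed.

(** * The zero ideal *)

(** The elements [x] such that [x (phi1 phi2)^n] is in [I] for some [n] form an
    ideal saturated under [phi1] and [phi2]. By [generic_simple] it contains [1] as
    soon as [I] is nonzero, so [I] contains a power of [phi1 phi2]. *)
Lemma zero_prime : (forall n, (phi1 * phi2) ^+ n <> 0) -> prime_ideal [set 0 : A].
Proof.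
move=> w_n0; have [w wE] : exists w, w = phi1 * phi2 by eexists.
rewrite -wE in w_n0.
have w_right x : exists y, x * w = w * y.
  have [y e1] := phi1_right x; have [y' e2] := phi2_right y.
  by exists y'; rewrite wE mulrA e1 -!mulrA e2.
have w21 : phi1 * phi2 = phi2 * phi1.
  by have := phi1_phi2; rewrite /qcomm scale1r.
have w_phi1 n : phi1 * w ^+ n = w ^+ n * phi1.
  by apply: commrX; rewrite /GRing.comm wE -mulrA -w21.
have w_phi2 n : phi2 * w ^+ n = w ^+ n * phi2.
  by apply: commrX; rewrite /GRing.comm wE mulrA -w21.
have wX_right n x : exists y, x * w ^+ n = w ^+ n * y.
  elim: n x => [|n IHn] x; first by exists x; rewrite mulr1 mul1r.
  have [y e] := w_right x; have [y' e'] := IHn y.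
  by exists y'; rewrite exprS mulrA e -mulrA e' mulrA.
have lo I : two_sided_ideal I -> ~ I `<=` [set 0] -> exists n, I (w ^+ n).
  move=> iI nI; have lI := ideal_left iI.
  pose I' : set A := [set x | exists n, I (x * w ^+ n)].
  have iI' : two_sided_ideal I'.
    split; first split; rewrite ?classical_sets.inE.
    - by exists 0%N; rewrite mul0r; apply: lideal0.
    - move=> x y; rewrite !classical_sets.inE => -[n Ix] [m Iy]; exists (n + m)%N.
      rewrite mulrBl; apply: lidealB => //.
        by rewrite exprD mulrA; apply: idealMr.
      by rewrite addnC exprD mulrA; apply: idealMr.
    move=> x y [n Iy]; split; exists n; first by rewrite -mulrA; apply: lidealM.
    by have [x' e] := wX_right n x; rewrite -mulrA e mulrA; apply: idealMr.
  have [n] : I' 1.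
    apply: contrapT => nI'1; apply: nI => x Ix.
    apply: (generic_simple iI') => //; last by exists 0%N; rewrite mulr1.
      move=> y [n Iy]; exists n.+1; rewrite exprS {1}wE -(mulrA phi1) w_phi2.
      by rewrite !mulrA; apply: idealMr.
    move=> y [n Iy]; exists n.+1; rewrite exprS {1}wE w21 -(mulrA phi2) w_phi1.
    by rewrite !mulrA; apply: idealMr.
  by rewrite mul1r; exists n.
apply: primeP => [||I J iI iJ IJ].
- split; first split; rewrite ?classical_sets.inE //.
    by move=> x y; rewrite !classical_sets.inE => -> ->; rewrite subr0.
  by move=> x y ->; rewrite mulr0 mul0r.
- by move=> /= o0; apply: (w_n0 0%N).
apply: contrapT => /not_orP[/(lo _ iI)[n In] /(lo _ iJ)[m Jm]].
by apply: (w_n0 (n + m)%N); rewrite exprD; apply: IJ.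
Qed.

End Presentation.
End TwoPairs.

(** * The pairs inside the Heisenberg double *)

Section HeisenbergRelations.
Context (k : fieldType) (A : algType k).

(** The relations of the double for elements of any algebra, to be applied to
    the presented algebra once it is known to be nonzero. *)
Record hd_rels (q : k) (m n : int) (a ai b c K Ki E F : A) : Prop := HdRels {
  hd_ab : a * b = q ^ n *: (b * a);
  hd_ac : a * c = q ^ m *: (c * a);
  hd_bc : b * c = c * b;
  hd_aai : a * ai = 1; hd_aia : ai * a = 1;
  hd_KE : K * E = q ^ (2 * m) *: (E * K);
  hd_KF : K * F = q ^ (- (2 * n)) *: (F * K);
  hd_EF : E * F = F * E;
  hd_KKi : K * Ki = 1; hd_KiK : Ki * K = 1;
  hd_Ka : K * a = q^-1 *: (a * K);
  hd_Kb : K * b = q ^ n *: (b * K);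
  hd_Kc : K * c = q ^ (- m) *: (c * K);
  hd_Ea : E * a = a * E;
  hd_Eb : E * b = b * E;
  hd_Ec : E * c = c * E + zpow a ai (- m) * zpow K Ki m;
  hd_Fa : F * a = q ^ n *: (a * F);
  hd_Fb : F * b = q ^ (- (n * n)) *: (b * F) + zpow a ai n;
  hd_Fc : F * c = q ^ (m * n) *: (c * F)
}.

Variables (q : k) (m n : int) (a ai b c K Ki E F : A).
Hypotheses (q0 : q != 0) (H : hd_rels q m n a ai b c K Ki E F).

(** Commutation up to powers of [q], so that weights are integers and add up. *)
Definition qz (e : int) (w x : A) : Prop := qcomm (q ^ e) w x.

Let qe0 e : q ^ e != 0. Proof. exact: expfz_neq0. Qed.

Lemma qzM e e' w x y : qz e w x -> qz e' w y -> qz (e + e') w (x * y).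
Proof. by move=> wx wy; rewrite /qz expfzDr //; apply: qcommM. Qed.

Lemma qzMl e e' w x y : qz e w x -> qz e' y x -> qz (e + e') (w * y) x.
Proof. by move=> wx yx; rewrite /qz expfzDr //; apply: qcommMl. Qed.

Lemma qz_sym e w x : qz e w x -> qz (- e) x w.
Proof. by move=> wx; rewrite /qz -invr_expz; apply: qcommC. Qed.

Lemma qz_inv e w x y : x * y = 1 -> y * x = 1 -> qz e w x -> qz (- e) w y.
Proof. by move=> xy yx wx; rewrite /qz -invr_expz; apply: qcomm_inv wx. Qed.

Lemma qz_zpow e z w x y :
  x * y = 1 -> y * x = 1 -> qz e w x -> qz (z * e) w (zpow x y z).
Proof.
move=> xy yx wx; rewrite /qz mulrC -exprz_exp; apply: qcomm_zpow => //.
by rewrite invr_expz; apply: qz_inv wx.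
Qed.

Lemma qz_zpowa e z w : qz e w a -> qz (z * e) w (zpow a ai z).
Proof. by apply: qz_zpow; case: H. Qed.

Lemma qz_zpowK e z w : qz e w K -> qz (z * e) w (zpow K Ki z).
Proof. by apply: qz_zpow; case: H. Qed.

Lemma qz0E w x : w * x = x * w -> qz 0 w x.
Proof. by rewrite /qz expr0z /qcomm scale1r. Qed.

Lemma qzE e w x : qz e w x -> w * x = q ^ e *: (x * w).
Proof. by []. Qed.

Let aa : qz 0 a a. Proof. exact: qz0E. Qed.
Let KK : qz 0 K K. Proof. exact: qz0E. Qed.
Let ab : qz n a b. Proof. by case: H. Qed.
Let ac : qz m a c. Proof. by case: H. Qed.
Let Ka : qz (- 1) K a. Proof. by case: H. Qed.
Let aK : qz 1 a K. Proof. exact: qz_sym Ka. Qed.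
Let Kb : qz n K b. Proof. by case: H. Qed.
Let Kc : qz (- m) K c. Proof. by case: H. Qed.
Let KE : qz (2 * m) K E. Proof. by case: H. Qed.
Let KF : qz (- (2 * n)) K F. Proof. by case: H. Qed.
Let bc : qz 0 b c. Proof. by apply: qz0E; case: H. Qed.
Let bE : qz 0 b E. Proof. by apply: qz0E; case: H. Qed.
Let aE : qz 0 a E. Proof. by apply: qz0E; case: H. Qed.
Let Fa : qz n F a. Proof. by case: H. Qed.
Let Fc : qz (m * n) F c. Proof. by case: H. Qed.
Let FE : qz 0 F E. Proof. by apply: qz0E; case: H. Qed.

(** The elements [b'], [c'], [E'], [F'] in terms of given generators. *)
Definition bp : A := zpow a ai n * b * zpow K Ki (- n).
Definition cp : A := zpow a ai (- m) * c * zpow K Ki (- m).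
Definition Ep : A := zpow a ai (2 * m) * E.
Definition Fp : A :=
  q ^ (- (n * n)) *: (zpow a ai (- (2 * n)) * F * zpow K Ki n).

Lemma qz_bp e1 e2 e3 w : qz e1 w a -> qz e2 w b -> qz e3 w K ->
  qz (n * e1 + e2 - n * e3) w bp.
Proof.
by move=> wa wb wK; rewrite -mulNr; do 2? apply: qzM => //;
  [apply: qz_zpowa|apply: qz_zpowK].
Qed.

Lemma qz_cp e1 e2 e3 w : qz e1 w a -> qz e2 w c -> qz e3 w K ->
  qz (- m * e1 + e2 - m * e3) w cp.
Proof.
by move=> wa wb wK; rewrite -(mulNr m e3); do 2? apply: qzM => //;
  [apply: qz_zpowa|apply: qz_zpowK].
Qed.

Lemma qz_Ep e1 e2 w : qz e1 w a -> qz e2 w E -> qz (2 * m * e1 + e2) w Ep.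
Proof. by move=> wa wE; apply: qzM => //; apply: qz_zpowa. Qed.

Lemma qz_Fp e1 e2 e3 w : qz e1 w a -> qz e2 w F -> qz e3 w K ->
  qz (- (2 * n) * e1 + e2 + n * e3) w Fp.
Proof.
by move=> wa wb wK; apply: qcommZ; do 2? apply: qzM => //;
  [apply: qz_zpowa|apply: qz_zpowK].
Qed.

Lemma qz_cast e e' w x : qz e w x -> e = e' -> qz e' w x.
Proof. by move=> wx <-. Qed.

Let a_bp : qz 0 a bp. Proof. by apply: (qz_cast (qz_bp aa ab aK)); ring. Qed.
Let K_bp : qz 0 K bp. Proof. by apply: (qz_cast (qz_bp Ka Kb KK)); ring. Qed.
Let a_cp : qz 0 a cp. Proof. by apply: (qz_cast (qz_cp aa ac aK)); ring. Qed.
Let K_cp : qz 0 K cp. Proof. by apply: (qz_cast (qz_cp Ka Kc KK)); ring. Qed.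
Let a_Ep : qz 0 a Ep. Proof. by apply: (qz_cast (qz_Ep aa aE)); ring. Qed.
Let K_Ep : qz 0 K Ep. Proof. by apply: (qz_cast (qz_Ep Ka KE)); ring. Qed.
Let a_Fp : qz 0 a Fp.
Proof. by apply: (qz_cast (qz_Fp aa (qz_sym Fa) aK)); ring. Qed.
Let K_Fp : qz 0 K Fp. Proof. by apply: (qz_cast (qz_Fp Ka KF KK)); ring. Qed.

Lemma zpowa_comm z x : qz 0 a x -> zpow a ai z * x = x * zpow a ai z.
Proof.
by move=> /qz_sym/(qz_zpowa z); rewrite oppr0 mulr0 => /qzE ->; rewrite expr0z scale1r.
Qed.

Lemma zpowK_comm z x : qz 0 K x -> zpow K Ki z * x = x * zpow K Ki z.
Proof.
by move=> /qz_sym/(qz_zpowK z); rewrite oppr0 mulr0 => /qzE ->; rewrite expr0z scale1r.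
Qed.

Lemma qz_mulbp e x : qz 0 a x -> qz 0 K x -> qz e b x -> qz e bp x.
Proof.
move=> ax Kx bx; apply: (@qz_cast (0 + e + 0)); last by rewrite add0r addr0.
by do 2? apply: qzMl => //; apply/qz0E; [apply: zpowa_comm|apply: zpowK_comm].
Qed.

Lemma qz_mulFp e x : qz 0 a x -> qz 0 K x -> qz e F x -> qz e Fp x.
Proof.
move=> ax Kx bx; apply: (@qz_cast (0 + e + 0)); last by rewrite add0r addr0.
by apply: qcommZl; do 2? apply: qzMl => //; apply/qz0E;
  [apply: zpowa_comm|apply: zpowK_comm].
Qed.

Lemma bp_cp : qz (2 * m * n) bp cp.
Proof.
apply: qz_mulbp => //.
by apply: (qz_cast (qz_cp (qz_sym ab) bc (qz_sym Kb))); ring.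
Qed.

Lemma bp_Ep : qz (- (2 * m * n)) bp Ep.
Proof.
by apply: qz_mulbp => //; apply: (qz_cast (qz_Ep (qz_sym ab) bE)); ring.
Qed.

Lemma Fp_cp : qz (- (2 * m * n)) Fp cp.
Proof.
by apply: qz_mulFp => //; apply: (qz_cast (qz_cp Fa Fc (qz_sym KF))); ring.
Qed.

Lemma Fp_Ep : qz (2 * m * n) Fp Ep.
Proof. by apply: qz_mulFp => //; apply: (qz_cast (qz_Ep Fa FE)); ring. Qed.

Let aiz z t : zpow a ai z * zpow a ai t = zpow a ai (z + t).
Proof. by rewrite zpowD //; case: H. Qed.
Let Kiz z t : zpow K Ki z * zpow K Ki t = zpow K Ki (z + t).
Proof. by rewrite zpowD //; case: H. Qed.

Lemma Ep_cp : Ep * cp = q ^ (2 * m * m) *: (cp * Ep) + 1.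
Proof.
have -> : Ep * cp = zpow a ai (2 * m) * (E * cp) by rewrite /Ep -mulrA.
have Ea : qz 0 E (zpow a ai (- m)).
  by apply: (qz_cast (qz_zpowa (- m) (qz_sym aE))); ring.
have EK : qz (2 * m * m) E (zpow K Ki (- m)).
  by apply: (qz_cast (qz_zpowK (- m) (qz_sym KE))); ring.
have -> : E * cp = q ^ (2 * m * m) *: (cp * E) + zpow a ai (- (2 * m)).
  rewrite /cp !mulrA (qzE Ea) expr0z scale1r -!mulrA (mulrA E) (hd_Ec H).
  rewrite mulrDl -(mulrA c) (qzE EK) !mulZr -!mulrA mulrDr; congr (_ + _).
    by rewrite !mulZr !mulrA.
  by rewrite Kiz addrN mulr1 aiz; congr (zpow a ai _); ring.
rewrite mulrDr mulZr aiz addrN; congr (_ *: _ + _).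
by rewrite mulrA (zpowa_comm _ a_cp) -mulrA.
Qed.

Lemma Fp_bp : Fp * bp = q ^ (- (2 * n * n)) *: (bp * Fp) + 1.
Proof.
have Fa' : qz (n * n) F (zpow a ai n) by apply: qz_zpowa.
have FK : qz (- (2 * n * n)) F (zpow K Ki (- n)).
  by apply: (qz_cast (qz_zpowK (- n) (qz_sym KF))); ring.
have Fbp : F * bp = q ^ (- (2 * n * n)) *: (bp * F) +
    q ^ (n * n) *: (zpow a ai (2 * n) * zpow K Ki (- n)).
  rewrite /bp !mulrA (qzE Fa') !mulZl -!mulrA (mulrA F) (hd_Fb H).
  rewrite mulrDl mulZl -(mulrA b) (qzE FK) mulrDr !mulZr scalerDr !scalerA.
  rewrite -expfzDr // subrr expr0z mul1r; congr (_ *: _ + _ *: _).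
    by rewrite mulrA.
  by rewrite mulrA aiz; congr (zpow a ai _ * _); ring.
rewrite {1}/Fp mulZl -(mulrA _ _ bp) (zpowK_comm _ K_bp) mulrA -(mulrA _ F) Fbp.
rewrite mulrDr mulrDl scalerDr !mulZr !mulZl scalerA; congr (_ + _).
  rewrite scalerA mulrC; congr (_ *: _).
  by rewrite (mulrA _ bp) (zpowa_comm _ a_bp) !mulrA.
rewrite scalerA -expfzDr // addNr expr0z scale1r mulrA aiz addNr mul1r Kiz addNr.
by [].
Qed.

Lemma Ep_cp_phi : Ep * cp - cp * Ep = 1 - cp * ((1 - q ^ (2 * m * m)) *: Ep).
Proof.
by rewrite Ep_cp (mulZr (1 - _)) scalerBl scale1r opprB addrAC addrC.
Qed.

Lemma Fp_bp_phi : Fp * bp - bp * Fp = 1 - bp * ((1 - q ^ (- (2 * n * n))) *: Fp).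
Proof.
by rewrite Fp_bp (mulZr (1 - _)) scalerBl scale1r opprB addrAC addrC.
Qed.

Lemma left_mul_zpow (B : set A) x y z : (forall u, B u -> B (x * u)) ->
  (forall u, B u -> B (y * u)) -> forall u, B u -> B (zpow x y z * u).
Proof.
have pow (w : A) r : (forall u, B u -> B (w * u)) -> forall u, B u -> B (w ^+ r * u).
  move=> Bw; elim: r => [|r IHr] u Bu; first by rewrite mul1r.
  by rewrite exprS -mulrA; apply/Bw/IHr.
by move=> Bx By u Bu; case: z => r; apply: pow.
Qed.

Hypotheses (al1 : q ^ (2 * m * m) != 1) (be1 : q ^ (- (2 * n * n)) != 1).
Hypothesis gen : generates [:: a; ai; b; c; K; Ki; E; F].

(** The powers of [a] and [K] in the primed elements cancel the weights of [b], [c],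
    [E], [F] under the torus, and the factors [1 - al], [1 - be] give the pairs their
    normal form. *)
Lemma heis_of_hd :
  heis_rel q (q ^ (2 * m * m)) (q ^ (- (2 * n * n))) (q ^ (2 * m * n)) a ai K Ki
    cp ((1 - q ^ (2 * m * m)) *: Ep) bp ((1 - q ^ (- (2 * n * n))) *: Fp).
Proof.
have q1 w x : qz 0 w x -> qcomm 1 w x by rewrite /qz expr0z.
have pV : (q ^ (2 * m * n))^-1 = q ^ (- (2 * m * n)) by rewrite invr_expz.
split; try by [case: H]; try exact: q1.
- by apply/qcommZ/q1.
- by apply/qcommZ/q1.
- by apply/qcommZ/q1.
- by apply/qcommZ/q1.
- rewrite /weyl_pair (mulZl (1 - _)) Ep_cp scalerDr (mulZr (1 - _)) !scalerA.
  by rewrite [LHS]addrC (mulrC (1 - _)).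
- rewrite /weyl_pair (mulZl (1 - _)) Fp_bp scalerDr (mulZr (1 - _)) !scalerA.
  by rewrite [LHS]addrC (mulrC (1 - _)).
- exact: bp_cp.
- by rewrite pV; apply/qcommZ/bp_Ep.
- by rewrite pV; apply/qcommZl/Fp_cp.
- by apply/qcommZ/qcommZl/Fp_Ep.
move=> B B1 BD BZ Bg; apply: gen => // g x.
have Ba u : B u -> B (a * u) by apply: Bg; rewrite !seq.inE eqxx ?orbT.
have Bai u : B u -> B (ai * u) by apply: Bg; rewrite !seq.inE eqxx ?orbT.
have BK u : B u -> B (K * u) by apply: Bg; rewrite !seq.inE eqxx ?orbT.
have BKi u : B u -> B (Ki * u) by apply: Bg; rewrite !seq.inE eqxx ?orbT.
have Bza z u : B u -> B (zpow a ai z * u) by apply: left_mul_zpow.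
have BzK z u : B u -> B (zpow K Ki z * u) by apply: left_mul_zpow.
have za z : zpow a ai (- z) * zpow a ai z = 1 by rewrite aiz addNr.
have zK z : zpow K Ki z * zpow K Ki (- z) = 1 by rewrite Kiz addrN.
have scaleB l y u : l != 0 -> B (l *: y * u) -> B (y * u).
  by move=> l0 /(BZ l^-1); rewrite mulZl scalerA mulVf // scale1r.
have Bb u : B u -> B (b * u).
  move=> Bu; have -> : b * u = zpow a ai (- n) * (bp * (zpow K Ki n * u)).
    rewrite /bp !mulrA za mul1r -!mulrA; congr (_ * _).
    by rewrite (mulrA (zpow K Ki (- n))) Kiz addNr mul1r.
  by apply/Bza/Bg; [rewrite !seq.inE eqxx ?orbT|apply: BzK].
have Bc u : B u -> B (c * u).
  move=> Bu; have -> : c * u = zpow a ai m * (cp * (zpow K Ki m * u)).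
    rewrite /cp !mulrA aiz addrN mul1r -!mulrA; congr (_ * _).
    by rewrite (mulrA (zpow K Ki (- m))) Kiz addNr mul1r.
  by apply/Bza/Bg; [rewrite !seq.inE eqxx ?orbT|apply: BzK].
have BE u : B u -> B (E * u).
  move=> Bu; have -> : E * u = zpow a ai (- (2 * m)) * (Ep * u).
    by rewrite /Ep !mulrA za mul1r.
  apply: Bza; apply: (scaleB (1 - q ^ (2 * m * m))); first by rewrite subr_eq0 eq_sym.
  by apply: Bg; rewrite ?seq.inE ?eqxx ?orbT.
have BF u : B u -> B (F * u).
  move=> Bu; have -> : F * u = zpow a ai (2 * n) * ((q ^ (n * n) *: Fp) * (zpow K Ki (- n) * u)).
    rewrite /Fp scalerA -expfzDr // addrN expr0z scale1r !mulrA aiz addrN mul1r.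
    by rewrite -(mulrA F) zK mulr1.
  apply: Bza; rewrite mulZl; apply: BZ.
  apply: (scaleB (1 - q ^ (- (2 * n * n)))); first by rewrite subr_eq0 eq_sym.
  by apply: Bg; [rewrite !seq.inE eqxx ?orbT|apply: BzK].
rewrite !seq.inE; do ![case/orP => [/eqP->|]; first by auto].
by move/eqP->; auto.
Qed.

End HeisenbergRelations.

(** * Strata and containments *)

Section Strata.
Context (k : fieldType) (A : algType k).

Definition stratum_ideal (phi1 phi2 C : A) (M N : nat) (z : k) : set A :=
  left_span2 phi1 (phi2 ^+ M - z *: C ^+ N).

(** The shape of the spectrum over [phi1] and away from [phi2]: the generic point
    [A phi1] and a family of points indexed by [z != 0], pairwise incomparable and
    comaximal with [phi2]. *)
Record stratum (phi1 phi2 C : A) (M N : nat) : Prop := Stratum {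
  stratum_bottom : prime_ideal (left_span1 phi1);
  stratum_top z : z != 0 -> prime_ideal (stratum_ideal phi1 phi2 C M N z);
  stratum_cases P : prime_ideal P -> P phi1 -> ~ P phi2 ->
    P = left_span1 phi1 \/ exists2 z, z != 0 & P = stratum_ideal phi1 phi2 C M N z;
  stratum_phi2 z P : z != 0 -> two_sided_ideal P ->
    stratum_ideal phi1 phi2 C M N z `<=` P -> P phi2 -> P 1;
  stratum_inj z z' : z' != 0 ->
    stratum_ideal phi1 phi2 C M N z `<=` stratum_ideal phi1 phi2 C M N z' -> z = z'
}.

Lemma left_span2C (v w : A) : left_span2 v w = left_span2 w v.
Proof.
by apply/seteqP; split; apply: left_span2_min; [apply: left_span2_left|
  apply: left_span2_memr|apply: left_span2_meml|apply: left_span2_left|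
  apply: left_span2_memr|apply: left_span2_meml].
Qed.

Lemma left_span1Z l (v : A) : l != 0 -> left_span1 (l *: v) = left_span1 v.
Proof.
move=> l0; have lL := left_span1_left (l *: v); have lL' := left_span1_left v.
apply/seteqP; split; apply: left_span1_min => //.
  by apply: lidealZ => //; apply: left_span1_mem.
by apply: (lidealZK lL l0); apply: left_span1_mem.
Qed.

Lemma left_span2Z l (v w : A) : l != 0 -> left_span2 (l *: v) w = left_span2 v w.
Proof.
move=> l0; have lL := left_span2_left (l *: v) w; have lL' := left_span2_left v w.
apply/seteqP; split; apply: left_span2_min => //; try exact: left_span2_memr.
  by apply: lidealZ => //; apply: left_span2_meml.
by apply: (lidealZK lL l0); apply: left_span2_meml.
Qed.

Lemma stratum_scale l l' (phi1 phi2 C : A) M N : l != 0 -> l' != 0 ->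
  stratum (l *: phi1) phi2 (l' *: C) M N -> stratum phi1 phi2 C M N.
Proof.
move=> l0 l'0 S; have lN0 : l' ^+ N != 0 by rewrite expf_neq0.
have JE z : stratum_ideal phi1 phi2 C M N z =
    stratum_ideal (l *: phi1) phi2 (l' *: C) M N (z / l' ^+ N).
  by rewrite /stratum_ideal left_span2Z // exprZn scalerA divfK.
have divz z : z != 0 -> z / l' ^+ N != 0.
  by move=> z0; rewrite mulf_neq0 // invr_eq0.
split=> [|z z0|P pP P1 nP2|z P z0|z z' z0].
- by have := stratum_bottom S; rewrite left_span1Z.
- by rewrite JE; apply: (stratum_top S); apply: divz.
- have := stratum_cases S pP (lidealZ _ _ P1) nP2; rewrite left_span1Z //.
  case=> [||[z z0 ->]]; [by apply: ideal_left; case: pP|by left|].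
  right; exists (z * l' ^+ N); first by rewrite mulf_neq0.
  by rewrite JE mulfK.
- by rewrite JE; apply: (stratum_phi2 S); apply: divz.
rewrite !JE => /(stratum_inj S (divz _ z0)) /(congr1 (fun t => t * l' ^+ N)).
by rewrite !divfK.
Qed.

Lemma stratum_of_heis q al be p (a ai K Ki c d b f : A) M N :
  (forall g : {poly k}, size g != 1%N -> exists z, root g z) ->
  heis_rel q al be p a ai K Ki c d b f ->
  nonroot q -> nonroot al -> nonroot be -> p != 0 -> (0 < M)%N -> (0 < N)%N ->
  be ^+ M = p^-1 ^+ N ->
  (forall r u : int, p ^ r = be ^ u ->
     exists j : int, r = - (N%:Z * j) /\ u = M%:Z * j) ->
  (forall z, z != 0 -> ~ stratum_ideal (1 - c * d) (1 - b * f) c M N z 1) ->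
  stratum (1 - c * d) (1 - b * f) c M N.
Proof.
move=> cl H qR alR beR p0 M0 N0 rel wts proper.
have JE z : stratum_ideal (1 - c * d) (1 - b * f) c M N z =
    left_span2 (1 - c * d) (ratio d b f M N - z%:A).
  by rewrite (J_generator H alR p0).
have proper' z : z != 0 -> ~ left_span2 (1 - c * d) (ratio d b f M N - z%:A) 1.
  by rewrite -JE; apply: proper.
split=> [|z z0|P pP P1 nP2|z P z0 iP JP P2|z z' z0].
- exact: (phi1_span_prime H qR alR beR p0 M0 N0 rel wts proper').
- by rewrite JE; apply: (J_prime H qR alR beR p0 M0 N0 rel wts).
- have [->|[z z0 ->]] := prime_stratum H qR alR beR p0 M0 N0 rel wts cl pP P1 nP2.
    by left.
  by right; exists z => //; rewrite JE.
- have sP : saturated P (1 - b * f).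
    apply: (ratio_saturated M0 z0 iP); apply: JP; rewrite JE.
    exact: left_span2_memr.
  by apply: sP; rewrite mul1r.
by rewrite !JE; apply: J_inj.
Qed.

Variables (phi1 phi2 B C : A) (M N : nat) (q : k).
Hypotheses (q0 : q != 0) (q1 : q != 1).
Hypotheses (S1 : stratum phi2 phi1 B N M) (S2 : stratum phi1 phi2 C M N).
Hypotheses (prime0 : prime_ideal [set 0 : A]).
Hypotheses (prime3 : prime_ideal (left_span2 phi1 phi2)).
Hypothesis cases0 : forall P, prime_ideal P -> ~ P phi1 -> ~ P phi2 -> P = [set 0].
Hypothesis cases3 : forall P, prime_ideal P -> P phi1 -> P phi2 ->
  P = left_span2 phi1 phi2.

Definition spec (i : hd_label k) : set A :=
  match i with
  | L0 => [set 0]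
  | LI1 => left_span1 phi1
  | LI2 => left_span1 phi2
  | LI3 => left_span2 phi1 phi2
  | LJ1 z => stratum_ideal phi2 phi1 B N M (val z)
  | LJ2 z => stratum_ideal phi1 phi2 C M N (val z)
  end.

Lemma spec_prime i : prime_ideal (spec i).
Proof.
case: i => [||||z|z] //=.
- exact: stratum_bottom S2.
- exact: stratum_bottom S1.
- by apply: (stratum_top S1); apply: (valP z).
- by apply: (stratum_top S2); apply: (valP z).
Qed.

Lemma specP P : prime_ideal P <-> exists i, P = spec i.
Proof.
split=> [pP|[i ->]]; last exact: spec_prime.
have [P1|P1] := pselect (P phi1); have [P2|P2] := pselect (P phi2).
- by exists (LI3 k); apply: cases3.
- have [->|[z z0 ->]] := stratum_cases S2 pP P1 P2; first by exists (LI1 k).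
  by exists (LJ2 (exist _ z z0)).
- have [->|[z z0 ->]] := stratum_cases S1 pP P2 P1; first by exists (LI2 k).
  by exists (LJ1 (exist _ z z0)).
- by exists (L0 k); apply: cases0.
Qed.

Lemma spec_left i : left_ideal (spec i).
Proof. by apply: ideal_left; case: (spec_prime i). Qed.

Lemma spec_proper i : ~ spec i 1.
Proof. by case: (spec_prime i) => iP /(ideal_proper iP). Qed.

Lemma spec_cover i j : hd_cover i j -> spec i `<=` spec j.
Proof.
have lz i' : left_ideal (spec i') := spec_left i'.
case=> [||||z|z].
- by move=> x ->; apply: (lideal0 (lz (LI1 k))).
- by move=> x ->; apply: (lideal0 (lz (LI2 k))).
- by apply: left_span1_min; [apply: lz (LI3 k)|apply: left_span2_meml].
- by apply: left_span1_min; [apply: lz (LI3 k)|apply: left_span2_memr].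
- by apply: left_span1_min; [apply: lz (LJ2 z)|apply: left_span2_meml].
- by apply: left_span1_min; [apply: lz (LJ1 z)|apply: left_span2_meml].
Qed.

Lemma spec_rt i j : clos_refl_trans _ (@hd_cover k) i j -> spec i `<=` spec j.
Proof.
elim=> [i' j' /spec_cover //|i' x //|i1 i2 i3 _ s12 _ s23].
exact: subset_trans s12 s23.
Qed.

(** Which of [phi1] and [phi2] a listed prime contains. Inclusions preserve this,
    which rules out most pairs of labels. *)
Definition has_phi1 (i : hd_label k) : bool :=
  match i with LI1 | LI3 | LJ2 _ => true | _ => false end.
Definition has_phi2 (i : hd_label k) : bool :=
  match i with LI2 | LI3 | LJ1 _ => true | _ => false end.

Let one1 : (1 : k) != 0. Proof. exact: oner_neq0. Qed.

Lemma J1_phi1 (z : {z : k | z != 0}) : ~ spec (LJ1 z) phi1.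
Proof.
move=> J1; apply: (spec_proper (i := LJ1 z)).
by apply: (stratum_phi2 S1 (valP z)) J1 => //; case: (spec_prime (LJ1 z)).
Qed.

Lemma J2_phi2 (z : {z : k | z != 0}) : ~ spec (LJ2 z) phi2.
Proof.
move=> J2; apply: (spec_proper (i := LJ2 z)).
by apply: (stratum_phi2 S2 (valP z)) J2 => //; case: (spec_prime (LJ2 z)).
Qed.

Let z1 : {z : k | z != 0} := exist _ 1 one1.

Lemma has_phi1P i : spec i phi1 <-> has_phi1 i.
Proof.
have I2 : spec (LI2 k) phi1 -> False.
  by move=> h; apply: (@J1_phi1 z1); apply: (spec_cover (cover_I2_J1 z1) h).
case: i => [||||z|z] //=; split=> //.
- by move=> h; case: I2; apply: (spec_cover (cover_0_I2 k) h).
- by move=> _; apply: left_span1_mem.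
- by move=> _; apply: left_span2_meml.
- by move=> h; case: (@J1_phi1 z).
- by move=> _; apply: left_span2_meml.
Qed.

Lemma has_phi2P i : spec i phi2 <-> has_phi2 i.
Proof.
have I1 : spec (LI1 k) phi2 -> False.
  by move=> h; apply: (@J2_phi2 z1); apply: (spec_cover (cover_I1_J2 z1) h).
case: i => [||||z|z] //=; split=> //.
- by move=> h; case: I1; apply: (spec_cover (cover_0_I1 k) h).
- by move=> _; apply: left_span1_mem.
- by move=> _; apply: left_span2_memr.
- by move=> _; apply: left_span2_meml.
- by move=> h; case: (@J2_phi2 z).
Qed.

Lemma other_point (z : {z : k | z != 0}) : exists z' : {z : k | z != 0}, val z' != val z.
Proof.
have qz : q * val z != 0 by rewrite mulf_neq0 // (valP z).
by exists (exist (fun t : k => t != 0) _ qz); rewrite /= -{2}[val z]mul1r (inj_eq (mulIf (valP z))).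
Qed.

(** The remaining inclusions are those inside a stratum and those into [I_3]. The
    latter contradict [stratum_phi2]. As [A phi1] lies in every [J_2(z')], an
    inclusion of [J_2(z)] in [A phi1] would give [z = z'] for all [z']. *)
Lemma spec_sub i j : spec i `<=` spec j <-> clos_refl_trans _ (@hd_cover k) i j.
Proof.
split; last exact: spec_rt.
move=> sij; have h1 : has_phi1 i -> has_phi1 j by move=> /has_phi1P/sij/has_phi1P.
have h2 : has_phi2 i -> has_phi2 j by move=> /has_phi2P/sij/has_phi2P.
have step i' j' : hd_cover i' j' -> clos_refl_trans _ (@hd_cover k) i' j' by apply: rt_step.
have refl i' : clos_refl_trans _ (@hd_cover k) i' i' by apply: rt_refl.
have trans i1 i2 i3 := @rt_trans _ (@hd_cover k) i1 i2 i3.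
have J1I3 (z : {z : k | z != 0}) : ~ spec (LJ1 z) `<=` spec (LI3 k).
  move=> h; apply: (spec_proper (i := LI3 k)).
  apply: (stratum_phi2 S1 (valP z)) h _; last exact: left_span2_meml.
  by case: (spec_prime (LI3 k)).
have J2I3 (z : {z : k | z != 0}) : ~ spec (LJ2 z) `<=` spec (LI3 k).
  move=> h; apply: (spec_proper (i := LI3 k)).
  apply: (stratum_phi2 S2 (valP z)) h _; last exact: left_span2_memr.
  by case: (spec_prime (LI3 k)).
have J1J1 (z z' : {z : k | z != 0}) : spec (LJ1 z) `<=` spec (LJ1 z') -> z = z'.
  by move=> /(stratum_inj S1 (valP z'))/val_inj.
have J2J2 (z z' : {z : k | z != 0}) : spec (LJ2 z) `<=` spec (LJ2 z') -> z = z'.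
  by move=> /(stratum_inj S2 (valP z'))/val_inj.
case: i j sij h1 h2 => [||||z|z] [||||z'|z'] //= sij h1 h2;
  try by [case: (h1 isT)|case: (h2 isT)|apply: refl|apply: step; constructor].
- by apply: (trans _ (LI1 k)); apply: step; constructor.
- by apply: (trans _ (LI2 k)); apply: step; constructor.
- by apply: (trans _ (LI1 k)); apply: step; constructor.
- have [z' /eqP[]] := other_point z; congr val; apply/esym/J1J1.
  exact: subset_trans sij (spec_cover (cover_I2_J1 z')).
- by case: (J1I3 z).
- by rewrite (J1J1 _ _ sij).
- have [z' /eqP[]] := other_point z; congr val; apply/esym/J2J2.
  exact: subset_trans sij (spec_cover (cover_I1_J2 z')).
- by case: (J2I3 z).
- by rewrite (J2J2 _ _ sij).
Qed.

End Strata.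

(** * Integer weights of the two pairs *)

Lemma nonroot_exp (k : fieldType) (q : k) e : nonroot q -> e != 0 -> nonroot (q ^ e).
Proof.
move=> [q0 q1] e0; split=> [|z]; first exact: expfz_neq0.
by rewrite exprz_exp => /q1/eqP; rewrite mulf_eq0 (negPf e0) => /eqP.
Qed.

(** As [q] is not a root of unity, [p ^ r = be ^ u] means [x r = - y u]; divided by
    the gcd, [x] and [y] become [M] and [N] up to a common sign. *)
Lemma weight_lattice (k : fieldType) (q p be : k) (x y : int) (M N : nat) :
  nonroot q -> 0 < x * y -> p = q ^ (2 * x * y) -> be = q ^ (- (2 * y * y)) ->
  M = (`|x| %/ gcdn `|x| `|y|)%N -> N = (`|y| %/ gcdn `|x| `|y|)%N ->
  [/\ (0 < M)%N, (0 < N)%N, be ^+ M = p^-1 ^+ N &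
    forall r u : int, p ^ r = be ^ u ->
      exists j : int, r = - (N%:Z * j) /\ u = M%:Z * j].
Proof.
move=> qR xy -> -> ME NE; set g := gcdn _ _ in ME NE.
have x0 : (0 < `|x|)%N by nia.
have y0 : (0 < `|y|)%N by nia.
have g0 : (0 < g)%N by rewrite gcdn_gt0 x0.
have xE : `|x|%N = (M * g)%N by rewrite ME divnK // dvdn_gcdl.
have yE : `|y|%N = (N * g)%N by rewrite NE divnK // dvdn_gcdr.
have M0 : (0 < M)%N by nia.
have N0 : (0 < N)%N by nia.
have cMN : coprime N M.
  rewrite coprime_sym /coprime -(eqn_pmul2r g0) mul1n muln_gcdl.
  by rewrite -xE -yE.
have [s [s1 xs ys]] : exists s : int, [/\ s * s = 1, x = s * (M * g)%N%:Z & y = s * (N * g)%N%:Z].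
  by case: (ltP 0 x) => x_s; [exists 1|exists (-1)]; split => //; nia.
split=> //.
  rewrite !exprnP invr_expz !exprz_exp; congr (q ^ _); rewrite xs ys !PoszM.
  by ring.
move=> r u; rewrite !exprz_exp => /(nonroot_inj qR) e.
have {}e : M%:Z * r = - (N%:Z * u).
  have yn0 : y != 0 by nia.
  have gn0 : s * g%:Z != 0 by nia.
  have e2 : 2 * y != 0 by rewrite mulf_neq0.
  have e1 : x * r = - (y * u).
    apply: (mulfI e2); transitivity (2 * x * y * r); first by ring.
    by rewrite e; ring.
  apply: (mulfI gn0); transitivity (x * r); first by rewrite xs PoszM; ring.
  by rewrite e1 ys PoszM; ring.
have /dvdzP[j uE] : (M%:Z %| u)%Z.
  rewrite -(@Gauss_dvdzr _ N%:Z) ?coprimezE /= 1?coprime_sym //.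
  have -> : N%:Z * u = M%:Z * - r by lia.
  exact: dvdz_mulr.
exists j; rewrite uE; split; last exact: mulrC.
have Mn0 : M%:Z != 0 by lia.
by apply: (mulfI Mn0); rewrite e uE; ring.
Qed.

Section Assembly.
Context (k : fieldType) (A : algType k).

Lemma stratum_ideal_scale l l' (phi1 phi2 C : A) M N z : l != 0 ->
  stratum_ideal (l *: phi1) phi2 (l' *: C) M N z =
  stratum_ideal phi1 phi2 C M N (z * l' ^+ N).
Proof. by move=> l0; rewrite /stratum_ideal left_span2Z // exprZn scalerA. Qed.

(** If the pair is flipped, [phi1] is only multiplied by [al], and the coprime
    exponents refer to powers of [E] instead of [c]. *)
Lemma stratum_flip q al be p (a ai K Ki c d b f E : A) M N :
  (forall g : {poly k}, size g != 1%N -> exists z, root g z) ->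
  heis_rel q al be p a ai K Ki c d b f -> d = (1 - al) *: E ->
  nonroot q -> nonroot al -> nonroot be -> p != 0 -> (0 < M)%N -> (0 < N)%N ->
  be ^+ M = p ^+ N ->
  (forall r u : int, p^-1 ^ r = be ^ u ->
     exists j : int, r = - (N%:Z * j) /\ u = M%:Z * j) ->
  (forall z, z != 0 -> ~ stratum_ideal (1 - c * d) (1 - b * f) E M N z 1) ->
  stratum (1 - c * d) (1 - b * f) E M N.
Proof.
move=> cl H dE qR alR beR p0 M0 N0 rel wts proper.
have [al0 al1] := alR.
have al1' : 1 - al != 0.
  by rewrite subr_eq0; apply/eqP => e; have := al1 1; rewrite -e => /(_ erefl).
have phiE : 1 - d * c = al *: (1 - c * d).
  by rewrite (weyl_dc (weyl_c H)) opprB addrC subrK.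
apply: (stratum_scale al0 al1'); rewrite -dE -phiE.
apply: (stratum_of_heis cl (heis_flip al0 H)) => //.
- exact: nonrootV.
- by rewrite invr_eq0.
- by rewrite invrK.
move=> z z0; rewrite phiE dE stratum_ideal_scale // -dE; apply: proper.
by rewrite mulf_neq0 // expf_neq0.
Qed.

Variables (q : k) (m n : int) (a ai b c K Ki E F : A).
Hypotheses (qR : nonroot q) (m0 : m != 0) (n0 : n != 0).
Hypothesis H : hd_rels q m n a ai b c K Ki E F.
Hypothesis gen : generates [:: a; ai; b; c; K; Ki; E; F].
Hypothesis closed : forall g : {poly k}, size g != 1%N -> exists z, root g z.

Local Notation b' := (bp n a ai b K Ki).
Local Notation c' := (cp m a ai c K Ki).
Local Notation E' := (Ep m a ai E).
Local Notation F' := (Fp q n a ai K Ki F).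
Let phi1 := E' * c' - c' * E'.
Let phi2 := F' * b' - b' * F'.
Let C := if 0 < m * n then c' else E'.
Let B := if 0 < m * n then b' else F'.
Let M := (`|m| %/ gcdn `|m| `|n|)%N.
Let N := (`|n| %/ gcdn `|m| `|n|)%N.

Hypothesis proper1 : forall z, z != 0 -> ~ stratum_ideal phi2 phi1 B N M z 1.
Hypothesis proper2 : forall z, z != 0 -> ~ stratum_ideal phi1 phi2 C M N z 1.
Hypothesis proper3 : ~ left_span2 phi1 phi2 1.
Hypothesis phi_n0 : forall r, (phi1 * phi2) ^+ r <> 0.

Let al := q ^ (2 * m * m).
Let be := q ^ (- (2 * n * n)).
Let p := q ^ (2 * m * n).
Let alR : nonroot al. Proof. by apply: nonroot_exp => //; rewrite !mulf_neq0. Qed.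
Let beR : nonroot be.
Proof. by apply: nonroot_exp => //; rewrite oppr_eq0 !mulf_neq0. Qed.
Let pR : nonroot p. Proof. by apply: nonroot_exp => //; rewrite !mulf_neq0. Qed.

Lemma nonroot_neq1 (l : k) : nonroot l -> l != 1.
Proof. by case=> _ l1; apply/eqP => e; have := l1 1 e. Qed.

Let q0 : q != 0. Proof. by case: qR. Qed.
Let p0 : p != 0. Proof. by case: pR. Qed.

Let d := (1 - al) *: E'.
Let f := (1 - be) *: F'.

Let heis : heis_rel q al be p a ai K Ki c' d b' f.
Proof. exact: (heis_of_hd q0 H (nonroot_neq1 alR) (nonroot_neq1 beR) gen). Qed.

Let phi1E : 1 - c' * d = phi1. Proof. by rewrite -(Ep_cp_phi q0 H). Qed.
Let phi2E : 1 - b' * f = phi2. Proof. by rewrite -(Fp_bp_phi q0 H). Qed.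

Let mn_neg : ~~ (0 < m * n) -> 0 < m * - n.
Proof.
move=> mn; have mn0 : m * n != 0 by rewrite mulf_neq0.
by rewrite mulrN oppr_gt0 lt_neqAle mn0 leNgt.
Qed.

Lemma stratum_C : stratum phi1 phi2 C M N.
Proof.
move: proper2; rewrite /C -phi1E -phi2E; case: ifPn => [mn|/mn_neg mn] pr.
  have [M0 N0 rel wts] := weight_lattice qR mn (erefl p) (erefl be) (erefl M) (erefl N).
  exact: (stratum_of_heis closed heis).
have pVE : p^-1 = q ^ (2 * m * - n) by rewrite invr_expz; congr (q ^ _); ring.
have beE : be = q ^ (- (2 * - n * - n)) by congr (q ^ _); ring.
have [||M0 N0 rel wts] := weight_lattice (M := M) (N := N) qR mn pVE beE.
- by rewrite abszN.
- by rewrite abszN.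
rewrite invrK in rel.
exact: (stratum_flip closed heis).
Qed.

(** The swapped presentation has [p^-1] for [p]; writing it over [q^-1] gives the
    exponents the form that [weight_lattice] asks for. *)
Lemma stratum_B : stratum phi2 phi1 B N M.
Proof.
move: proper1; rewrite /B -phi1E -phi2E; have heis' := heis_swap p0 heis.
have qVR := nonrootV qR.
have pV0 : p^-1 != 0 by rewrite invr_eq0.
have alE : al = q^-1 ^ (- (2 * m * m)) by rewrite exprz_inv opprK.
case: ifPn => [mn|/mn_neg mn] pr.
  have pVE : p^-1 = q^-1 ^ (2 * n * m).
    by rewrite invr_expz exprz_inv; congr (q ^ _); ring.
  have nm : 0 < n * m by rewrite mulrC.
  have [||N0 M0 rel wts] := weight_lattice (M := N) (N := M) qVR nm pVE alE.
  - by rewrite gcdnC.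
  - by rewrite gcdnC.
  exact: (stratum_of_heis closed heis').
have pE : p^-1^-1 = q^-1 ^ (2 * n * - m).
  by rewrite invrK exprz_inv; congr (q ^ _); ring.
have alE' : al = q^-1 ^ (- (2 * - m * - m)) by rewrite alE; congr (_ ^ _); ring.
have nm : 0 < n * - m by lia.
have [||N0 M0 rel wts] := weight_lattice (M := N) (N := M) qVR nm pE alE'.
- by rewrite abszN gcdnC.
- by rewrite abszN gcdnC.
rewrite invrK in rel.
exact: (stratum_flip closed heis').
Qed.

Lemma zero_ideal_prime : prime_ideal [set 0 : A].
Proof.
by apply: (zero_prime heis qR alR beR p0) => r; rewrite phi1E phi2E; apply: phi_n0.
Qed.

Lemma bottom_prime : prime_ideal (left_span2 phi1 phi2).
Proof.
by rewrite -phi1E -phi2E; apply: (phi12_span_prime heis); rewrite ?phi1E ?phi2E.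
Qed.

Lemma prime_zero P : prime_ideal P -> ~ P phi1 -> ~ P phi2 -> P = [set 0].
Proof.
move=> pP P1 P2; have [iP PT _] := pP; have lP := ideal_left iP.
apply/seteqP; split=> [|_ ->]; last exact: lideal0.
have right w : (forall x, exists y, x * w = w * y) -> ~ P w -> saturated P w.
  move=> wr; apply: prime_saturated => // x; have [y ->] := wr x.
  by exists y; rewrite subrr; apply: lideal0.
apply: (generic_simple heis) => //; rewrite ?phi1E ?phi2E.
- apply: right => // x; rewrite -phi1E; exact: (phi1_right heis alR p0).
- apply: right => // x; rewrite -phi2E; exact: (phi2_right heis beR p0).
by apply/ideal_proper.
Qed.

Lemma prime_bottom P : prime_ideal P -> P phi1 -> P phi2 -> P = left_span2 phi1 phi2.
Proof.
move=> pP P1 P2; have [iP PT _] := pP; have lP := ideal_left iP.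
apply/seteqP; split; last exact: left_span2_min.
rewrite -phi1E -phi2E; apply: (phi12_span_max heis); rewrite ?phi1E ?phi2E //.
by apply/ideal_proper.
Qed.

Lemma hd_specP P : prime_ideal P <-> exists i, P = spec phi1 phi2 B C M N i.
Proof.
exact: (specP stratum_B stratum_C zero_ideal_prime bottom_prime prime_zero prime_bottom).
Qed.

Lemma hd_spec_sub i j : spec phi1 phi2 B C M N i `<=` spec phi1 phi2 B C M N j <->
  clos_refl_trans _ (@hd_cover k) i j.
Proof.
apply: (spec_sub q0 (nonroot_neq1 qR) stratum_B stratum_C zero_ideal_prime bottom_prime).
Qed.

End Assembly.

(** * Representations by weighted shifts *)

Section ShiftRepresentation.
Context (k : fieldType) (G : choiceType) (T : Type).
Variables (wt : G -> T -> k) (sh : G -> T -> T).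
Local Notation free_alg := {malg k[{fmonom G}]}.

Fixpoint word_act (w : seq G) (f : T -> k) (t : T) : k :=
  if w is g :: w' then wt g t * word_act w' f (sh g t) else f t.

Definition act (x : free_alg) (f : T -> k) (t : T) : k :=
  mmap idfun (fun w : {fmonom G} => word_act w f t) x.

Lemma word_act_cat w w' f t : word_act (w ++ w') f t = word_act w (word_act w' f) t.
Proof. by elim: w t => //= g w IHw t; rewrite IHw. Qed.

Lemma actD x y f t : act (x + y) f t = act x f t + act y f t.
Proof. exact: raddfD. Qed.

Lemma actB x y f t : act (x - y) f t = act x f t - act y f t.
Proof. exact: raddfB. Qed.

Lemma act0 f t : act 0 f t = 0.
Proof. exact: raddf0. Qed.

Lemma word_act_sum (I : Type) (s : seq I) (a : I -> k) (h : I -> T -> k) w t :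
  word_act w (fun t => \sum_(i <- s) a i * h i t) t =
  \sum_(i <- s) a i * word_act w (h i) t.
Proof.
elim: w t => //= g w IHw t; rewrite IHw mulr_sumr.
by apply: eq_bigr => i _; rewrite mulrCA.
Qed.

Lemma actM x y f t : act (x * y) f t = act x (act y f) t.
Proof.
rewrite {1}/act malgM_def fgmulEl1 raddf_sum [RHS]mmapE; apply: eq_bigr => w _.
rewrite fgmulUg [LHS]raddf_sum /=.
have e := word_act_sum (finmap.enum_fset (msupp y)) (fun w' => y@_w')
  (fun w' : {fmonom G} => word_act w' f) w t.
transitivity (x@_w * word_act w (act y f) t) => //.
rewrite [word_act w (act y f) t]e mulr_sumr; apply: eq_bigr => w' _.
by rewrite mmapU fmM word_act_cat -mulrA.
Qed.

Lemma act1 f t : act 1 f t = f t.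
Proof. by rewrite [LHS]mmapU /= fm1 mul1r. Qed.

Lemma actZ l x f t : act (l *: x) f t = l * act x f t.
Proof.
rewrite -mul_malgC actM [LHS]mmapU /= fm1.
by [].
Qed.

Lemma act_gen g f t : act (free_gen k g) f t = wt g t * f (sh g t).
Proof. by rewrite [LHS]mmapU fmU mul1r. Qed.

Lemma act_ext x f f' t : f =1 f' -> act x f t = act x f' t.
Proof. by move=> /funext ->. Qed.

Context (R : set free_alg).
Hypothesis actR : forall x, R x -> forall f t, act x f t = 0.

Lemma act_rel x f t : rel_ideal R x -> act x f t = 0.
Proof.
pose I : set free_alg := [set x | forall f t, act x f t = 0].
suff RI : rel_ideal R `<=` I by move=> /RI; apply.
apply: smallest_sub; last by move=> y /actR.
split; first split; rewrite ?classical_sets.inE.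
- exact: act0.
- move=> y z; rewrite !classical_sets.inE => Iy Iz f' t'.
  by rewrite actB Iy Iz subr0.
move=> y z Iz; split=> f' t'; rewrite actM; last exact: Iz.
rewrite (@act_ext _ _ (fun=> 0)) => [|s]; last exact: Iz.
rewrite /act mmapE big1 // => w _; rewrite (_ : word_act w _ _ = 0) ?mulr0 //.
by elim: (w : seq G) t' => //= g v IHv t'; rewrite IHv mulr0.
Qed.

Definition pact (u : pres_alg R) : (T -> k) -> T -> k := act (pres_repr u).

Lemma pact_pi x f t : pact (pres_pi R x) f t = act x f t.
Proof.
apply/eqP; rewrite -subr_eq0 -actB; apply/eqP/act_rel.
exact: pres_reprB.
Qed.

Lemma pactB u v f t : pact (u - v) f t = pact u f t - pact v f t.
Proof.
by rewrite -[u]pres_reprK -[v]pres_reprK -pres_piN -pres_piD !pact_pi actB.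
Qed.

Lemma pactD u v f t : pact (u + v) f t = pact u f t + pact v f t.
Proof. by rewrite -[u]pres_reprK -[v]pres_reprK -pres_piD !pact_pi actD. Qed.

Lemma pactM u v f t : pact (u * v) f t = pact u (pact v f) t.
Proof.
rewrite -{1}[u]pres_reprK -{1}[v]pres_reprK -pres_piM pact_pi actM.
by [].
Qed.

Lemma pactZ l u f t : pact (l *: u) f t = l * pact u f t.
Proof. by rewrite -{1}[u]pres_reprK -pres_piZ pact_pi actZ. Qed.

Lemma pact1 f t : pact 1 f t = f t.
Proof. by rewrite -pres_pi1 pact_pi act1. Qed.

Lemma pact0 f t : pact 0 f t = 0.
Proof. by rewrite -(pres_pi0 R) pact_pi act0. Qed.

End ShiftRepresentation.

Section HdRepresentation.
Context (k : fieldType) (q : k) (m n : int).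
Hypothesis q0 : q != 0.
Local Notation al := (q ^ (2 * m * m)).
Local Notation be := (q ^ (- (2 * n * n))).
Hypotheses (al1 : 1 - al != 0) (be1 : 1 - be != 0).
Variables (sc sb x y : int) (l1 l2 : int -> k).
Hypothesis xy1 : x * sb + y * sc = 1.
Hypothesis l1S : forall r, l1 (r + sc) = al * l1 r.
Hypothesis l2S : forall s, l2 (s + sb) = be * l2 s.

(** On functions of [(i, r, s)], [a] shifts [i] and [K] multiplies by [q ^ (- i)]; the
    pair of [c] and [E] shifts [r] by [sc], that of [b] and [F] shifts [s] by [sb].
    The terms in [x s] and [y r] produce the powers of [q] between the two pairs,
    thanks to [x * sb + y * sc = 1]. The functions [l1] and [l2] will be the
    eigenvalues of [phi1] and [phi2]; they may vanish, and a pair with shift [0]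
    acts diagonally. *)
Definition hd_expo (g : hd_gen) (t : int * int * int) : int :=
  let: (i, r, s) := t in
  match g with
  | Ga | Gai => 0
  | GK => - i
  | GKi => i
  | Gb => - (n * (i + n)) + 2 * m * n * y * r
  | Gc => - (m * (i - m)) - 2 * m * n * x * s
  | GE => 2 * m * n * x * s
  | GF => n * n + n * (i - 2 * n) - 2 * m * n * y * r
  end.

Definition hd_coef (g : hd_gen) (t : int * int * int) : k :=
  let: (i, r, s) := t in
  match g with
  | GE => (1 - al * l1 r) / (1 - al)
  | GF => (1 - be * l2 s) / (1 - be)
  | _ => 1
  end.

Definition hd_shift (g : hd_gen) (t : int * int * int) : int * int * int :=
  let: (i, r, s) := t in
  match g with
  | Ga => (i - 1, r, s)
  | Gai => (i + 1, r, s)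
  | GK | GKi => (i, r, s)
  | Gb => (i + n, r, s - sb)
  | Gc => (i - m, r - sc, s)
  | GE => (i + 2 * m, r + sc, s)
  | GF => (i - 2 * n, r, s + sb)
  end.

Definition hd_weight g t : k := q ^ hd_expo g t * hd_coef g t.

Local Notation hact := (act hd_weight hd_shift).
Local Notation X := (@free_gen k hd_gen).

Lemma hact_gen g f t : hact (X g) f t = q ^ hd_expo g t * hd_coef g t * f (hd_shift g t).
Proof. exact: act_gen. Qed.

Lemma hact_gen2 g h f t : hact (X g * X h) f t =
  q ^ hd_expo g t * hd_coef g t * (q ^ hd_expo h (hd_shift g t) *
    hd_coef h (hd_shift g t) * f (hd_shift h (hd_shift g t))).
Proof. by rewrite actM !act_gen. Qed.

Lemma sub2_eq0 (u v u' v' : k) : u = u' -> v = v' -> u' - v' = 0 -> u - v = 0.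
Proof. by move=> -> ->. Qed.

Lemma sub3_eq0 (u v w u' v' w' : k) :
  u = u' -> v = v' -> w = w' -> u' - (v' + w') = 0 -> u - (v + w) = 0.
Proof. by move=> -> -> ->. Qed.

Lemma hact_swap g h e f t :
  hd_shift h (hd_shift g t) = hd_shift g (hd_shift h t) ->
  hd_expo g t + hd_expo h (hd_shift g t) = e + hd_expo h t + hd_expo g (hd_shift h t) ->
  hd_coef g t * hd_coef h (hd_shift g t) = hd_coef h t * hd_coef g (hd_shift h t) ->
  hact (X g * X h - q ^ e *: (X h * X g)) f t = 0.
Proof.
move=> sE eE cE; rewrite actB actZ.
apply: (sub2_eq0 (hact_gen2 g h f t) (congr1 _ (hact_gen2 h g f t))); rewrite sE.
apply/eqP; rewrite subr_eq0 !mulrA; apply/eqP; congr (_ * _).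
transitivity (q ^ (hd_expo g t + hd_expo h (hd_shift g t)) *
    (hd_coef g t * hd_coef h (hd_shift g t))).
  by rewrite expfzDr //; ring.
by rewrite eE cE !expfzDr //; ring.
Qed.

Lemma hact_zpowa z f i r s : hact (zpow (X Ga) (X Gai) z) f (i, r, s) = f (i - z, r, s).
Proof.
have pow g : (forall f i r s, hact (X g) f (i, r, s) = f (hd_shift g (i, r, s))) ->
    forall j f i r s, hact (X g ^+ j) f (i, r, s) = f (iter j (hd_shift g) (i, r, s)).
  move=> gE j; elim: j => [|j IHj] f' i' r' s'; first by rewrite act1.
  by rewrite exprSr actM IHj /=; case: (iter _ _ _) => [[i1 r1] s1]; rewrite gE.
have ita j i' : iter j (hd_shift Ga) (i', r, s) = (i' - j%:Z, r, s).
  by elim: j => [|j /= ->] /=; [rewrite subr0|congr (_, _, _); lia].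
have itai j i' : iter j (hd_shift Gai) (i', r, s) = (i' + j%:Z, r, s).
  by elim: j => [|j /= ->] /=; [rewrite addr0|congr (_, _, _); lia].
have ga f' i' r' s' : hact (X Ga) f' (i', r', s') = f' (hd_shift Ga (i', r', s')).
  by rewrite act_gen /hd_weight /= expr0z !mul1r.
have gai f' i' r' s' : hact (X Gai) f' (i', r', s') = f' (hd_shift Gai (i', r', s')).
  by rewrite act_gen /hd_weight /= expr0z !mul1r.
case: z => j /=; first by rewrite (pow _ ga) ita.
rewrite (pow _ gai) itai; congr f; congr (_, _, _); lia.
Qed.

Lemma hact_zpowK z f i r s :
  hact (zpow (X GK) (X GKi) z) f (i, r, s) = q ^ (- (z * i)) * f (i, r, s).
Proof.
have pow g : (forall f t, hact (X g) f t = q ^ hd_expo g t * f t) ->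
    forall j f t, hact (X g ^+ j) f t = q ^ (j%:Z * hd_expo g t) * f t.
  move=> gE j; elim: j => [|j IHj] f' t; first by rewrite act1 mul0r expr0z mul1r.
  rewrite exprS actM gE IHj mulrA -expfzDr //; congr (q ^ _ * _).
  by rewrite -addn1 PoszD mulrDl mul1r addrC.
have gK f' t : hact (X GK) f' t = q ^ hd_expo GK t * f' t.
  by case: t => [[i' r'] s']; rewrite act_gen /hd_weight /= mulr1.
have gKi f' t : hact (X GKi) f' t = q ^ hd_expo GKi t * f' t.
  by case: t => [[i' r'] s']; rewrite act_gen /hd_weight /= mulr1.
case: z => j /=; [rewrite (pow _ gK)|rewrite (pow _ gKi)]; congr (q ^ _ * _).
  by rewrite /=; ring.
by rewrite /= NegzE; ring.
Qed.

Lemma hact_comm g h f t :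
  hd_shift h (hd_shift g t) = hd_shift g (hd_shift h t) ->
  hd_expo g t + hd_expo h (hd_shift g t) = hd_expo h t + hd_expo g (hd_shift h t) ->
  hd_coef g t * hd_coef h (hd_shift g t) = hd_coef h t * hd_coef g (hd_shift h t) ->
  hact (X g * X h - X h * X g) f t = 0.
Proof.
move=> sE eE cE; rewrite -[X h * X g]scale1r -(expr0z q).
by apply: hact_swap => //; rewrite add0r.
Qed.

Lemma hact_zpow2 z z' f i r s :
  hact (zpow (X Ga) (X Gai) z * zpow (X GK) (X GKi) z') f (i, r, s) =
  q ^ (- (z' * (i - z))) * f (i - z, r, s).
Proof. by rewrite actM hact_zpowa hact_zpowK. Qed.

Lemma hact_Ec f t : hact (X GE * X Gc -
  (X Gc * X GE + zpow (X Ga) (X Gai) (- m) * zpow (X GK) (X GKi) m)) f t = 0.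
Proof.
case: t => [[i r] s]; rewrite actB actD.
apply: (sub3_eq0 (hact_gen2 GE Gc f _) (hact_gen2 Gc GE f _) (hact_zpow2 _ _ f i r s)) => /=.
have -> : i + 2 * m - m = i + m by ring.
have -> : i - m + 2 * m = i + m by ring.
have -> : i - - m = i + m by ring.
rewrite addrK subrK; have -> : al * l1 (r - sc) = l1 r by rewrite -l1S subrK.
set F := f _; set e1 := 2 * m * n * x * s.
have -> : q ^ (- (m * (i + m)) - e1) = q ^ (- (m * (i + m))) * q ^ (- e1).
  by rewrite -expfzDr //; congr (q ^ _); ring.
have -> : q ^ (- (m * (i - m)) - e1) = q ^ (- (m * (i + m))) * al * q ^ (- e1).
  by rewrite -!expfzDr //; congr (q ^ _); ring.
have e10 : q ^ e1 * q ^ (- e1) = 1 by rewrite -expfzDr // subrr expr0z.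
move: (q ^ e1) (q ^ (- e1)) e10 (q ^ (- (m * (i + m)))) al al1 (l1 r) => u v uv w a a1 l.
transitivity (((1 - a * l) - a * (1 - l)) / (1 - a) * (u * v) * w * F - w * F).
  by field.
by rewrite uv (_ : 1 - a * l - a * (1 - l) = 1 - a) ?divff ?mul1r ?subrr //; ring.
Qed.

Lemma hact_Fb f t : hact (X GF * X Gb -
  (q ^ (- (n * n)) *: (X Gb * X GF) + zpow (X Ga) (X Gai) n)) f t = 0.
Proof.
case: t => [[i r] s]; rewrite actB actD actZ.
apply: (sub3_eq0 (hact_gen2 GF Gb f _) (congr1 _ (hact_gen2 Gb GF f _))
  (hact_zpowa _ f i r s)) => /=.
have -> : i - 2 * n + n = i - n by ring.
have -> : i + n - 2 * n = i - n by ring.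
rewrite addrK subrK; have -> : be * l2 (s - sb) = l2 s by rewrite -l2S subrK.
set F := f _; set e1 := 2 * m * n * y * r.
have -> : q ^ (n * n + n * (i - n) - e1) = q ^ (n * n) * q ^ (n * (i - n)) * q ^ (- e1).
  by rewrite -!expfzDr //; congr (q ^ _); ring.
have -> : q ^ (n * n + n * (i - 2 * n) - e1) = q ^ (n * (i - n)) * q ^ (- e1).
  by rewrite -!expfzDr //; congr (q ^ _); ring.
have -> : q ^ (- (n * (i - n)) + e1) = q ^ (- (n * (i - n))) * q ^ e1.
  by rewrite -!expfzDr //; congr (q ^ _); ring.
have -> : q ^ (- (n * (i + n)) + e1) = q ^ (- (n * (i - n))) * be * q ^ e1.
  by rewrite -!expfzDr //; congr (q ^ _); ring.
have inv e : q ^ e * q ^ (- e) = 1 by rewrite -expfzDr // subrr expr0z.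
move: (inv e1) (inv (n * (i - n))) (inv (n * n)).
move: (q ^ e1) (q ^ (- e1)) (q ^ (n * (i - n))) (q ^ - (n * (i - n))).
move: (q ^ (n * n)) (q ^ - (n * n)) be be1 (l2 s).
move=> w w' c c1 l u u' v v' uu vv ww.
transitivity ((1 - c * l - w * w' * c * (1 - l)) / (1 - c) * (u * u') * (v * v') * F - F).
  by field.
rewrite uu vv ww (_ : 1 - c * l - 1 * c * (1 - l) = 1 - c); last by ring.
by rewrite divff // !mul1r subrr.
Qed.

(** Exponents are compared modulo the relation [x * sb + y * sc = 1]. *)
Lemma shift_rel (e u v : int) : u - v = e * (x * sb + y * sc - 1) -> u = v.
Proof. by rewrite xy1 subrr mulr0 => /eqP; rewrite subr_eq0 => /eqP. Qed.

Lemma hact_relations p f t : p \in hd_relations q m n -> hact (p.1 - p.2) f t = 0.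
Proof.
case: t => [[i r] s].
rewrite /hd_relations !seq.inE.
do ![case/orP; first move=> /eqP->]; last move=> /eqP->; rewrite /=.
- apply: hact_swap => /=; [congr (_, _, _); ring|ring|ring].
- apply: hact_swap => /=; [congr (_, _, _); ring|ring|ring].
- apply: hact_comm => /=; [congr (_, _, _); ring| |ring].
  by apply: (shift_rel (e := 2 * m * n)); ring.
- rewrite actB act1 actM !act_gen /hd_weight /= !expr0z !mul1r.
  by rewrite subrK subrr.
- rewrite actB act1 actM !act_gen /hd_weight /= !expr0z !mul1r.
  by rewrite addrK subrr.
- apply: hact_swap => /=; [congr (_, _, _); ring|ring|ring].
- apply: hact_swap => /=; [congr (_, _, _); ring|ring|ring].
- apply: hact_comm => /=; [congr (_, _, _); ring| |ring].
  by apply: (shift_rel (e := - (2 * m * n))); ring.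
- rewrite actB act1 actM !act_gen /hd_weight /= !mulr1 mulrA -expfzDr //.
  by rewrite addNr expr0z mul1r subrr.
- rewrite actB act1 actM !act_gen /hd_weight /= !mulr1 mulrA -expfzDr //.
  by rewrite addrN expr0z mul1r subrr.
- rewrite -exprN1; apply: hact_swap => /=; [congr (_, _, _); ring|ring|ring].
- apply: hact_swap => /=; [congr (_, _, _); ring|ring|ring].
- apply: hact_swap => /=; [congr (_, _, _); ring|ring|ring].
- apply: hact_comm => /=; [congr (_, _, _); ring|ring|ring].
- apply: hact_comm => /=; [congr (_, _, _); ring| |ring].
  by apply: (shift_rel (e := 2 * m * n)); ring.
- exact: hact_Ec.
- apply: hact_swap => /=; [congr (_, _, _); ring|ring|ring].
- exact: hact_Fb.
- apply: hact_swap => /=; [congr (_, _, _); ring| |ring].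
  by apply: (shift_rel (e := - (2 * m * n))); ring.
Qed.

Local Notation hdR := [set p.1 - p.2 | p in [set p | p \in hd_relations q m n]].

Lemma hact_rel z : hdR z -> forall f t, hact z f t = 0.
Proof. by case=> p pR <- f t; apply: hact_relations. Qed.

Definition hdact (u : hd q m n) : (int * int * int -> k) -> int * int * int -> k :=
  pact hd_weight hd_shift u.

Lemma hdact_pi z f t : hdact (pres_pi hdR z) f t = hact z f t.
Proof. exact: pact_pi hact_rel _ _ _. Qed.

Lemma hdactM (u v : hd q m n) f t : hdact (u * v) f t = hdact u (hdact v f) t.
Proof. exact: pactM hact_rel u v f t. Qed.

Lemma hdactB (u v : hd q m n) f t : hdact (u - v) f t = hdact u f t - hdact v f t.
Proof. exact: pactB hact_rel u v f t. Qed.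

Lemma hdactD (u v : hd q m n) f t : hdact (u + v) f t = hdact u f t + hdact v f t.
Proof. exact: pactD hact_rel u v f t. Qed.

Lemma hdactZ l (u : hd q m n) f t : hdact (l *: u) f t = l * hdact u f t.
Proof. exact: pactZ hact_rel l u f t. Qed.

Lemma hdact1 f t : hdact 1 f t = f t.
Proof. exact: pact1 hact_rel f t. Qed.

Lemma hdact0 f t : hdact 0 f t = 0.
Proof. exact: pact0 hact_rel f t. Qed.

Lemma hdact_elt g f t :
  hdact (hd_elt q m n g) f t = q ^ hd_expo g t * hd_coef g t * f (hd_shift g t).
Proof. by rewrite hdact_pi hact_gen. Qed.

Lemma pi_zpow u v z :
  zpow (pres_pi hdR u : hd q m n) (pres_pi hdR v) z = pres_pi hdR (zpow u v z).
Proof.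
have piX w j : (pres_pi hdR w : hd q m n) ^+ j = pres_pi hdR (w ^+ j).
  by elim: j => [//|j IHj]; rewrite !exprS IHj pres_piM.
by case: z => j; apply: piX.
Qed.

Lemma hdact_zpowa z f i r s :
  hdact (zpow (hd_elt q m n Ga) (hd_elt q m n Gai) z) f (i, r, s) = f (i - z, r, s).
Proof. by rewrite pi_zpow hdact_pi hact_zpowa. Qed.

Lemma hdact_zpowK z f i r s :
  hdact (zpow (hd_elt q m n GK) (hd_elt q m n GKi) z) f (i, r, s) =
  q ^ (- (z * i)) * f (i, r, s).
Proof. by rewrite pi_zpow hdact_pi hact_zpowK. Qed.

Lemma hdact_b' f i r s :
  hdact (b' q m n) f (i, r, s) = q ^ (2 * m * n * y * r) * f (i, r, s - sb).
Proof.
rewrite /b' (hdactM (zpow _ _ _ * _)) (hdactM (zpow _ _ _))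
  hdact_zpowa hdact_elt /= hdact_zpowK subrK mulr1 mulrA -expfzDr //.
by congr (q ^ _ * _); ring.
Qed.

Lemma hdact_c' f i r s :
  hdact (c' q m n) f (i, r, s) = q ^ (- (2 * m * n * x * s)) * f (i, r - sc, s).
Proof.
rewrite /c' (hdactM (zpow _ _ _ * _)) (hdactM (zpow _ _ _))
  hdact_zpowa hdact_elt /= hdact_zpowK.
have -> : i - - m - m = i by ring.
rewrite mulr1 mulrA -expfzDr //.
by congr (q ^ _ * _); ring.
Qed.

Lemma hdact_E' f i r s :
  hdact (E' q m n) f (i, r, s) =
  q ^ (2 * m * n * x * s) * ((1 - al * l1 r) / (1 - al)) * f (i, r + sc, s).
Proof. by rewrite /E' (hdactM (zpow _ _ _))
  hdact_zpowa hdact_elt /= subrK. Qed.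

Lemma hdact_F' f i r s :
  hdact (F' q m n) f (i, r, s) =
  q ^ (- (2 * m * n * y * r)) * ((1 - be * l2 s) / (1 - be)) * f (i, r, s + sb).
Proof.
rewrite /F' hdactZ (hdactM (zpow _ _ _ * _)) (hdactM (zpow _ _ _))
  hdact_zpowa hdact_elt /= hdact_zpowK.
have -> : i - - (2 * n) - 2 * n = i by ring.
have <- : q ^ (- (n * n)) * q ^ (n * n + n * i - 2 * m * n * y * r) * q ^ (- (n * i)) =
    q ^ (- (2 * m * n * y * r)).
  by rewrite -!expfzDr //; congr (q ^ _); ring.
by ring.
Qed.

Lemma hdact_phi1 f i r s : hdact (phi1 q m n) f (i, r, s) = l1 r * f (i, r, s).
Proof.
rewrite /phi1 hdactB; set e := 2 * m * n * x * s.
have inv : q ^ e * q ^ (- e) = 1 by rewrite -expfzDr // subrr expr0z.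
have e1 : hdact (E' q m n * c' q m n) f (i, r, s) =
    (1 - al * l1 r) / (1 - al) * f (i, r, s).
  rewrite hdactM hdact_E' hdact_c' addrK -/e.
  by rewrite -[RHS]mulr1 -inv; ring.
have e2 : hdact (c' q m n * E' q m n) f (i, r, s) =
    (1 - l1 r) / (1 - al) * f (i, r, s).
  rewrite hdactM hdact_c' hdact_E' subrK -/e.
  have -> : al * l1 (r - sc) = l1 r by rewrite -l1S subrK.
  by rewrite -[RHS]mulr1 -inv; ring.
apply/eqP; rewrite -subr_eq0 -addrA -opprD; apply/eqP.
apply: (sub3_eq0 e1 e2 (erefl _)).
by move: al al1 => a a1; field.
Qed.

Lemma hdact_phi2 f i r s : hdact (phi2 q m n) f (i, r, s) = l2 s * f (i, r, s).
Proof.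
rewrite /phi2 hdactB; set e := 2 * m * n * y * r.
have inv : q ^ e * q ^ (- e) = 1 by rewrite -expfzDr // subrr expr0z.
have e1 : hdact (F' q m n * b' q m n) f (i, r, s) =
    (1 - be * l2 s) / (1 - be) * f (i, r, s).
  rewrite hdactM hdact_F' hdact_b' addrK -/e.
  by rewrite -[RHS]mulr1 -inv; ring.
have e2 : hdact (b' q m n * F' q m n) f (i, r, s) =
    (1 - l2 s) / (1 - be) * f (i, r, s).
  rewrite hdactM hdact_b' hdact_F' subrK -/e.
  have -> : be * l2 (s - sb) = l2 s by rewrite -l2S subrK.
  by rewrite -[RHS]mulr1 -inv; ring.
apply/eqP; rewrite -subr_eq0 -addrA -opprD; apply/eqP.
apply: (sub3_eq0 e1 e2 (erefl _)).
by move: be be1 => a a1; field.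
Qed.

Lemma hdactX (u : hd q m n) (lam : int -> int -> k) j :
  (forall f i r s, hdact u f (i, r, s) = lam r s * f (i, r, s)) ->
  forall f i r s, hdact (u ^+ j) f (i, r, s) = lam r s ^+ j * f (i, r, s).
Proof.
move=> uE; elim: j => [|j IHj] f i r s; first by rewrite hdact1 mul1r.
by rewrite !exprS hdactM uE IHj mulrA.
Qed.

(** Left multiples of elements acting by zero act by zero, whereas [1] acts as the
    identity. *)
Lemma hdact_proper (v w : hd q m n) : (forall f t, hdact v f t = 0) ->
  (forall f t, hdact w f t = 0) -> ~ left_span2 v w 1.
Proof.
move=> v0 w0 [d [e de1]]; have := hdact1 (fun=> 1) (0, 0, 0).
have kill (u z : hd q m n) f t : (forall f t, hdact u f t = 0) -> hdact (z * u) f t = 0.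
  move=> u0; have -> : hdact (z * u) f t = hdact (z * 0) f t.
    apply: etrans (hdactM z u f t) (etrans _ (esym (hdactM z 0 f t))).
    by congr hdact; apply: funext => t'; rewrite u0 hdact0.
  by rewrite mulr0 hdact0.
have de0 : hdact (d * v + e * w) (fun=> 1) (0, 0, 0) = 0.
  apply: etrans (hdactD (d * v) (e * w) _ _) _.
  exact: etrans (congr2 +%R (kill v d _ _ v0) (kill w e _ _ w0)) (addr0 0).
rewrite -de1 in de0; rewrite de0 => /esym/eqP.
by rewrite oner_eq0.
Qed.

End HdRepresentation.

(** * The presented algebra *)

Lemma heis_commute (k : fieldType) (A : algType k) (q al be p : k)
    (a ai K Ki c d b f : A) : heis_rel q al be p a ai K Ki c d b f ->
  forall g t, g \in [:: c; d; b; f] -> t \in [:: a; ai; K; Ki] -> g * t = t * g.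
Proof.
move=> H g t gP tP.
have [ga gai gK gKi] : [/\ qcomm 1 g a, qcomm 1 g ai, qcomm 1 g K & qcomm 1 g Ki].
  apply: (torus_commV H); move: gP; rewrite !seq.inE; case/or4P => /eqP->.
  - exact: torus_comm_c H.
  - exact: torus_comm_d H.
  - exact: torus_comm_b H.
  - exact: torus_comm_f H.
have q1 u : qcomm 1 g u -> g * u = u * g by rewrite /qcomm scale1r.
by move: tP; rewrite !seq.inE; case/or4P => /eqP->; apply: q1.
Qed.

Section Cover.
Context (k : fieldType) (A : algType k).
Variables (q al be p : k) (a ai K Ki c d b f : A).
Hypothesis H : heis_rel q al be p a ai K Ki c d b f.
Variables (S0 S : set A).
Hypotheses (S0_1 : S0 1) (S_1 : S 1).
Hypothesis S0_mul : forall g x, g \in [:: a; ai; K; Ki] -> S0 x -> S0 (g * x).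
Hypothesis S_mul : forall g x, g \in [:: c; d; b; f] -> S x -> S (g * x).
Hypothesis S_comm : forall g x, g \in [:: c; d; b; f] -> S0 x -> g * x = x * g.

(** Letters of [S] commute with the torus, so a product [x y] remains of this form
    after left multiplication by any generator. The span of the products is
    encoded as the intersection [B0] of all subspaces that contain them. *)
Lemma span_products (B : set A) : B 0 -> (forall x y, B x -> B y -> B (x + y)) ->
  (forall (l : k) x, B x -> B (l *: x)) ->
  (forall x y, S0 x -> S y -> B (x * y)) -> forall x, B x.
Proof.
pose sub (W : set A) := [/\ W 0, forall x y, W x -> W y -> W (x + y),
  forall (l : k) x, W x -> W (l *: x) & forall x y, S0 x -> S y -> W (x * y)].
pose B0 : set A := [set u | forall W, sub W -> W u].
have B0P u : B0 u.
  apply: (heis_gen H (B := B0)) => {u}.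
  - by move=> W [_ _ _ /(_ 1 1)]; rewrite mul1r; apply.
  - by move=> x y Bx By W sW; case: (sW) => _ WD _ _; apply: WD; [apply: Bx|apply: By].
  - by move=> l x Bx W sW; case: (sW) => _ _ WZ _; apply: WZ; apply: Bx.
  move=> g x gens_g Bx W [W0 WD WZ WM].
  apply: (Bx [set v | W (g * v)]); split=> /=.
  - by rewrite mulr0.
  - by move=> y z Wy Wz; rewrite mulrDr; apply: WD.
  - by move=> l y Wy; rewrite mulZr; apply: WZ.
  move=> y z S0y Sz; rewrite mulrA.
  have [g0|g1] : g \in [:: a; ai; K; Ki] \/ g \in [:: c; d; b; f].
    by apply/orP; rewrite -mem_cat.
    by apply: WM => //; apply: S0_mul.
  by rewrite (S_comm g1 S0y) -mulrA; apply: WM => //; apply: S_mul.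
by move=> B_0 BD BZ BM x; apply: B0P.
Qed.
End Cover.

Section NonzeroDouble.
Context (k : fieldType) (q : k) (m n : int).

(** The double as an algebra over [k], a structure which includes [1 != 0]. *)
Definition hd_alg (hd_neq0 : (1 : hd q m n) != 0) : Type := hd q m n.

Variable hd_neq0 : (1 : hd q m n) != 0.
HB.instance Definition _ := GRing.PzRing.on (hd_alg hd_neq0).
HB.instance Definition _ := GRing.Lmodule.on (hd_alg hd_neq0).
HB.instance Definition _ :=
  GRing.PzSemiRing_isNonZero.Build (hd_alg hd_neq0) hd_neq0.
HB.instance Definition _ :=
  GRing.Lmodule_isLalgebra.Build k (hd_alg hd_neq0) (@pres_scalerAl _ _ _).
HB.instance Definition _ :=
  GRing.Lalgebra_isAlgebra.Build k (hd_alg hd_neq0) (@pres_scalerAr _ _ _).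
End NonzeroDouble.

Section DoubleAlgebra.
Context (k : closedFieldType) (q : k) (m n : int).
Hypotheses (qR : nonroot q) (m0 : m != 0) (n0 : n != 0).
Local Notation D := (hd q m n).
Local Notation hdR := [set p.1 - p.2 | p in [set p | p \in hd_relations q m n]].
Local Notation al := (q ^ (2 * m * m)).
Local Notation be := (q ^ (- (2 * n * n))).

Let q0 : q != 0. Proof. by case: qR. Qed.
Let al1 : 1 - al != 0.
Proof.
rewrite subr_eq0 eq_sym; apply/nonroot_neq1/nonroot_exp => //.
by rewrite !mulf_neq0.
Qed.
Let be1 : 1 - be != 0.
Proof.
rewrite subr_eq0 eq_sym; apply/nonroot_neq1/nonroot_exp => //.
by rewrite oppr_eq0 !mulf_neq0.
Qed.

(** The double acts on functions, with [1] as the identity. *)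
Lemma hd_one_neq0 : (1 : D) != 0.
Proof.
have xy1 : 1 * 1 + 0 * 0 = 1 :> int by [].
have lS (l : k) (j r : int) : (fun _ : int => 0 : k) (r + j) = l * (fun _ : int => 0 : k) r.
  by rewrite mulr0.
apply/eqP => e.
have := hdact1 q0 al1 be1 xy1 (lS al 0) (lS be 1) (fun=> 1) (0, 0, 0).
rewrite e (hdact0 q0 al1 be1 xy1 (lS al 0) (lS be 1)) => /esym/eqP.
by rewrite oner_eq0.
Qed.

Local Notation A := (hd_alg hd_one_neq0).
Local Notation X g := (hd_elt q m n g : A).

Lemma pi_rel i : (i < 19)%N ->
  pres_pi hdR (nth (0, 0) (hd_relations q m n) i).1 =
  pres_pi hdR (nth (0, 0) (hd_relations q m n) i).2.
Proof.
move=> i19; apply/eqP; rewrite -subr_eq0; apply/eqP.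
rewrite -pres_piN -pres_piD; apply: pres_pi_rel.
by exists (nth (0, 0) (hd_relations q m n) i) => //; apply: mem_nth.
Qed.

Lemma hd_alg_rels :
  hd_rels q m n (X Ga) (X Gai) (X Gb) (X Gc) (X GK) (X GKi) (X GE) (X GF).
Proof.
pose Y := @free_gen k hd_gen.
have swapZ g h l : pres_pi hdR (Y g * Y h) = pres_pi hdR (l *: (Y h * Y g)) ->
    X g * X h = l *: (X h * X g).
  move=> e; apply: etrans (esym (pres_piM hdR _ _)) (etrans e _).
  exact: etrans (pres_piZ hdR _ _) (congr1 _ (pres_piM hdR _ _)).
have swap1 g h : pres_pi hdR (Y g * Y h) = pres_pi hdR (Y h * Y g) ->
    X g * X h = X h * X g.
  move=> e; apply: etrans (esym (pres_piM hdR _ _)) (etrans e _).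
  exact: pres_piM.
have inv g h : pres_pi hdR (Y g * Y h) = pres_pi hdR 1 -> X g * X h = 1.
  by move=> e; apply: etrans (esym (pres_piM hdR _ _)) e.
have zpow_pi g h z : pres_pi hdR (zpow (Y g) (Y h) z) = zpow (X g) (X h) z :> A.
  have e : zpow (pres_pi hdR (Y g) : D) (pres_pi hdR (Y h)) z =
      pres_pi hdR (zpow (Y g) (Y h) z) by apply: pi_zpow.
  exact: esym e.
have Ec : X GE * X Gc = X Gc * X GE + zpow (X Ga) (X Gai) (- m) * zpow (X GK) (X GKi) m.
  have e : pres_pi hdR (Y GE * Y Gc) = pres_pi hdR
    (Y Gc * Y GE + zpow (Y Ga) (Y Gai) (- m) * zpow (Y GK) (Y GKi) m).
    exact: (@pi_rel 15 isT).
  apply: etrans (esym (pres_piM hdR _ _)) (etrans e (etrans (pres_piD hdR _ _) _)).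
  apply: (congr2 (fun u v : A => u + v) (pres_piM hdR _ _)).
  apply: etrans (pres_piM hdR _ _) _.
  exact: (congr2 (fun u v : A => u * v) (zpow_pi _ _ _) (zpow_pi _ _ _)).
have Fb : X GF * X Gb = q ^ (- (n * n)) *: (X Gb * X GF) + zpow (X Ga) (X Gai) n.
  have e : pres_pi hdR (Y GF * Y Gb) = pres_pi hdR
    (q ^ (- (n * n)) *: (Y Gb * Y GF) + zpow (Y Ga) (Y Gai) n).
    exact: (@pi_rel 17 isT).
  apply: etrans (esym (pres_piM hdR _ _)) (etrans e (etrans (pres_piD hdR _ _) _)).
  apply: (congr2 (fun u v : A => u + v) _ (zpow_pi _ _ _)).
  exact: etrans (pres_piZ hdR _ _) (congr1 _ (pres_piM hdR _ _)).
split.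
- exact: swapZ (@pi_rel 0 isT).
- exact: swapZ (@pi_rel 1 isT).
- exact: swap1 (@pi_rel 2 isT).
- exact: inv (@pi_rel 3 isT).
- exact: inv (@pi_rel 4 isT).
- exact: swapZ (@pi_rel 5 isT).
- exact: swapZ (@pi_rel 6 isT).
- exact: swap1 (@pi_rel 7 isT).
- exact: inv (@pi_rel 8 isT).
- exact: inv (@pi_rel 9 isT).
- exact: swapZ (@pi_rel 10 isT).
- exact: swapZ (@pi_rel 11 isT).
- exact: swapZ (@pi_rel 12 isT).
- exact: swap1 (@pi_rel 13 isT).
- exact: swap1 (@pi_rel 14 isT).
- exact: Ec.
- exact: swapZ (@pi_rel 16 isT).
- exact: Fb.
- exact: swapZ (@pi_rel 18 isT).
Qed.

Lemma hd_alg_gen : generates [:: X Ga; X Gai; X Gb; X Gc; X GK; X GKi; X GE; X GF].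
Proof.
move=> B B1 BD BZ Bg u.
have B_word (w : seq hd_gen) : B (pres_pi hdR << FMonom w >>).
  elim: w => [|g w IHw]; first by rewrite -fmoneE.
  have -> : << FMonom (g :: w) >> = free_gen k g * << FMonom w >>.
    rewrite malgM_def fgmulUU mulr1; congr << _ >>.
    by apply/eqP; rewrite fmP fmM fmU.
  rewrite pres_piM; apply: Bg IHw.
  apply: (map_f (fun g => X g) (s := [:: Ga; Gai; Gb; Gc; GK; GKi; GE; GF])).
  by rewrite !seq.inE; case: g; rewrite eqxx ?orbT.
have B_pi y : B (pres_pi hdR y).
  rewrite (monalgE y); apply: (big_ind (fun y => B (pres_pi hdR y))).
  - by rewrite pres_pi0 -(scale0r (1 : A)); apply: BZ.
  - by move=> y1 y2 B1' B2'; rewrite pres_piD; apply: BD.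
  move=> w _; have -> : << y@_w *g w >> = y@_w *: << w >>.
    by apply/malgP=> w'; rewrite mcoeffZ !mcoeffU mulrnAr mulr1.
  by rewrite pres_piZ; apply: BZ; case: w => w; apply: B_word.
by rewrite -[u]pres_reprK; apply: B_pi.
Qed.

End DoubleAlgebra.

(** * Left ideals as spans over the torus *)

Section Subalgebras.
Context (k : fieldType) (G : choiceType) (R : set {malg k[{fmonom G}]}).
Local Notation P := (pres_alg R).

Lemma subalg_gen_mem (Y : set P) x : Y x -> subalg_gen Y x.
Proof. exact: sub_gen_smallest. Qed.

Lemma subalg_gen1 (Y : set P) : subalg_gen Y 1.
Proof. by move=> B [[B1 _ _] _]. Qed.

Lemma subalg_genM (Y : set P) x y :
  subalg_gen Y x -> subalg_gen Y y -> subalg_gen Y (x * y).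
Proof.
move=> Yx Yy B BY; have [[_ _ BM] _] := BY.
have := BM x y; rewrite !classical_sets.inE; apply; [exact: Yx|exact: Yy].
Qed.

Lemma subalg_genZ (Y : set P) (l : k) x : subalg_gen Y x -> subalg_gen Y (l *: x).
Proof.
move=> Yx B BY; have [[B1 [B0 BL] BM] _] := BY.
have := BL l x 0; rewrite !classical_sets.inE addr0; apply; first exact: Yx.
by move: B0; rewrite classical_sets.inE.
Qed.

Lemma subalg_gen_ind (Y : set P) (B : set P) : B 1 -> B 0 ->
  (forall x y, B x -> B y -> B (x + y)) -> (forall l x, B x -> B (l *: x)) ->
  (forall x y, B x -> B y -> B (x * y)) -> Y `<=` B -> subalg_gen Y `<=` B.
Proof.
move=> B1 B0 BD BZ BM YB; apply: smallest_sub => //; split=> //; first split.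
- by rewrite classical_sets.inE.
- by move=> l x y; rewrite !classical_sets.inE => Bx By; apply/BD/By/BZ.
by move=> x y; rewrite !classical_sets.inE; apply: BM.
Qed.
End Subalgebras.

Section Spans.
Context (k : fieldType) (V : lmodType k).

Lemma lin_span_mem (Y : set V) x : Y x -> lin_span Y x.
Proof. exact: sub_gen_smallest. Qed.

Lemma lin_span0 (Y : set V) : lin_span Y 0.
Proof. by move=> B [[B0 _] _]; move: B0; rewrite classical_sets.inE. Qed.

Lemma lin_spanL (Y : set V) (l : k) x y :
  lin_span Y x -> lin_span Y y -> lin_span Y (l *: x + y).
Proof.
move=> Yx Yy B BY; have [[_ BL] _] := BY.
by have := BL l x y; rewrite !classical_sets.inE; apply; [apply: Yx|apply: Yy].
Qed.

Lemma lin_spanD (Y : set V) x y : lin_span Y x -> lin_span Y y -> lin_span Y (x + y).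
Proof. by rewrite -{2}[x]scale1r; apply: lin_spanL. Qed.

Lemma lin_spanZ (Y : set V) (l : k) x : lin_span Y x -> lin_span Y (l *: x).
Proof. by move=> Yx; rewrite -[l *: x]addr0; apply: lin_spanL => //; apply: lin_span0. Qed.
End Spans.

Section ListedIdeals.
Context (k : closedFieldType) (q : k) (m n : int).
Hypotheses (qR : nonroot q) (m0 : m != 0) (n0 : n != 0).
Local Notation D := (hd q m n).
Local Notation A := (hd_alg (hd_one_neq0 qR m0 n0)).
Local Notation X g := (hd_elt q m n g : A).
Local Notation al := (q ^ (2 * m * m)).
Local Notation be := (q ^ (- (2 * n * n))).
Local Notation p := (q ^ (2 * m * n)).
Local Notation d := ((1 - al) *: (E' q m n : A)).
Local Notation f := ((1 - be) *: (F' q m n : A)).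

Let q0 : q != 0. Proof. by case: qR. Qed.
Let alN1 : al != 1.
Proof. by apply/nonroot_neq1/nonroot_exp => //; rewrite !mulf_neq0. Qed.
Let beN1 : be != 1.
Proof. by apply/nonroot_neq1/nonroot_exp => //; rewrite oppr_eq0 !mulf_neq0. Qed.

Lemma hd_heis : heis_rel q al be p (X Ga) (X Gai) (X GK) (X GKi)
  (c' q m n : A) d (b' q m n : A) f.
Proof.
exact: (heis_of_hd q0 (hd_alg_rels qR m0 n0) alN1 beN1 (@hd_alg_gen _ _ _ _ qR m0 n0)).
Qed.

Lemma hd_cover_products (B : set A) : B 0 -> (forall x y, B x -> B y -> B (x + y)) ->
  (forall (l : k) x, B x -> B (l *: x)) ->
  (forall x y, hd0 q m n x -> hdS q m n y -> B (x * y)) -> forall x, B x.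
Proof.
have H := hd_heis.
apply: (span_products H (S0 := hd0 q m n) (S := hdS q m n)).
- exact: subalg_gen1.
- exact: subalg_gen1.
- move=> g x gP Sx; apply: (subalg_genM _ Sx); apply: subalg_gen_mem.
  move: gP; rewrite !seq.inE; case/or4P => /eqP->.
  + left; right; reflexivity.
  + right; reflexivity.
  + left; left; left; reflexivity.
  + left; left; right; reflexivity.
- move=> g x gP Sx; apply: (subalg_genM _ Sx).
  move: gP; rewrite !seq.inE; case/or4P => /eqP->.
  + apply: subalg_gen_mem; left; left; right; reflexivity.
  + apply: (@subalg_genZ _ _ _ _ (1 - al)); apply: subalg_gen_mem.
    left; right; reflexivity.
  + apply: subalg_gen_mem; left; left; left; reflexivity.
  + apply: (@subalg_genZ _ _ _ _ (1 - be)); apply: subalg_gen_mem.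
    right; reflexivity.
move=> g x gP; move: x; apply: (subalg_gen_ind (B := [set x : A | g * x = x * g])) => /=.
- exact: (@commr1 A g).
- exact: (@commr0 A g).
- by move=> x y gx gy; apply: (@commrD A g x y gx gy).
- by move=> l x gx; rewrite mulZr gx mulZl.
- by move=> x y gx gy; apply: (@commrM A g x y gx gy).
have gcomm := heis_commute H gP.
move=> t [[[->|->]|->]|->] /=; apply: gcomm.
- exact: (mem_nth 0 (s := [:: X Ga; X Gai; X GK; X GKi]) (n := 2) isT).
- exact: (mem_nth 0 (s := [:: X Ga; X Gai; X GK; X GKi]) (n := 3) isT).
- exact: (mem_nth 0 (s := [:: X Ga; X Gai; X GK; X GKi]) (n := 0) isT).
- exact: (mem_nth 0 (s := [:: X Ga; X Gai; X GK; X GKi]) (n := 1) isT).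
Qed.

Lemma hd0_mul_min (I L : set A) : left_ideal L -> I `<=` L -> hd0_mul I `<=` L.
Proof.
move=> lL IL; apply: smallest_sub; last by move=> _ [x _ [y /IL Ly <-]]; apply: lidealM.
split; rewrite ?classical_sets.inE; first exact: lideal0.
move=> l x y; rewrite !classical_sets.inE => Lx Ly.
exact: (@lidealD A _ _ _ lL (@lidealZ k A _ l x lL Lx) Ly).
Qed.

(** As the double is the span of [D^0 S], it suffices to let [u] be a product. *)
Lemma hd0_mul_left (I : set D) (w u : D) : (forall s, hdS q m n s -> I (s * w)) ->
  hd0_mul I (u * w).
Proof.
move=> Iw; apply: (hd_cover_products (B := [set u : D | hd0_mul I (u * w)])) => /=.
- by rewrite mul0r; apply: lin_span0.
- move=> x y Bx By; rewrite (_ : _ * w = (x : D) * w + (y : D) * w); last exact: mulrDl.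
  exact: (@lin_spanD k D _ _ _ Bx By).
- move=> l x Bx; rewrite (_ : _ * w = l *: ((x : D) * w)); last by rewrite pres_scalerAl.
  exact: (@lin_spanZ k D _ _ _ Bx).
move=> x y x0 yS; apply: lin_span_mem; exists x => //; exists (y * w); first exact: Iw.
exact: mulrA.
Qed.

Lemma hd0_mul_span1 (w : A) : hd0_mul (S_mul w) = left_span1 w.
Proof.
have lL := left_span1_left w; apply/seteqP; split.
  by apply: hd0_mul_min => // _ [s _ <-]; exists s.
by move=> _ [u ->]; apply: hd0_mul_left => s Ss; exists s.
Qed.

Lemma hd0_mul_span2 (v w : A) :
  hd0_mul (set_add (S_mul v) (S_mul w)) = left_span2 v w.
Proof.
have lL := left_span2_left v w; have S0 : hdS q m n 0.
  rewrite -(scale0r (1 : D)); apply: subalg_genZ; exact: subalg_gen1.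
apply/seteqP; split.
  apply: hd0_mul_min => // _ [_ [s _ <-] [_ [t _ <-] <-]].
  by exists s, t.
move=> _ [u [t ->]]; apply: lin_spanD; apply: hd0_mul_left => s Ss.
  exists (s * v); first by exists s.
  by exists 0; [exists 0; rewrite ?mul0r|rewrite addr0].
exists 0; first by exists 0; rewrite ?mul0r.
by exists (s * w); [exists s|rewrite add0r].
Qed.

(** * Properness *)

Lemma exists_root_of (w : k) (M : nat) : (0 < M)%N -> exists mu : k, mu ^+ M = w.
Proof.
move=> M0; have /closed_rootP[mu] : size ('X^M - w%:P) != 1%N.
  by rewrite size_XnsubC // eqSS -lt0n.
by rewrite /root !hornerE subr_eq0 => /eqP; exists mu.
Qed.

Let M := m_d m n.
Let N := n_d m n.
Let al1 : 1 - al != 0. Proof. by rewrite subr_eq0 eq_sym. Qed.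
Let be1 : 1 - be != 0. Proof. by rewrite subr_eq0 eq_sym. Qed.
Let zeroS (l : k) (j r : int) : (fun _ : int => 0 : k) (r + j) = l * (fun _ : int => 0 : k) r.
Proof. by rewrite mulr0. Qed.
Let powS (mu l : k) : l != 0 ->
  forall r : int, (fun r : int => mu * l ^ r) (r + 1) = l * (fun r : int => mu * l ^ r) r.
Proof. by move=> l0 r /=; rewrite expfzDr // expr1z; ring. Qed.

Let M0 : (0 < M)%N.
Proof. by rewrite /M /m_d divn_gt0 ?gcdn_gt0 ?absz_gt0 ?m0 // dvdn_leq ?absz_gt0 ?dvdn_gcdl. Qed.
Let N0 : (0 < N)%N.
Proof.
by rewrite /N /n_d divn_gt0 ?gcdn_gt0 ?absz_gt0 ?m0 // dvdn_leq ?absz_gt0 ?dvdn_gcdr.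
Qed.

Let MN : m * N%:Z = (if 0 < m * n then n else - n) * M%:Z.
Proof.
set g := gcdn `|m| `|n|; have g0 : (0 < g)%N by rewrite gcdn_gt0 !absz_gt0 m0.
have mE : `|m|%N = (M * g)%N by rewrite divnK // dvdn_gcdl.
have nE : `|n|%N = (N * g)%N by rewrite divnK // dvdn_gcdr.
have gn0 : g%:Z != 0 by rewrite eqz_nat -lt0n.
apply: (mulIf gn0); rewrite -!mulrA -!PoszM -mE -nE.
by case: ifPn => mn; case: (ltgtP m 0) mn m0 => // ms; case: (ltgtP n 0) n0 => // ns _; nia.
Qed.

(** With eigenvalues [0] both [phi1] and [phi2] act by zero. *)
Lemma I3_proper : ~ left_span2 (phi1 q m n) (phi2 q m n) 1.
Proof.
have xy1 : 1 * 1 + 0 * 0 = 1 :> int by [].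
apply: (hdact_proper q0 al1 be1 xy1 (zeroS al 0) (zeroS be 1)) => g [[i r] s].
  by rewrite (hdact_phi1 q0 al1 be1 xy1 (zeroS al 0) (zeroS be 1)) mul0r.
by rewrite (hdact_phi2 q0 al1 be1 xy1 (zeroS al 0) (zeroS be 1)) mul0r.
Qed.

(** With geometric eigenvalues [phi1 * phi2] acts diagonally without zeros. *)
Lemma phi_pow_neq0 j : (phi1 q m n * phi2 q m n) ^+ j <> 0.
Proof.
have al0 : al != 0 by apply: expfz_neq0.
have be0 : be != 0 by apply: expfz_neq0.
have xy1 : 1 * 1 + 0 * 1 = 1 :> int by [].
have l1 := powS 1 al0; have l2 := powS 1 be0.
have uE g (i r s : int) : hdact 1 1 1 0 (fun r : int => 1 * al ^ r) (fun r : int => 1 * be ^ r)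
    (phi1 q m n * phi2 q m n) g (i, r, s) = (1 * al ^ r) * (1 * be ^ s) * g (i, r, s).
  rewrite (hdactM q0 al1 be1 xy1 l1 l2) (hdact_phi1 q0 al1 be1 xy1 l1 l2).
  by rewrite (hdact_phi2 q0 al1 be1 xy1 l1 l2) mulrA.
have := hdactX q0 al1 be1 xy1 l1 l2 (lam := fun r s => (1 * al ^ r) * (1 * be ^ s))
  j uE (fun=> 1) 0 0 0.
move=> + e; rewrite e (hdact0 q0 al1 be1 xy1 l1 l2).
by rewrite !expr0z !mulr1 expr1n => /esym/eqP; rewrite oner_eq0.
Qed.

(** Let [phi1] act by zero, [phi2] by [mu be ^ s], and the first pair without shift.
    Then [c'], or [E'] if [m * n < 0], acts diagonally by [t q ^ (e s)]. The
    proportion between [M] and [N] makes [be ^ (s M)] equal to [q ^ (e s N)], and [mu]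
    is chosen to match the constants. *)
Lemma J2_proper (z : k) : z != 0 -> ~ @stratum_ideal k A (phi1 q m n) (phi2 q m n)
  (if 0 < m * n then c' q m n else E' q m n) M N z 1.
Proof.
move=> z0; have be0 : be != 0 by apply: expfz_neq0.
have xy1 : 1 * 1 + 0 * 0 = 1 :> int by [].
pose t : k := if 0 < m * n then 1 else (1 - al)^-1.
have [mu muE] := exists_root_of (z * t ^+ N) M0.
have l1 := zeroS al 0; have l2 := powS mu be0.
pose e : int := if 0 < m * n then - (2 * m * n) else 2 * m * n.
have CE g (i r s : int) : hdact 0 1 1 0 (fun=> 0) (fun r : int => mu * be ^ r)
    (if 0 < m * n then c' q m n else E' q m n) g (i, r, s) = q ^ (e * s) * t * g (i, r, s).
  rewrite /e /t; case: ifP => _.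
    rewrite (hdact_c' q0 al1 be1 xy1 l1 l2) subr0 [in RHS]mulr1.
    by congr (q ^ _ * _); ring.
  rewrite (hdact_E' q0 al1 be1 xy1 l1 l2) addr0 mulr0 subr0 [in LHS]mul1r.
  by congr (q ^ _ * _ * _); ring.
apply: (hdact_proper q0 al1 be1 xy1 l1 l2) => g [[i r] s].
  by rewrite (hdact_phi1 q0 al1 be1 xy1 l1 l2) mul0r.
have phi2E g' i' r' s' := hdact_phi2 q0 al1 be1 xy1 l1 l2 g' i' r' s'.
rewrite (hdactB q0 al1 be1 xy1 l1 l2) (hdactZ q0 al1 be1 xy1 l1 l2).
rewrite (hdactX q0 al1 be1 xy1 l1 l2 (lam := fun _ s => mu * be ^ s) M phi2E).
rewrite (hdactX q0 al1 be1 xy1 l1 l2 (lam := fun _ s => q ^ (e * s) * t) N CE).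
rewrite mulrA -mulrBl !exprMn muE !exprnP !exprz_exp.
have -> : - (2 * n * n) * s * M%:Z = e * s * N%:Z.
  transitivity (- (2 * n * s) * (n * M%:Z)); first by ring.
  rewrite (_ : n * M%:Z = (if 0 < m * n then m else - m) * N%:Z); last first.
    by move: MN; case: ifP => _ E; rewrite ?mulNr E ?mulNr ?opprK.
  by rewrite /e; case: ifP => _; ring.
by ring.
Qed.

(** As for [J2_proper], with the two pairs exchanged. *)
Lemma J1_proper (z : k) : z != 0 -> ~ @stratum_ideal k A (phi2 q m n) (phi1 q m n)
  (if 0 < m * n then b' q m n else F' q m n) N M z 1.
Proof.
move=> z0; have al0 : al != 0 by apply: expfz_neq0.
have xy1 : 0 * 0 + 1 * 1 = 1 :> int by [].
pose t : k := if 0 < m * n then 1 else (1 - be)^-1.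
have [mu muE] := exists_root_of (z * t ^+ M) N0.
have l1 := powS mu al0; have l2 := zeroS be 0.
pose e : int := if 0 < m * n then 2 * m * n else - (2 * m * n).
have BE g (i r s : int) : hdact 1 0 0 1 (fun r : int => mu * al ^ r) (fun=> 0)
    (if 0 < m * n then b' q m n else F' q m n) g (i, r, s) = q ^ (e * r) * t * g (i, r, s).
  rewrite /e /t; case: ifP => _.
    rewrite (hdact_b' q0 al1 be1 xy1 l1 l2) subr0 [in RHS]mulr1.
    by congr (q ^ _ * _); ring.
  rewrite (hdact_F' q0 al1 be1 xy1 l1 l2) addr0 mulr0 subr0 [in LHS]mul1r.
  by congr (q ^ _ * _ * _); ring.
apply: (hdact_proper q0 al1 be1 xy1 l1 l2) => g [[i r] s].
  by rewrite (hdact_phi2 q0 al1 be1 xy1 l1 l2) mul0r.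
have phi1E g' i' r' s' := hdact_phi1 q0 al1 be1 xy1 l1 l2 g' i' r' s'.
rewrite (hdactB q0 al1 be1 xy1 l1 l2) (hdactZ q0 al1 be1 xy1 l1 l2).
rewrite (hdactX q0 al1 be1 xy1 l1 l2 (lam := fun r _ => mu * al ^ r) N phi1E).
rewrite (hdactX q0 al1 be1 xy1 l1 l2 (lam := fun r _ => q ^ (e * r) * t) M BE).
rewrite mulrA -mulrBl !exprMn muE !exprnP !exprz_exp.
have -> : 2 * m * m * r * N%:Z = e * r * M%:Z.
  transitivity (2 * m * r * (m * N%:Z)); first by ring.
  by rewrite MN /e; case: ifP => _; ring.
by ring.
Qed.

End ListedIdeals.

(** * The spectrum *)

Section Classification.
Context (k : closedFieldType) (q : k) (m n : int).
Hypotheses (qR : nonroot q) (m0 : m != 0) (n0 : n != 0).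
Local Notation A := (hd_alg (hd_one_neq0 qR m0 n0)).
Local Notation hd_spec := (@spec k A (phi1 q m n) (phi2 q m n)
  (if 0 < m * n then b' q m n else F' q m n)
  (if 0 < m * n then c' q m n else E' q m n) (m_d m n) (n_d m n)).

Lemma hd_prime_spec i : hd_prime q m n i = hd_spec i.
Proof.
case: i => [||||z|z] /=.
- reflexivity.
- exact: (@hd0_mul_span1 _ _ _ _ qR m0 n0).
- exact: (@hd0_mul_span1 _ _ _ _ qR m0 n0).
- exact: (@hd0_mul_span2 _ _ _ _ qR m0 n0).
- exact: etrans (@hd0_mul_span2 _ _ _ _ qR m0 n0 _ _) (@left_span2C k A _ _).
- exact: (@hd0_mul_span2 _ _ _ _ qR m0 n0).
Qed.

Let closed (g : {poly k}) : size g != 1%N -> exists z, root g z.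
Proof. by move/closed_rootP. Qed.

Lemma hd_primeP (P : set (hd q m n)) :
  prime_ideal P <-> exists i, P = hd_prime q m n i.
Proof.
have H : prime_ideal (P : set A) <-> exists i, (P : set A) = hd_spec i.
  exact: (hd_specP qR m0 n0 (hd_alg_rels qR m0 n0) (@hd_alg_gen _ _ _ _ qR m0 n0)
  closed (@J1_proper _ _ _ _ qR m0 n0) (@J2_proper _ _ _ _ qR m0 n0)
  (@I3_proper _ _ _ _ qR m0 n0) (@phi_pow_neq0 _ _ _ _ qR m0 n0) P).
split=> [pP|[i e]]; last exact: proj2 H (ex_intro _ i (etrans e (hd_prime_spec i))).
by have [i e] := proj1 H pP; exists i; apply: etrans e (esym (hd_prime_spec i)).
Qed.

Lemma hd_prime_sub i j : hd_prime q m n i `<=` hd_prime q m n j <->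
  clos_refl_trans _ (@hd_cover k) i j.
Proof.
rewrite !hd_prime_spec.
exact: (hd_spec_sub qR m0 n0 (hd_alg_rels qR m0 n0) (@hd_alg_gen _ _ _ _ qR m0 n0)
  closed (@J1_proper _ _ _ _ qR m0 n0) (@J2_proper _ _ _ _ qR m0 n0)
  (@I3_proper _ _ _ _ qR m0 n0) (@phi_pow_neq0 _ _ _ _ qR m0 n0)).
Qed.
End Classification.

Theorem theorem4p5 (k : closedFieldType) (char0 : [pchar k] =i pred0)
    (q : k) (q_neq0 : q != 0)
    (q_not_root_of_unity : forall r : nat, (0 < r)%N -> q ^+ r != 1)
    (m n : int) (m_neq0 : m != 0) (n_neq0 : n != 0) :
  [set P : set (hd q m n) | prime_ideal P] =
    [set [set 0]; hd0_mul (I1 q m n); hd0_mul (I2 q m n); hd0_mul (I3 q m n)]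
    `|` ([set hd0_mul (J1 q m n z) | z in [set z : k | z != 0]]
         `|` [set hd0_mul (J2 q m n z) | z in [set z : k | z != 0]])
  /\ (forall i j : hd_label k,
        hd_prime q m n i `<=` hd_prime q m n j
        <-> clos_refl_trans (hd_label k) (@hd_cover k) i j).
Proof.
have qR : nonroot q.
  split=> // [[[//|r]|r]] qr; first by have := q_not_root_of_unity r.+1 isT; rewrite -qr eqxx.
  have := q_not_root_of_unity r.+1 isT.
  by rewrite -(inj_eq invr_inj) invr1 -qr eqxx.
split; last exact: hd_prime_sub.
apply/seteqP; split=> P.
  case/(hd_primeP qR m_neq0 n_neq0) => [[||||z|z]] -> /=.
  - by left; left; left; left.
  - by left; left; left; right.
  - by left; left; right.
  - by left; right.
  - by right; left; exists (val z) => //; apply: (valP z).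
  - by right; right; exists (val z) => //; apply: (valP z).
move=> PE; apply/(hd_primeP qR m_neq0 n_neq0).
case: PE => [[[[|]|]|]|[[z z0]|[z z0]]].
- by exists (L0 k).
- by exists (LI1 k).
- by exists (LI2 k).
- by exists (LI3 k).
- by exists (LJ1 (exist _ z z0)).
- by exists (LJ2 (exist _ z z0)).
Qed.
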